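(* There exist an absolute constant $c>0$ and a deterministic algorithm such that, for every chaining functional $h$ of log-concave type with $|h'(1)|=1$ (left derivative), given a probability measure $\rho$ on an $n$-point metric space $(X,d)$, the algorithm finds, in $O(n^2\log n)$ time, a $\frac1{10}$-packing tree $\mathcal T$ on $(X,d)$ such that $$\delta_h(\rho,X)\;\le\;c\;\mathsf{val}_h(\mathcal T).$$
   Context: For $S,S'\subseteq X$: $\mathbf D(S)=\max_{u,v\in S}d(u,v)$, $d(S,S')=\min_{u\in S,v\in S'}d(u,v)$, and $B(x,r)=\{y\in X: d(x,y)\le r\}$. The metric space is given by its pairwise distances; arithmetic operations and evaluations of $h$ have unit cost. Chaining functional: let $f:[0,\infty)\to[0,\infty)$ be a continuous, non-increasing probability density on $[0,\infty)$ and let $F(s)=\int_s^\infty f(t)\,dt$. The chaining functional induced by $f$ is $h(p)=F^{-1}(p)$ for $p\in(0,1]$ (so $h(1)=0$ and $h$ is strictly decreasing and convex). It is of log-concave type if $f$ is log-concave. The normalization $|h'(1)|=1$ is equivalent to $f(0)=1$. For a probability measure $\rho$ on $X$, $\delta_h(\rho,X)=\min_{x\in X,\ \rho(x)>0}\int_0^\infty h(\rho(B(x,r)))\,dr$. Packing tree: let $\alpha\in(0,\frac1{10}]$. An $\alpha$-packing tree $\mathcal T$ on $(X,d)$ is a rooted tree whose nodes are subsets of $X$, with root node $W\subseteq X$, together with a labelling $\chi:\mathcal T\to\mathbb Z_{\ge0}$. Every leaf node is a singleton $\{x\}$, $x\in X$; $\mathrm{leaf}(\mathcal T)\subseteq X$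 is the union of all leaf nodes. Every node $V$ has a (possibly empty) set of children $C_1,\dots,C_k\subseteq V$ that are pairwise disjoint; $\deg_+(V)=k$ is the number of children. It is required that: (1) for any child $C$ of $V\in\mathcal T$, $\mathbf D(C)\le\alpha^{\chi(V)+1}\mathbf D(X)$; (2) for any $V\in\mathcal T$ and distinct children $C_1,C_2$ of $V$, $d(C_1,C_2)\ge\frac1{10}\alpha^{\chi(V)}\mathbf D(X)$. Its value is $$\mathsf{val}_h(\mathcal T)=\inf_{x\in\mathrm{leaf}(\mathcal T)}\ \sum_{V\in\mathcal P_x\setminus\{x\}}\alpha^{\chi(V)}\,\mathbf D(X)\,h(1/\deg_+(V)),$$ where $\mathcal P_x$ is the path of nodes from the root $W$ to the leaf $\{x\}$, and the sum is over the nodes on this path other than the leaf. *)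

(* Defs.v *)
From HB Require Import structures.
From mathcomp Require Import all_boot all_order all_algebra.
From mathcomp Require Import all_classical all_reals all_analysis.

Set Implicit Arguments.
Unset Strict Implicit.
Unset Printing Implicit Defensive.

Import Order.TTheory GRing.Theory Num.Theory.
Import numFieldNormedType.Exports.

Local Open Scope classical_set_scope.
Local Open Scope ring_scope.

(** * Finite metric spaces and probability measures on them *)

Record is_metric (R : realType) (X : finType) (d : X -> X -> R) : Prop := {
  metric_ge0 : forall x y, 0 <= d x y;
  metric_eq0 : forall x y, d x y = 0 <-> x = y;
  metric_sym : forall x y, d x y = d y x;
  metric_triangle : forall x y z, d x z <= d x y + d y z }.

Definition is_prob (R : realType) (X : finType) (rho : X -> R) : Prop :=
  (forall x, 0 <= rho x) /\ \sum_x rho x = 1.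

Definition mass (R : realType) (X : finType) (rho : X -> R) (S : {set X}) : R :=
  \sum_(x in S) rho x.

Definition cball (R : realType) (X : finType) (d : X -> X -> R) (x : X) (r : R)
  : {set X} := [set y | d x y <= r]%SET.

(* On nonempty finite sets, [sup] and [inf] are the maximum and minimum;
   both are 0 on empty sets. *)
Definition diam (R : realType) (X : finType) (d : X -> X -> R) (S : {set X}) : R :=
  sup [set r | exists u v, [/\ u \in S, v \in S & r = d u v]].

Definition setdist (R : realType) (X : finType) (d : X -> X -> R)
    (S S' : {set X}) : R :=
  inf [set r | exists u v, [/\ u \in S, v \in S' & r = d u v]].

(** * Chaining functionals *)

Definition chaining_density (R : realType) (f : R -> R) : Prop :=
  [/\ forall t : R, 0 <= t -> 0 <= f t,
      {within `[0, +oo[, continuous f},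
      forall s t : R, 0 <= s -> s <= t -> f t <= f s &
      (\int[lebesgue_measure]_(t in `[0%R, +oo[) (f t)%:E)%E = 1%E].

(* [h] is [F^-1] on (0,1], where [F s] is the integral of [f] over [s, +oo[;
   only the values of [h] on (0,1] are constrained. *)
Definition induced_by (R : realType) (f h : R -> R) : Prop :=
  forall p : R, 0 < p -> p <= 1 ->
    0 <= h p /\
    (\int[lebesgue_measure]_(t in `[h p, +oo[) (f t)%:E)%E = p%:E.

(* [powR] satisfies [0 `^ 0 = 1], so zeros of [f] are handled as usual. *)
Definition log_concave (R : realType) (f : R -> R) : Prop :=
  forall s t l : R, 0 <= s -> 0 <= t -> 0 <= l -> l <= 1 ->
    f s `^ l * f t `^ (1 - l) <= f (l * s + (1 - l) * t).

Definition log_concave_chaining_functional (R : realType) (h : R -> R) : Prop :=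
  exists f, [/\ chaining_density f, log_concave f & induced_by f h].

Definition normalized_at1 (R : realType) (h : R -> R) : Prop :=
  exists2 l : R, (h p - h 1) / (p - 1) @[p --> 1^'-] --> l & `|l| = 1.

Definition delta (R : realType) (X : finType) (d : X -> X -> R) (h : R -> R)
    (rho : X -> R) : \bar R :=
  ereal_inf [set (\int[lebesgue_measure]_(r in `[0%R, +oo[)
                    (h (mass rho (cball d x r)))%:E)%E | x in [set x | 0 < rho x]].

(** * Packing trees *)

Inductive ptree (X : finType) : Type :=
  PNode of {set X} & nat & seq (ptree X).

Definition node_set (X : finType) (t : ptree X) : {set X} :=
  let: PNode V _ _ := t in V.
Definition label (X : finType) (t : ptree X) : nat :=
  let: PNode _ chi _ := t in chi.
Definition children (X : finType) (t : ptree X) : seq (ptree X) :=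
  let: PNode _ _ cs := t in cs.
Definition outdeg (X : finType) (t : ptree X) : nat := size (children t).
Definition is_leaf (X : finType) (t : ptree X) : bool := nilp (children t).

Fixpoint node_sets (X : finType) (t : ptree X) : seq {set X} :=
  let: PNode V _ cs := t in V :: flatten (map (@node_sets X) cs).

Fixpoint every_node (X : finType) (Q : ptree X -> Prop) (t : ptree X) : Prop :=
  let: PNode _ _ cs := t in Q t /\ foldr and True (map (every_node Q) cs).

Fixpoint leaf_set (X : finType) (t : ptree X) : {set X} :=
  let: PNode V _ cs := t in
  if cs is [::] then V else (\bigcup_(S <- map (@leaf_set X) cs) S)%SET.

(* The nodes of a packing tree are subsets of [X]; [uniq] says that distinct
   nodes are distinct sets. *)
Definition packing_tree (R : realType) (X : finType) (d : X -> X -> R)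
    (alpha : R) (t : ptree X) : Prop :=
  let D := diam d [set: X]%SET in
  uniq (node_sets t) /\
  every_node (fun v =>
    let cs := map (@node_set X) (children v) in
    [/\ is_leaf v -> exists x, node_set v = [set x]%SET,
        all (fun C : {set X} => C \subset node_set v) cs,
        pairwise (fun C1 C2 : {set X} => (C1 :&: C2 == finset.set0)%SET) cs,
        all (fun C : {set X} => diam d C <= alpha ^+ (label v).+1 * D) cs &
        pairwise (fun C1 C2 : {set X} =>
          10%:R^-1 * alpha ^+ label v * D <= setdist d C1 C2) cs]) t.

(* The nodes above the leaf [{x}] (inclusive), from the root down. *)
Fixpoint path_to (X : finType) (x : X) (t : ptree X) : seq (ptree X) :=
  let: PNode _ _ cs := t in
  if x \in leaf_set t then t :: flatten (map (path_to x) cs) else [::].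

Definition tree_val (R : realType) (X : finType) (d : X -> X -> R)
    (alpha : R) (h : R -> R) (t : ptree X) : R :=
  inf [set \sum_(v <- path_to x t | ~~ is_leaf v)
             alpha ^+ label v * diam d [set: X]%SET * h (1 / (outdeg v)%:R)
      | x in [set x | x \in leaf_set t]].

(** * A real random access machine with an oracle

   Programs are finite and do not depend on the input or on its size. The
   memory consists of arrays of natural numbers and arrays of reals. Reals can
   only be added, subtracted, multiplied, divided, compared and passed to the
   oracle; in particular they cannot be rounded, nor used as addresses. *)

Inductive nexp : Type :=
  | NConst of nat
  | NLoad of nat & nexp                    (* array, index *)
  | NAdd of nexp & nexp
  | NSub of nexp & nexp                    (* truncated *)
  | NMul of nexp & nexp.

Inductive rexp : Type :=
  | ROfNat of nexp
  | RLoad of nat & nexp                    (* array, index *)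
  | RAdd of rexp & rexp
  | RSub of rexp & rexp
  | RMul of rexp & rexp
  | RDiv of rexp & rexp
  | ROracle of rexp.

Inductive bexp : Type :=
  | BNle of nexp & nexp
  | BRle of rexp & rexp
  | BNot of bexp
  | BAnd of bexp & bexp.

Inductive cmd : Type :=
  | CSkip
  | CNStore of nat & nexp & nexp           (* array, index, value *)
  | CRStore of nat & nexp & rexp           (* array, index, value *)
  | CSeq of cmd & cmd
  | CIf of bexp & cmd & cmd
  | CWhile of bexp & cmd.

Record state (R : realType) : Type := State {
  nmem : nat -> nat -> nat;                (* array, index *)
  rmem : nat -> nat -> R }.

Fixpoint neval (R : realType) (s : state R) (e : nexp) : nat :=
  match e with
  | NConst k => k
  | NLoad a i => nmem s a (neval s i)
  | NAdd e1 e2 => (neval s e1 + neval s e2)%N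
  | NSub e1 e2 => (neval s e1 - neval s e2)%N
  | NMul e1 e2 => (neval s e1 * neval s e2)%N
  end.

Fixpoint reval (R : realType) (h : R -> R) (s : state R) (e : rexp) : R :=
  match e with
  | ROfNat e1 => (neval s e1)%:R
  | RLoad a i => rmem s a (neval s i)
  | RAdd e1 e2 => reval h s e1 + reval h s e2
  | RSub e1 e2 => reval h s e1 - reval h s e2
  | RMul e1 e2 => reval h s e1 * reval h s e2
  | RDiv e1 e2 => reval h s e1 / reval h s e2
  | ROracle e1 => h (reval h s e1)
  end.

Fixpoint beval (R : realType) (h : R -> R) (s : state R) (b : bexp) : bool :=
  match b with
  | BNle e1 e2 => (neval s e1 <= neval s e2)%N
  | BRle e1 e2 => reval h s e1 <= reval h s e2
  | BNot b1 => ~~ beval h s b1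
  | BAnd b1 b2 => beval h s b1 && beval h s b2
  end.

Fixpoint ncost (e : nexp) : nat :=
  match e with
  | NConst _ => 1
  | NLoad _ i => (ncost i).+1
  | NAdd e1 e2 | NSub e1 e2 | NMul e1 e2 => (ncost e1 + ncost e2).+1
  end.

Fixpoint rcost (e : rexp) : nat :=
  match e with
  | ROfNat e1 => (ncost e1).+1
  | RLoad _ i => (ncost i).+1
  | RAdd e1 e2 | RSub e1 e2 | RMul e1 e2 | RDiv e1 e2 =>
      (rcost e1 + rcost e2).+1
  | ROracle e1 => (rcost e1).+1
  end.

Fixpoint bcost (b : bexp) : nat :=
  match b with
  | BNle e1 e2 => (ncost e1 + ncost e2).+1
  | BRle e1 e2 => (rcost e1 + rcost e2).+1
  | BNot b1 => (bcost b1).+1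
  | BAnd b1 b2 => (bcost b1 + bcost b2).+1
  end.

Definition upd (T : Type) (m : nat -> nat -> T) (a i : nat) (v : T)
  : nat -> nat -> T :=
  fun a' i' => if (a' == a) && (i' == i) then v else m a' i'.

Definition nstore (R : realType) (s : state R) (a i v : nat) : state R :=
  State (upd (nmem s) a i v) (rmem s).
Definition rstore (R : realType) (s : state R) (a i : nat) (v : R) : state R :=
  State (nmem s) (upd (rmem s) a i v).

(* [exec h c s t s']: run from [s] with oracle [h], the program [c] halts in
   state [s'] after [t] elementary operations. *)
Inductive exec (R : realType) (h : R -> R)
  : cmd -> state R -> nat -> state R -> Prop :=
  | ESkip s : exec h CSkip s 1 s
  | ENStore a i e s :
      exec h (CNStore a i e) s (ncost i + ncost e).+1
        (nstore s a (neval s i) (neval s e))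
  | ERStore a i e s :
      exec h (CRStore a i e) s (ncost i + rcost e).+1
        (rstore s a (neval s i) (reval h s e))
  | ESeq c1 c2 s t1 s1 t2 s2 :
      exec h c1 s t1 s1 -> exec h c2 s1 t2 s2 ->
      exec h (CSeq c1 c2) s (t1 + t2) s2
  | EIf b c1 c2 s t s1 :
      exec h (if beval h s b then c1 else c2) s t s1 ->
      exec h (CIf b c1 c2) s (bcost b + t).+1 s1
  | EWhileF b c s :
      beval h s b = false -> exec h (CWhile b c) s (bcost b).+1 s
  | EWhileT b c s t1 s1 t2 s2 :
      beval h s b = true -> exec h c s t1 s1 ->
      exec h (CWhile b c) s1 t2 s2 ->
      exec h (CWhile b c) s (bcost b + t1 + t2).+1 s2.

Lemma exec_det (R : realType) (h : R -> R) c s t1 s1 t2 s2 :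
  exec h c s t1 s1 -> exec h c s t2 s2 -> t1 = t2 /\ s1 = s2.
Proof.
move=> H1; elim: H1 t2 s2 => {c s t1 s1}.
- by move=> s t2 s2 H; inversion H.
- by move=> a i e s t2 s2 H; inversion H.
- by move=> a i e s t2 s2 H; inversion H.
- move=> c1 c2 s ta sa tb sb _ IH1 _ IH2 t2 s2 H.
  inversion H as [| | |? ? ? ? ? ? ? Ha Hb| | |]; subst.
  by have [? ?] := IH1 _ _ Ha; subst; have [-> ->] := IH2 _ _ Hb.
- move=> b c1 c2 s t s1 _ IH t2 s2 H.
  inversion H as [| | | |? ? ? ? ? ? Ha| |]; subst.
  by have [-> ->] := IH _ _ Ha.
- move=> b c s Hb t2 s2 H.
  by inversion H as [| | | | | |? ? ? ? ? ? ? Hb']; subst => //;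
     rewrite Hb in Hb'.
- move=> b c s ta sa tb sb Hb _ IH1 _ IH2 t2 s2 H.
  inversion H as [| | | | |? ? ? Hb'|? ? ? ? ? ? ? Hb' Hc Hw]; subst.
    by rewrite Hb in Hb'.
  by have [? ?] := IH1 _ _ Hc; subst; have [-> ->] := IH2 _ _ Hw.
Qed.

(* Input: [n] in cell 0 of the natural array 0, [d i j] in cell [i * n + j] of
   the real array 0, [rho i] in cell [i] of the real array 1; all other cells
   are 0. *)
Definition input (R : realType) (n : nat) (d : 'I_n -> 'I_n -> R)
    (rho : 'I_n -> R) : state R :=
  State
    (fun a k => if (a == 0)%N && (k == 0)%N then n else 0%N)
    (fun a k =>
       match a with
       | 0%N => if (insub (k %/ n)%N, insub (k %% n)%N) is (Some i, Some j)
                then d i j else 0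
       | 1%N => if insub k is Some i then rho i else 0
       | _ => 0
       end).

Definition out_root : nat := 1.
Definition out_member : nat := 2.
Definition out_label : nat := 3.
Definition out_child : nat := 4.
Definition out_sibling : nat := 5.

(* Output: nodes have positive addresses. The natural arrays [out_label],
   [out_child], [out_sibling] hold at index [p] the label, the address of the
   first child and the address of the next sibling of node [p] (0 if there is
   none); row [p] of the [out_member] matrix, of width [n], is the indicator
   of its subset of ['I_n]. *)
Fixpoint stored_at (R : realType) (n : nat) (s : state R) (p : nat)
    (t : ptree 'I_n) : Prop :=
  let: PNode V chi cs := t in
  [/\ (0 < p)%N,
      forall x : 'I_n, nmem s out_member (p * n + x)%N = (x \in V),
      nmem s out_label p = chi &
      (fix siblings (q : nat) (ts : seq (ptree 'I_n)) : Prop :=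
         if ts is t' :: ts'
         then stored_at s q t' /\ siblings (nmem s out_sibling q) ts'
         else q = 0%N)
      (nmem s out_child p) cs].

Definition outputs (R : realType) (n : nat) (s : state R) (t : ptree 'I_n)
  : Prop := stored_at s (nmem s out_root 0) t.

(* Main.v *)
Require Import Defs.
From mathcomp Require Import all_boot all_order all_algebra.
From mathcomp Require Import all_classical all_reals all_analysis.
From mathcomp Require Import measurable_realfun.
From mathcomp Require Import ring lra zify.

(** The tree is built from the root down, its nodes having radii that shrink by a
    factor 10 from level to level. A node is a set [W] of points of positive mass
    and of diameter of order [r]. To choose its children, centers are picked
    greedily in [W], each time a point with the heaviest ball of radius [r / 20]
    among those farther than [3 r / 10] from the earlier centers. After the [k]-th
    pick, with [w] the mass of [W] and [q] that of the last ball: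

    - If [h (q / w) <= 42 h (1 / k)], the node branches into the [k] balls, which
      are far apart. On entering any of them the entropy integral grows by at most
      a multiple of [r h (1 / k)], the gain of the node ([node_inv_split]).

    - Otherwise, if the last piece, the large ball of the last center minus the
      earlier ones, has mass at least [w / (k (k + 1))], this piece is the only
      child. The loss of mass costs at most about [2 h (1 / k)], and is
      owed: all small balls in the child have mass at most [q], so that the next
      step loses enough mass for what is charged to it to cover the debt as well
      ([node_inv_single]).

    - Otherwise another center is picked. The pieces passed over have total mass at
      most [w k / (k + 1)], so a free point remains ([covered_bound]).

    The only analysis behind this is that [h] is nonnegative and nonincreasing, that
    [h 1 = 0], and that [h (p q) <= h p + h q]: the survival function of a
    log-concave density is submultiplicative ([survival_submul]).

    Logarithmically many levels suffice. Let [E] be the eccentricity of an arbitrary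
    point, so that the diameter is between [E] and [2 E]. When the radius is at most
    [E / n], the heaviest point of the node has a proportion at least [1 / n], and
    ending the path there adds only a multiple of [E h (1/2)] to the entropy
    integral ([node_inv_final]). So a leaf of value [v] gives
    [delta <= 130 E h (1/2) + 1680 v]. If all leaves have value at least [E h (1/2)],
    the tree is good ([main_tree_good]). If some leaf has a smaller value, then
    [delta <= 1810 E h (1/2)], and a root with two leaves at distance [E] is a good
    tree ([fallback_good]).

    Two nodes of the tree must not be the same set. When the only child would be the
    node itself, the radius of the node is divided by 10 in place.

    Processing a node takes [O(n)] time per point of the node: there are at most as
    many picks as points, each followed by a scan of the space. Nodes of the same
    level are disjoint, whence [O(n^2)] time per level and [O(n^2 log n)] in all; the
    bookkeeping is a potential counting, for each point of a waiting node, the levels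
    that remain ([weight]). *)

Set Implicit Arguments.
Unset Strict Implicit.
Unset Printing Implicit Defensive.

Import Order.TTheory GRing.Theory Num.Theory.
Import numFieldNormedType.Exports.

Local Open Scope ring_scope.

(** * The chaining functional of a log-concave density *)

Section ChainingFunctional.
Variables (R : realType) (f : R -> R).
Hypothesis f_density : chaining_density f.
Hypothesis f_logconcave : log_concave f.

Local Notation mu := (@lebesgue_measure R).

Let f_ge0 t : 0 <= t -> 0 <= f t.
Proof. by case: f_density => H _ _ _; apply: H. Qed.

Let f_noninc s t : 0 <= s -> s <= t -> f t <= f s.
Proof. by case: f_density => _ _ H _; apply: H. Qed.

Definition tail (s : R) : \bar R :=
  (\int[mu]_(t in `[s, +oo[) (f t)%:E)%E.

Let tail0 : tail 0 = 1%E.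
Proof. by case: f_density. Qed.

Lemma measurable_density (D : set R) :
  measurable D -> (D `<=` `[0, +oo[)%classic -> measurable_fun D f.
Proof.
move=> mD D0.
apply: (@eq_measurable_fun _ _ (measurableTypeR R) (measurableTypeR R) D (fun t => f (Num.max t 0))).
  move=> t; rewrite inE => /D0 /=; rewrite in_itv /= andbT => t0.
  by rewrite (max_idPl t0).
apply: nonincreasing_measurable => // s t st; apply: f_noninc.
  by rewrite le_max lexx orbT.
by rewrite ge_max !le_max st lexx orbT.
Qed.

Lemma lebesgue_measure_shift (a : R) (A : set R) : measurable A ->
  pushforward mu (fun t : measurableTypeR R => a + t : measurableTypeR R) A = mu A.
Proof.
have ma : measurable_fun setT (fun t : measurableTypeR R => a + t : measurableTypeR R).
  by apply: measurable_funD.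
move=> mA; apply/esym.
apply: (@lebesgue_measure_unique _ (pushforward mu _)) => //= _ [[b c]] _ <-.
rewrite /pushforward.
have -> : ((fun t : R => a + t) @^-1` `]b, c] = `]b - a, c - a])%classic.
  by apply/seteqP; split=> t /=; rewrite !in_itv /= ltrBlDl lerBrDl.
rewrite !lebesgue_measure_itv /= !lte_fin ltrD2r.
by case: ifP => // _; rewrite -!EFinB; congr (_%:E); ring.
Qed.

Lemma integral_shift (a : R) (D : set R) (g : R -> R) :
  measurable D -> measurable_fun D g ->
  (forall t, D t -> 0 <= g t) ->
  (\int[mu]_(t in D) (g t)%:E =
   \int[mu]_(t in (fun t : R => (a + t)%R) @^-1` D) (g (a + t)%R)%:E)%E.
Proof.
move=> mD mg g0.
have ma : measurable_fun setT (fun t : measurableTypeR R => a + t : measurableTypeR R).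
  by apply: measurable_funD.
rewrite -(@ge0_integral_pushforward _ _ (measurableTypeR R) (measurableTypeR R)
  R _ ma mu D (EFin \o g)) //.
- by apply: eq_measure_integral => //= A mA AS; apply/esym/lebesgue_measure_shift.
- exact/measurable_EFinP.
- by move=> y; rewrite inE => /g0; rewrite lee_fin.
Qed.

Lemma tail_split s t : 0 <= s -> s <= t ->
  tail s = ((\int[mu]_(u in `[s, t[) (f u)%:E) + tail t)%E.
Proof.
move=> s0 st.
have eqU : (`[s, +oo[ : set R)%classic = (`[s, t[ `|` `[t, +oo[)%classic.
  apply/seteqP; split=> u /=; rewrite !in_itv /= ?andbT.
    by move=> su; case: (ltP u t) => ut; [left; rewrite su|right].
  by case=> [/andP[]//|]; apply: le_trans.
have sub0 : (`[s, +oo[ `<=` `[0, +oo[)%classic.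
  by move=> u /=; rewrite !in_itv /= !andbT; apply: le_trans.
rewrite /tail {1}eqU ge0_integral_setU //.
- by rewrite -eqU; apply/measurable_EFinP; apply: measurable_density.
- rewrite -eqU => u /sub0 /=; rewrite in_itv /= andbT => u0.
  by rewrite lee_fin f_ge0.
- rewrite disj_set2E; apply/eqP/seteqP; split=> u //= [].
  by rewrite !in_itv /= andbT => /andP[_ ut] tu; move: (lt_le_trans ut tu); rewrite ltxx.
Qed.

Lemma tail_ge0 s : 0 <= s -> (0 <= tail s)%E.
Proof.
move=> s0; apply: integral_ge0 => u /=; rewrite in_itv /= andbT => su.
by rewrite lee_fin f_ge0 // (le_trans s0).
Qed.

Lemma slab_ge0 s t : 0 <= s -> (0 <= \int[mu]_(u in `[s, t[) (f u)%:E)%E.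
Proof.
move=> s0; apply: integral_ge0 => u /=; rewrite in_itv /= => /andP[su _].
by rewrite lee_fin f_ge0 // (le_trans s0).
Qed.

Lemma tail_noninc s t : 0 <= s -> s <= t -> (tail t <= tail s)%E.
Proof. by move=> s0 st; rewrite (tail_split s0 st) leeDr // slab_ge0. Qed.

Lemma tail_fin s : 0 <= s -> tail s \is a fin_num.
Proof.
move=> s0; rewrite ge0_fin_numE ?tail_ge0 //.
by apply: (@le_lt_trans _ _ 1%E); rewrite ?ltey // -tail0; apply: tail_noninc.
Qed.

Definition survival s : R := fine (tail s).

Lemma survivalE s : 0 <= s -> tail s = (survival s)%:E.
Proof. by move=> s0; rewrite /survival fineK // tail_fin. Qed.

Lemma survival0 : survival 0 = 1.
Proof. by rewrite /survival tail0. Qed.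

Lemma survival_noninc s t : 0 <= s -> s <= t -> survival t <= survival s.
Proof.
move=> s0 st; rewrite -lee_fin -!survivalE ?tail_noninc //.
exact: le_trans st.
Qed.

Lemma slabE s t : 0 <= s -> s <= t ->
  (\int[mu]_(u in `[s, t[) (f u)%:E)%E = (survival s - survival t)%:E.
Proof.
move=> s0 st; have t0 := le_trans s0 st.
have := tail_split s0 st; rewrite !survivalE // EFinB => ->.
by rewrite addeK.
Qed.

Lemma slab_ge s t : 0 <= s -> s <= t ->
  (t - s) * f t <= survival s - survival t.
Proof.
move=> s0 st; have t0 := le_trans s0 st.
rewrite -lee_fin -slabE //.
have -> : ((t - s) * f t)%:E = (\int[mu]_(u in `[s, t[) (f t)%:E)%E.
  rewrite integral_cst //= lebesgue_measure_itv /= lte_fin.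
  move: st; rewrite le_eqVlt => /predU1P[->|st].
    by rewrite ltxx mule0 subrr mul0r.
  by rewrite st -EFinB -EFinM mulrC.
apply: ge0_le_integral => //.
- by move=> u _; rewrite lee_fin f_ge0.
- apply/measurable_EFinP; apply: measurable_density => // u /=.
  by rewrite !in_itv /= andbT => /andP[su _]; apply: le_trans su.
- move=> u /=; rewrite in_itv /= => /andP[su ut].
  by rewrite lee_fin f_noninc ?(ltW ut) // (le_trans s0).
Qed.

Lemma survival_eq0 t : 0 <= t -> f t = 0 -> survival t = 0.
Proof.
move=> t0 ft.
rewrite /survival /tail integral0_eq //= => u; rewrite in_itv /= andbT => tu.
have u0 := le_trans t0 tu.
have fu : f u = 0.
  by apply/eqP; rewrite eq_le f_ge0 // andbT -ft f_noninc.
by rewrite fu.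
Qed.

(** Between [s] and [t] the tail loses at least [(t - s) * f t]. If it loses
    nothing then [f t = 0], and [f] vanishes from [t] on. *)
Lemma survival_inj s t : 0 <= s -> s < t -> survival s <= survival t ->
  survival t = 0.
Proof.
move=> s0 st le_st; have t0 : 0 <= t by apply: le_trans (ltW st).
have := slab_ge s0 (ltW st).
rewrite -subr_le0 in le_st => /le_trans/(_ le_st).
rewrite pmulr_rle0 ?subr_gt0 // => ft.
by apply: survival_eq0 => //; apply/eqP; rewrite eq_le ft f_ge0.
Qed.

(** The outer pair [s], [a + t] and the inner pair [a + s], [t] have the same sum,
    so both inner points are mixtures of the outer ones with weights [l] and
    [1 - l]; multiplying the two log-concavity inequalities removes the powers. *)
Lemma density_exchange a s t : 0 <= a -> 0 <= s -> s <= t ->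
  f (a + t) * f s <= f (a + s) * f t.
Proof.
move=> a0 s0 st.
have t0 := le_trans s0 st.
have [ast|ast] := eqVneq (a + t - s) 0.
  have -> : a = 0 by apply/eqP; rewrite eq_le a0 andbT; lra.
  have -> : t = s by apply/eqP; rewrite eq_le st andbT; lra.
  by rewrite !add0r.
have d0 : 0 < a + t - s by rewrite lt_def ast /=; lra.
pose l := (t - s) / (a + t - s).
have l0 : 0 <= l by apply: divr_ge0; lra.
have l1 : l <= 1 by rewrite ler_pdivrMr // mul1r; lra.
have at0 : 0 <= a + t by lra.
have e1 : l * s + (1 - l) * (a + t) = a + s by rewrite /l; field.
have e2 : l * (a + t) + (1 - l) * s = t by rewrite /l; field.
have := f_logconcave s0 at0 l0 l1; rewrite e1 => h1.
have := f_logconcave at0 s0 l0 l1; rewrite e2 => h2.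
have p1 (x : R) : 0 <= x -> x `^ l * x `^ (1 - l) = x.
  move=> x0; rewrite -powRD; last by rewrite addrC subrK oner_eq0.
  by rewrite addrC subrK powRr1.
have pp (x y u v : R) : 0 <= x `^ u * y `^ v by rewrite mulr_ge0 ?powR_ge0.
have := ler_pM (pp _ _ _ _) (pp _ _ _ _) h1 h2; apply: le_trans.
rewrite -[in X in X <= _](p1 _ (f_ge0 s0)) -[in X in X <= _](p1 _ (f_ge0 at0)).
by rewrite le_eqVlt; apply/orP; left; apply/eqP; ring.
Qed.

(** [density_exchange] integrated over the points beyond [b]. *)
Lemma tail_ratio a b : 0 <= a -> 0 <= b ->
  survival (a + b) * f b <= f (a + b) * survival b.
Proof.
move=> a0 b0; have ab0 : 0 <= a + b by lra.
rewrite -lee_fin !EFinM -!survivalE // muleC /tail.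
have pre : ((fun t : R => a + t) @^-1` `[a + b, +oo[ = `[b, +oo[)%classic.
  by apply/seteqP; split=> t /=; rewrite !in_itv /= !andbT lerD2l.
have sub0 (c : R) : 0 <= c -> (`[c, +oo[ `<=` `[0, +oo[)%classic.
  by move=> c0 u /=; rewrite !in_itv /= !andbT; apply: le_trans.
have mf : measurable_fun `[b, +oo[%classic f by apply: measurable_density; auto.
have mfab : measurable_fun `[b, +oo[%classic (fun t => f (a + t)).
  apply: (@eq_measurable_fun _ _ (measurableTypeR R) (measurableTypeR R)
    _ (fun t => f (a + Num.max t 0))).
    move=> t; rewrite inE /= in_itv /= andbT => bt.
    by rewrite (max_idPl (le_trans b0 bt)).
  apply: nonincreasing_measurable => // s t st; apply: f_noninc.
    by rewrite addr_ge0 // le_max lexx orbT.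
  by rewrite lerD2l ge_max !le_max st lexx orbT.
rewrite (@integral_shift a) // ?pre; last 2 first.
- by apply: measurable_density; auto.
- by move=> t /=; rewrite in_itv /= andbT => bt; rewrite f_ge0 // (le_trans ab0).
rewrite -!ge0_integralZl_EFin ?f_ge0 //; last 4 first.
- by move=> t /=; rewrite in_itv /= andbT => bt; rewrite lee_fin f_ge0 // (le_trans b0).
- exact/measurable_EFinP.
- by move=> t /=; rewrite in_itv /= andbT => bt; rewrite lee_fin f_ge0; lra.
- exact/measurable_EFinP.
apply: ge0_le_integral => //.
- move=> t /=; rewrite in_itv /= andbT => bt.
  by rewrite -EFinM lee_fin mulr_ge0 ?f_ge0 //; lra.
- by apply/measurable_EFinP; apply: measurable_funM.
- by apply/measurable_EFinP; apply: measurable_funM.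
- move=> t /=; rewrite in_itv /= andbT => bt.
  by rewrite -!EFinM lee_fin mulrC density_exchange.
Qed.

(** [density_exchange] integrated over the points before [b]. *)
Lemma slab_ratio a b : 0 <= a -> 0 <= b ->
  f (a + b) * (1 - survival b) <= f b * (survival a - survival (a + b)).
Proof.
move=> a0 b0; have ab0 : 0 <= a + b by lra.
rewrite -{1}survival0 -lee_fin !EFinM -!slabE //; last by lra.
have pre : ((fun t : R => a + t) @^-1` `[a, a + b[ = `[0, b[)%classic.
  by apply/seteqP; split=> t /=; rewrite !in_itv /= ltrD2l lerDl.
have mf : measurable_fun `[0, b[%classic f.
  apply: measurable_density => // u /=.
  by rewrite !in_itv /= andbT => /andP[].
have mfab : measurable_fun `[0, b[%classic (fun t => f (a + t)).
  apply: (@eq_measurable_fun _ _ (measurableTypeR R) (measurableTypeR R)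
    _ (fun t => f (a + Num.max t 0))).
    move=> t; rewrite inE /= in_itv /= => /andP[bt _].
    by rewrite (max_idPl bt).
  apply: nonincreasing_measurable => // s t st; apply: f_noninc.
    by rewrite addr_ge0 // le_max lexx orbT.
  by rewrite lerD2l ge_max !le_max st lexx orbT.
rewrite [in leRHS](@integral_shift a) // ?pre; last 2 first.
- apply: measurable_density => // u /=.
  by rewrite !in_itv /= andbT => /andP[au _]; apply: le_trans au.
- by move=> t /=; rewrite in_itv /= => /andP[bt _]; rewrite f_ge0 // (le_trans a0).
rewrite -!ge0_integralZl_EFin ?f_ge0 //; last 4 first.
- by move=> t /=; rewrite in_itv /= => /andP[bt _]; rewrite lee_fin f_ge0; lra.
- exact/measurable_EFinP.
- by move=> t /=; rewrite in_itv /= => /andP[bt _]; rewrite lee_fin f_ge0.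
- exact/measurable_EFinP.
apply: ge0_le_integral => //.
- move=> t /=; rewrite in_itv /= => /andP[bt _].
  by rewrite -EFinM lee_fin mulr_ge0 ?f_ge0 //; lra.
- by apply/measurable_EFinP; apply: measurable_funM.
- by apply/measurable_EFinP; apply: measurable_funM.
- move=> t /=; rewrite in_itv /= => /andP[bt tb].
  by rewrite -!EFinM lee_fin [leRHS]mulrC density_exchange // ltW.
Qed.

(** In the language of reliability, a log-concave lifetime is new better than
    used. By [tail_ratio] and [slab_ratio], [f (a + b) / f b] is at
    least the factor by which a shift by [a] multiplies the tail beyond [b], and
    at most the factor by which it multiplies the mass before [b]; comparing the
    two factors gives the claim. *)
Lemma survival_submul a b : 0 <= a -> 0 <= b ->
  survival (a + b) <= survival a * survival b.
Proof.
move=> a0 b0; have ab0 : 0 <= a + b by lra.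
have Sge0 c : 0 <= c -> 0 <= survival c by move=> c0; rewrite fine_ge0 ?tail_ge0.
have Sb := Sge0 b b0; have Sa := Sge0 a a0.
have := tail_ratio a0 b0; have := slab_ratio a0 b0.
have Sab : survival (a + b) <= survival b by apply: survival_noninc => //; lra.
have [fb0|fb0] := eqVneq (f b) 0.
  have Sb0 : survival b = 0 by apply: survival_eq0.
  by move=> _ _; rewrite Sb0 mulr0 -[leRHS]Sb0.
have fb : 0 < f b by rewrite lt_def fb0 f_ge0.
move=> h1 h2.
have h3 : f (a + b) * (1 - survival b) * survival b
  <= f b * (survival a - survival (a + b)) * survival b by rewrite ler_wpM2r.
have S1 : survival b <= 1 by rewrite -survival0; apply: survival_noninc.
have h4 : survival (a + b) * f b * (1 - survival b)
  <= f (a + b) * survival b * (1 - survival b) by rewrite ler_wpM2r // subr_ge0.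
rewrite -(ler_pM2l fb); lra.
Qed.

Variable h : R -> R.
Hypothesis h_induced : induced_by f h.

Let h_ge0 p : 0 < p -> p <= 1 -> 0 <= h p.
Proof. by move=> p0 p1; case: (h_induced p0 p1). Qed.

Let survival_h p : 0 < p -> p <= 1 -> survival (h p) = p.
Proof.
by move=> p0 p1; case: (h_induced p0 p1) => _; rewrite /survival /tail => ->.
Qed.

(* The survival function is flat only where it vanishes, hence comparing tails at
   positive values compares the arguments. *)
Let le_of_survival p x : 0 < p -> p <= 1 -> 0 <= x -> survival x <= p -> h p <= x.
Proof.
move=> p0 p1 x0 xp; rewrite leNgt; apply/negP => xh.
have := survival_inj x0 xh; rewrite survival_h // => /(_ xp) p_eq0.
by rewrite p_eq0 ltxx in p0.
Qed.

Lemma chaining_at1 : h 1 = 0.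
Proof.
apply/eqP; rewrite eq_le h_ge0 ?ltr01 // andbT.
by apply: le_of_survival; rewrite ?ltr01 ?survival0.
Qed.

Lemma chaining_noninc (p q : R) : 0 < p -> p <= q -> q <= 1 -> h q <= h p.
Proof.
move=> p0 pq q1; have q0 := lt_le_trans p0 pq; have p1 := le_trans pq q1.
by apply: le_of_survival; rewrite ?h_ge0 ?survival_h.
Qed.

Lemma chaining_submul (p q : R) : 0 < p -> p <= 1 -> 0 < q -> q <= 1 ->
  h (p * q) <= h p + h q.
Proof.
move=> p0 p1 q0 q1.
have := survival_submul (h_ge0 p0 p1) (h_ge0 q0 q1).
rewrite (survival_h p0 p1) (survival_h q0 q1); apply: le_of_survival.
- exact: mulr_gt0.
- by rewrite mulr_ile1 // ltW.
- by rewrite addr_ge0 ?h_ge0.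
Qed.
End ChainingFunctional.

(** Log-concavity enters the construction of the tree through [sf_submul]: it is
    submultiplicativity of the survival function, read through its inverse. It
    says that the cost of a loss of mass in two steps is at most the sum of the
    costs of the steps. *)
Record submultiplicative_functional (R : realType) (h : R -> R) : Prop := {
  sf_ge0 : forall p : R, 0 < p -> p <= 1 -> 0 <= h p;
  sf_at1 : h 1 = 0;
  sf_noninc : forall p q : R, 0 < p -> p <= q -> q <= 1 -> h q <= h p;
  sf_submul : forall p q : R, 0 < p -> p <= 1 -> 0 < q -> q <= 1 ->
    h (p * q) <= h p + h q }.

Lemma log_concave_submultiplicative (R : realType) (h : R -> R) :
  log_concave_chaining_functional h -> submultiplicative_functional h.
Proof.
case=> f [fd fl fh]; split.
- by move=> p p0 p1; case: (fh p p0 p1).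
- exact (chaining_at1 fd fh).
- exact (chaining_noninc fd fh).
- exact (chaining_submul fd fl fh).
Qed.

Lemma functional_inv_ge0 (R : realType) (h : R -> R) (k : nat) :
  submultiplicative_functional h -> (0 < k)%N -> 0 <= h (1 / k%:R).
Proof.
move=> h_sf k0; apply: (sf_ge0 h_sf); first by rewrite divr_gt0 ?ltr0n.
by rewrite ler_pdivrMr ?ltr0n // mul1r ler1n.
Qed.

(** * Entropy integrals along shrinking sets *)

Section Geometry.
Variables (R : realType) (X : finType) (d : X -> X -> R) (rho : X -> R).
Variable h : R -> R.
Hypothesis d_metric : is_metric d.
Hypothesis rho_prob : is_prob rho.
Hypothesis h_sf : submultiplicative_functional h.

Local Notation mu := (@lebesgue_measure R).
Local Notation h2 := (h (1 / 2)).

Implicit Types (W : {set X}) (x y : X) (r s t V : R).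

Lemma half_functional_ge0 : 0 <= h2.
Proof. by apply: (sf_ge0 h_sf); lra. Qed.

Lemma mass_mono W1 W2 : W1 \subset W2 -> mass rho W1 <= mass rho W2.
Proof.
move=> /fintype.subsetP s12; rewrite /mass [leRHS](bigID (mem W1)) /=.
rewrite (eq_bigl (fun x => (x \in W2) && (x \in W1))).
  by rewrite lerDl sumr_ge0 // => x _; case: rho_prob.
by move=> x; case: (boolP (x \in W1)) => [/s12 ->|]; rewrite ?andbF.
Qed.

Lemma mass_le1 W : mass rho W <= 1.
Proof.
case: rho_prob => _ <-; apply: le_trans (mass_mono (finset.subsetT W)) _.
by rewrite le_eqVlt (_ : mass rho _ = \sum_x rho x) ?eqxx // /mass;
  apply: eq_bigl => x; rewrite inE.
Qed.

Lemma point_le_mass W x : x \in W -> rho x <= mass rho W.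
Proof.
move=> xW; rewrite /mass (bigD1 x) //= lerDl.
by rewrite sumr_ge0 // => y _; case: rho_prob.
Qed.

Lemma mass_gt0 W x : x \in W -> 0 < rho x -> 0 < mass rho W.
Proof. by move=> xW x0; apply: lt_le_trans (point_le_mass xW). Qed.

Definition tail_cost y t : \bar R :=
  (\int[mu]_(r in `[t, +oo[) (h (mass rho (cball d y r)))%:E)%E.

Lemma mem_cball y r : 0 <= r -> y \in cball d y r.
Proof. by move=> r0; rewrite inE; have /(Defs.metric_eq0 d_metric) -> := erefl y. Qed.

Lemma cball_mono y s t : s <= t -> cball d y s \subset cball d y t.
Proof.
by move=> st; apply/fintype.subsetP => z; rewrite !inE => /le_trans; apply.
Qed.

Lemma cball_mass_gt0 y r : 0 < rho y -> 0 <= r -> 0 < mass rho (cball d y r).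
Proof. by move=> y0 r0; apply: mass_gt0 y0; apply: mem_cball. Qed.

Lemma functional_mass_le W1 W2 x : x \in W1 -> 0 < rho x -> W1 \subset W2 ->
  h (mass rho W2) <= h (mass rho W1).
Proof.
move=> x1 x0 s12; apply: (sf_noninc h_sf) (mass_mono s12) (mass_le1 _).
exact: mass_gt0 x0.
Qed.

Lemma measurable_ball_functional y (D : set R) : 0 < rho y -> measurable D ->
  (D `<=` `[0, +oo[)%classic ->
  measurable_fun D (fun r : R => h (mass rho (cball d y r))).
Proof.
move=> y0 mD D0.
apply: (@eq_measurable_fun _ _ (measurableTypeR R) (measurableTypeR R) D
  (fun r => h (mass rho (cball d y (Num.max r 0))))).
  move=> t; rewrite inE => /D0 /=; rewrite in_itv /= andbT => t0.
  by rewrite (max_idPl t0).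
apply: nonincreasing_measurable => // s t st.
apply: (functional_mass_le (x := y)) => //.
  by apply: mem_cball; rewrite le_max lexx orbT.
by apply: cball_mono; rewrite ge_max !le_max st lexx orbT.
Qed.

Lemma tail_cost_split y s t c : 0 < rho y -> 0 <= s -> s <= t ->
  (forall r, s <= r -> h (mass rho (cball d y r)) <= c) ->
  (tail_cost y s <= tail_cost y t + ((t - s) * c)%:E)%E.
Proof.
move=> y0 s0 st hc; rewrite /tail_cost.
have t0 := le_trans s0 st.
have eqU : (`[s, +oo[ : set R)%classic = (`[s, t[ `|` `[t, +oo[)%classic.
  apply/seteqP; split=> u /=; rewrite !in_itv /= ?andbT.
    by move=> su; case: (ltP u t) => ut; [left; rewrite su|right].
  by case=> [/andP[]//|]; apply: le_trans.
have sub0 : (`[s, +oo[ `<=` `[0, +oo[)%classic.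
  by move=> u /=; rewrite !in_itv /= !andbT; apply: le_trans.
have pos u : 0 <= u -> 0 <= h (mass rho (cball d y u)).
  by move=> u0; apply: (sf_ge0 h_sf) (mass_le1 _); apply: cball_mass_gt0.
have c0 : 0 <= c by apply: le_trans (pos _ s0) (hc _ (lexx _)).
rewrite {1}eqU ge0_integral_setU //.
- rewrite addeC leeD2l //.
  apply: (@le_trans _ _ (\int[mu]_(u in `[s, t[) (cst c%:E) u)%E).
    apply: ge0_le_integral => //.
    - by move=> u /=; rewrite in_itv /= => /andP[su _]; rewrite lee_fin pos ?(le_trans s0).
    - apply/measurable_EFinP; apply: measurable_ball_functional => // u /=.
      by rewrite !in_itv /= andbT => /andP[su _]; apply: le_trans su.
    - by move=> u /=; rewrite in_itv /= => /andP[su _]; rewrite lee_fin hc.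
  rewrite integral_cst //= lebesgue_measure_itv /= lte_fin.
  move: st; rewrite le_eqVlt => /predU1P[->|st].
    by rewrite ltxx mule0 subrr mul0r.
  by rewrite st -EFinB -EFinM mulrC.
- rewrite -eqU; apply/measurable_EFinP; exact: measurable_ball_functional.
- rewrite -eqU => u /sub0 /=; rewrite in_itv /= andbT => u0.
  by rewrite lee_fin pos.
- rewrite disj_set2E; apply/eqP/seteqP; split=> u //= [].
  by rewrite !in_itv /= andbT => /andP[_ ut] tu; move: (lt_le_trans ut tu); rewrite ltxx.
Qed.

Lemma tail_cost_far y t : (forall x, d y x <= t) -> tail_cost y t = 0%E.
Proof.
move=> far; rewrite /tail_cost integral0_eq // => r /=.
rewrite in_itv /= andbT => tr.
suff -> : mass rho (cball d y r) = 1 by rewrite (sf_at1 h_sf).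
case: rho_prob => _ <-; apply: eq_bigl => x.
by rewrite inE (le_trans (far x)).
Qed.

Lemma delta_le_tail_cost y : 0 < rho y -> (delta d h rho <= tail_cost y 0)%E.
Proof. by move=> y0; apply: ereal_inf_lbound; exists y. Qed.

(** ** The invariant carried down the tree *)

Variable E : R.
Hypothesis E_diam : forall x y, d x y <= 2 * E.

Definition local_mass W x r := mass rho (W :&: cball d x r)%SET.

(** [A] bounds the entropy integral of every point of [W], completed below the
    scale of [W] as if all smaller balls had the mass of [W]. It is paid for by
    the value [V] collected on the path, by a multiple of [E * h (1/2)], and by a
    debt [e]. By the last clause all balls of radius [r / 2] are so small a
    proportion of [W] that [20 * e] is bounded by the loss of the next step, up
    to [h2], whichever child is entered. The share [70 * r * h2] not yet spent pays for
    the additive terms [h2] of all further steps, whose radii form a geometric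
    series. *)
Definition node_inv W r V : Prop :=
  [/\ (exists x, x \in W), (forall x, x \in W -> 0 < rho x),
      (forall x y, x \in W -> y \in W -> d x y <= 20 * r) &
      exists A e, [/\ 0 <= e,
        forall y, y \in W ->
          (tail_cost y (20 * r) + (20 * r * h (mass rho W))%:E <= A%:E)%E,
        A <= 70 * (E - r) * h2 + 1680 * V + 400 * r * e &
        forall x, x \in W ->
          20 * e <= h (local_mass W x (r / 2) / mass rho W) + h2]].

Lemma node_inv_root W : W = [set x | 0 < rho x]%SET -> 0 <= E ->
  node_inv W (E / 10) 0.
Proof.
move=> Wdef E0.
have mW : mass rho W = 1.
  case: rho_prob => rho0 <-; rewrite [RHS](bigID (mem W)) /= [X in _ + X]big1 ?addr0 //.
  move=> x; rewrite Wdef inE -leNgt => x0; apply/eqP.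
  by rewrite eq_le x0 rho0.
have W0 : exists x, x \in W.
  apply/set0Pn; apply/negP => /eqP We; move: mW; rewrite We /mass big_set0 => /esym/eqP.
  by rewrite oner_eq0.
have Wpos x : x \in W -> 0 < rho x by rewrite Wdef inE.
have far x y : d x y <= 20 * (E / 10) by have := E_diam x y; lra.
split; [exact: W0|exact: Wpos|by move=> x y _ _; apply: far|].
exists 0, 0; split; first exact: lexx.
- by move=> y yW; rewrite tail_cost_far // mW (sf_at1 h_sf) mulr0 adde0.
- by have := mulr_ge0 E0 half_functional_ge0; lra.
- move=> x xW; rewrite mulr0 mW divr1 addr_ge0 ?half_functional_ge0 //.
  apply: (sf_ge0 h_sf); last exact: mass_le1.
  apply: (mass_gt0 (x := x)); last exact: Wpos.
  by rewrite inE xW mem_cball //; lra.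
Qed.

Section Step.
Variables (W W' : {set X}) (r V : R) (x0 : X).
Hypotheses (r_gt0 : 0 < r) (W_inv : node_inv W r V) (x0W : x0 \in W).
Hypothesis W'_ne : exists x, x \in W'.
Hypothesis W'_sub : W' \subset (W :&: cball d x0 (3 / 10 * r))%SET.

Let W'W : W' \subset W.
Proof. by apply: fintype.subset_trans W'_sub (finset.subsetIl _ _). Qed.

Let W'pos x : x \in W' -> 0 < rho x.
Proof. by case: W_inv => _ pos _ _ /(fintype.subsetP W'W); apply: pos. Qed.

Let w_gt0 : 0 < mass rho W.
Proof. by case: W_inv => _ pos _ _; apply: mass_gt0 x0W (pos _ x0W). Qed.

Let w'_gt0 : 0 < mass rho W'.
Proof. by case: W'_ne => x xW'; apply: mass_gt0 xW' (W'pos xW'). Qed.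

Let W'_diam x y : x \in W' -> y \in W' -> d x y <= 2 * r.
Proof.
move=> /(fintype.subsetP W'_sub); rewrite !inE => /andP[_ dx].
move=> /(fintype.subsetP W'_sub); rewrite !inE => /andP[_ dy].
have := Defs.metric_triangle d_metric x x0 y; rewrite (Defs.metric_sym d_metric x x0).
by have := r_gt0; lra.
Qed.

Let ratio_gt0 : 0 < mass rho W' / mass rho W.
Proof. by rewrite divr_gt0. Qed.

Let ratio_le1 : mass rho W' / mass rho W <= 1.
Proof. by rewrite ler_pdivrMr // mul1r mass_mono. Qed.

Let submul : h (mass rho W') <= h (mass rho W) + h (mass rho W' / mass rho W).
Proof.
rewrite -[X in h X <= _](divfK (lt0r_neq0 w_gt0)) addrC.
by apply: (sf_submul h_sf) => //; apply: mass_le1.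
Qed.

Let cost_step A : (forall y, y \in W ->
    (tail_cost y (20 * r) + (20 * r * h (mass rho W))%:E <= A%:E)%E) ->
  forall y, y \in W' ->
    (tail_cost y (2 * r) + (2 * r * h (mass rho W'))%:E
      <= (A + 20 * r * h (mass rho W' / mass rho W))%:E)%E.
Proof.
move=> cost y yW'.
have hb s : 2 * r <= s -> h (mass rho (cball d y s)) <= h (mass rho W').
  move=> rs; apply: (functional_mass_le yW' (W'pos yW')).
  apply/fintype.subsetP => z zW'; rewrite inE.
  by apply: le_trans (W'_diam yW' zW') rs.
have r0 := r_gt0.
have r20 : 2 * r <= 20 * r by lra.
have r2 : 0 <= 2 * r by lra.
have split := tail_cost_split (W'pos yW') r2 r20 hb.
have costy := cost y (fintype.subsetP W'W _ yW').
apply: le_trans (leeD2r _ split) _.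
rewrite -addeA -EFinD.
have : ((20 * r - 2 * r) * h (mass rho W') + 2 * r * h (mass rho W')
   <= 20 * r * h (mass rho W) + 20 * r * h (mass rho W' / mass rho W))%R.
  have : 20 * r * h (mass rho W') <=
     20 * r * (h (mass rho W) + h (mass rho W' / mass rho W)).
    by rewrite ler_wpM2l //; lra.
  lra.
rewrite -lee_fin => /(leeD2l (tail_cost y (20 * r)))/le_trans; apply.
rewrite !EFinD addeA; apply: leeD2r; exact: costy.
Qed.

Let debt_step e : (forall x, x \in W ->
    20 * e <= h (local_mass W x (r / 2) / mass rho W) + h2) ->
  20 * e <= h (mass rho W' / mass rho W) + h2.
Proof.
move=> /(_ _ x0W) /le_trans; apply; rewrite lerD2r.
have sub : W' \subset (W :&: cball d x0 (r / 2))%SET.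
  apply: fintype.subset_trans W'_sub _; apply: finset.setIS; apply: cball_mono.
  by have := r_gt0; lra.
apply: (sf_noninc h_sf) => //.
  by rewrite ler_pM2r ?invr_gt0 // mass_mono.
by rewrite ler_pdivrMr // mul1r mass_mono // finset.subsetIl.
Qed.

Let local_ge0 x r' : 0 <= r' -> x \in W' ->
  0 <= h (local_mass W' x r' / mass rho W').
Proof.
move=> r'0 xW'; apply: (sf_ge0 h_sf).
  rewrite divr_gt0 //; apply: (mass_gt0 (x := x)); last exact: W'pos.
  by rewrite inE xW' mem_cball.
by rewrite ler_pdivrMr // mul1r mass_mono // finset.subsetIl.
Qed.

(** A branching into [k] children pays for its own loss [h (w' / w)], where [w]
    and [w'] are the masses of the node and of the child, and for the debt. The
    loss adds [20 * r * h (w' / w)] to the integral, and the debt [400 * r * e]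
    is at most as much plus [20 * r * h2]; as [2 * 20 * 42 = 1680], the gain
    [r * h (1 / k)] covers both. *)
Lemma node_inv_split k :
  h (mass rho W' / mass rho W) <= 42 * h (1 / k%:R) ->
  node_inv W' (r / 10) (V + r * h (1 / k%:R)).
Proof.
move=> loss; case: W_inv => _ _ _ [A [e [e0 cost budget debt]]].
have r0 := r_gt0; have := debt_step debt; have := half_functional_ge0 => h20 debt'.
split; [exact: W'_ne|exact: W'pos|
  by move=> x y xW' yW'; have := W'_diam xW' yW'; lra|].
exists (A + 20 * r * h (mass rho W' / mass rho W)), 0; split; first exact: lexx.
- have -> : 20 * (r / 10) = 2 * r by field.
  exact: cost_step.
- have : r * (20 * e) <= r * (h (mass rho W' / mass rho W) + h2).
    by rewrite ler_pM2l.
  have : r * h (mass rho W' / mass rho W) <= r * (42 * h (1 / k%:R)).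
    by rewrite ler_pM2l.
  have : 0 <= r * h2 by rewrite mulr_ge0 // ltW.
  by lra.
- move=> x xW'; rewrite mulr0 addr_ge0 // local_ge0 //.
  by have := r_gt0; lra.
Qed.

(** A step to a single child gains nothing, and is paid for later. The child
    keeps a proportion at least [1 / (k * (k + 1))] of the mass, so the loss is
    at most [2 * h (1 / k) + h2], whereas a small ball in the child has mass at
    most [q], and [h (q / w)] is at least [42 * h (1 / k)]. The new debt is
    [2 * h (1 / k)]: at the scale [r / 10] it counts [80 * r * h (1 / k)], twice
    the [40] of the loss and of the old debt, and 20 times it is [40] out of
    the [42], the rest making up for the loss in the proportions. *)
Lemma node_inv_single (k : nat) (q : R) : (0 < k)%N ->
  mass rho W <= mass rho W' * k%:R * k.+1%:R ->
  42 * h (1 / k%:R) <= h (q / mass rho W) ->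
  (forall x, x \in W' -> local_mass W x (r / 20) <= q) -> q <= mass rho W ->
  node_inv W' (r / 10) V.
Proof.
move=> k0 heavy gap small qw; case: W_inv => _ _ _ [A [e [e0 cost budget debt]]].
have r0 := r_gt0; have := debt_step debt; have := half_functional_ge0 => h20 debt'.
have kR : 0 < k%:R :> R by rewrite ltr0n.
have k1R : 1 <= k%:R :> R by rewrite ler1n.
have hk0 : 0 <= h (1 / k%:R).
  by apply: (sf_ge0 h_sf); rewrite ?divr_gt0 // ler_pdivrMr // mul1r.
have hk1 : h (1 / k.+1%:R) <= h (1 / k%:R) + h2.
  apply: (@le_trans _ _ (h (1 / k%:R * (1 / 2)))).
    apply: (sf_noninc h_sf).
    - by rewrite mulr_gt0 ?divr_gt0.
    - rewrite mulf_div mulr1 ler_pM2l ?ltr01 // lef_pV2 ?posrE ?mulr_gt0 ?ltr0n //.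
      by rewrite -natr1; lra.
    - by rewrite ler_pdivrMr ?ltr0n // mul1r ler1n.
  apply: (sf_submul h_sf); rewrite ?divr_gt0 //; last by lra.
  by rewrite ler_pdivrMr // mul1r.
have loss : h (mass rho W' / mass rho W) <= 2 * h (1 / k%:R) + h2.
  apply: (@le_trans _ _ (h (1 / k%:R * (1 / k.+1%:R)))).
    apply: (sf_noninc h_sf) => //.
      by rewrite mulr_gt0 // divr_gt0 ?ltr0n.
    rewrite mulf_div mulr1 ler_pdivrMr ?mulr_gt0 ?ltr0n //.
    by rewrite mulrAC ler_pdivlMr // mul1r mulrA.
  apply: le_trans (sf_submul h_sf _ _ _ _) _; rewrite ?divr_gt0 ?ltr0n //.
  - by rewrite ler_pdivrMr // mul1r.
  - by rewrite ler_pdivrMr ?ltr0n // mul1r ler1n.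
  - by have := hk1; lra.
split; [exact: W'_ne|exact: W'pos|
  by move=> x y xW' yW'; have := W'_diam xW' yW'; lra|].
exists (A + 20 * r * h (mass rho W' / mass rho W)), (2 * h (1 / k%:R)); split.
- by rewrite mulr_ge0.
- have -> : 20 * (r / 10) = 2 * r by field.
  exact: cost_step.
- have : r * (20 * e) <= r * (h (mass rho W' / mass rho W) + h2).
    by rewrite ler_pM2l.
  have : r * h (mass rho W' / mass rho W) <= r * (2 * h (1 / k%:R) + h2).
    by rewrite ler_pM2l.
  have : 0 <= r * h2 by rewrite mulr_ge0 // ltW.
  have : 0 <= r * h (1 / k%:R) by rewrite mulr_ge0 // ltW.
  by lra.
- move=> x xW'.
  have lm0 : 0 < local_mass W' x (r / 10 / 2).
    apply: (mass_gt0 (x := x)); last exact: W'pos.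
    by rewrite inE xW' mem_cball //; have := r_gt0; lra.
  have lmq : local_mass W' x (r / 10 / 2) <= q.
    apply: le_trans (small _ xW'); rewrite (_ : r / 10 / 2 = r / 20); last by field.
    by apply: mass_mono; apply: finset.setSI.
  have lm1 : local_mass W' x (r / 10 / 2) / mass rho W' <= 1.
    by rewrite ler_pdivrMr // mul1r mass_mono // finset.subsetIl.
  have : h (q / mass rho W)
      <= h (local_mass W' x (r / 10 / 2) / mass rho W') + h (mass rho W' / mass rho W).
    apply: le_trans (sf_submul h_sf _ _ _ _) => //; last by rewrite divr_gt0.
    apply: (sf_noninc h_sf).
    - by rewrite mulr_gt0 // divr_gt0.
    - by rewrite mulrA divfK ?gt_eqF // ler_pM2r ?invr_gt0.
    - by rewrite ler_pdivrMr // mul1r.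
  by lra.
Qed.
End Step.

(** A linear bound in place of the logarithmic one suffices at scale [E / n]. *)
Lemma functional_inv_nat n : (0 < n)%N -> h (1 / n%:R) <= n%:R * h2.
Proof.
case: n => // n _; elim: n => [|n IHn].
  by rewrite divr1 (sf_at1 h_sf) mulr_ge0 // half_functional_ge0.
have step : h (1 / n.+2%:R) <= h (1 / n.+1%:R) + h2.
  apply: (@le_trans _ _ (h (1 / n.+1%:R * (1 / 2)))).
    apply: (sf_noninc h_sf).
    - by rewrite mulr_gt0 ?divr_gt0 ?ltr0n.
    - rewrite mulf_div mulr1 ler_pM2l ?ltr01 // lef_pV2 ?posrE ?mulr_gt0 ?ltr0n //.
      by rewrite -natrM ler_nat; lia.
    - by rewrite ler_pdivrMr ?ltr0n // mul1r ler1n.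
  apply: (sf_submul h_sf); rewrite ?divr_gt0 ?ltr0n //; last by lra.
  by rewrite ler_pdivrMr ?ltr0n // mul1r ler1n.
have -> : n.+2%:R * h2 = n.+1%:R * h2 + h2 by rewrite -(natr1 n.+1); ring.
by lra.
Qed.

(** At scale [E / n] the heaviest point of the node closes the account: it has a
    proportion at least [1 / n] of the mass, so its balls cost at most
    [n * h (1/2)] more than the node, during a length of order [E / n]. *)
Lemma node_inv_final W r V : 0 <= r -> 0 <= E -> r * #|X|%:R <= E ->
  node_inv W r V ->
  (delta d h rho <= (130 * (E * h2) + 1680 * V)%:E)%E.
Proof.
move=> r0 E0 rn [[x0 x0W] pos _ [A [e [e0 cost budget debt]]]].
have [y yW ymax] : exists2 y, y \in W & forall x, x \in W -> rho x <= rho y.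
  case: (@Order.TotalTheory.arg_maxP _ _ _ x0 (mem W) rho x0W) => y yW ymax.
  by exists y => // x xW; apply: ymax.
have y0 := pos _ yW.
have w0 : 0 < mass rho W by apply: mass_gt0 yW y0.
have n0 : (0 < #|X|)%N by apply/card_gt0P; exists y.
have n0R : 0 < #|X|%:R :> R by rewrite ltr0n.
have wy : mass rho W <= rho y * #|X|%:R.
  rewrite /mass; apply: (@le_trans _ _ (\sum_(x in W) rho y)).
    by apply: ler_sum => x; apply: ymax.
  rewrite sumr_const -[leLHS]mulr_natr ler_pM2l // ler_nat; exact: max_card.
have hn s : rho y <= s -> s <= mass rho W ->
    h (s / mass rho W) <= #|X|%:R * h2.
  move=> ys sw; apply: le_trans (functional_inv_nat n0).
  apply: (sf_noninc h_sf).
  - by rewrite divr_gt0.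
  - rewrite ler_pdivlMr // mul1r mulrC ler_pdivrMr //.
    by apply: le_trans wy _; rewrite ler_pM2r.
  - by rewrite ler_pdivrMr // mul1r.
have hy : h (rho y) <= h (mass rho W) + #|X|%:R * h2.
  rewrite -[X in h X <= _](divfK (lt0r_neq0 w0)) addrC.
  apply: le_trans (sf_submul h_sf _ _ _ _) _; rewrite ?divr_gt0 ?mass_le1 //.
    by rewrite ler_pdivrMr // mul1r point_le_mass.
  by rewrite lerD2r hn // point_le_mass.
have rh : r * (#|X|%:R * h2) <= E * h2.
  rewrite mulrA; apply: ler_wpM2r => //; exact: half_functional_ge0.
have debt' : r * (20 * e) <= 2 * (E * h2).
  have : h (local_mass W y (r / 2) / mass rho W) <= #|X|%:R * h2.
    apply: hn; first by apply: point_le_mass; rewrite inE yW mem_cball //; lra.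
    by apply: mass_mono; apply: finset.subsetIl.
  have n1 : 1 * h2 <= #|X|%:R * h2.
    apply: ler_wpM2r; [exact: half_functional_ge0|by rewrite ler1n].
  move=> h3; have := debt _ yW => h4.
  have : 20 * e <= 2 * (#|X|%:R * h2) by lra.
  by move=> /(ler_wpM2l r0); lra.
apply: le_trans (delta_le_tail_cost y0) _.
have r20 : 0 <= 20 * r by rewrite mulr_ge0.
have hb s : 0 <= s -> h (mass rho (cball d y s)) <= h (rho y).
  move=> s0; apply: (sf_noninc h_sf) => //; last exact: mass_le1.
  by apply: point_le_mass; apply: mem_cball.
apply: le_trans (tail_cost_split y0 (lexx 0) r20 hb) _.
rewrite subr0.
have : (20 * r * h (rho y) <= 20 * r * h (mass rho W) + 20 * (E * h2))%R.
  by have := ler_wpM2l r20 hy; lra.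
rewrite -lee_fin => /(leeD2l (tail_cost y (20 * r)))/le_trans; apply.
rewrite (EFinD (20 * r * h (mass rho W))) addeA; apply: le_trans (leeD2r _ (cost _ yW)) _.
rewrite -EFinD lee_fin.
have : 0 <= r * h2 by rewrite mulr_ge0 // half_functional_ge0.
by lra.
Qed.
End Geometry.

(** * Packing trees read from a table of nodes *)

Section NodeTable.
Variables (R : realType) (X : finType) (d : X -> X -> R) (alpha : R).
Variable (h : R -> R).
Variables (V : nat -> {set X}) (lab first nk : nat -> nat) (cnt : nat).

Local Notation D := (diam d [set: X]%SET).

Definition kid (p i : nat) : nat := (first p + i)%N.

(** Children lie after their parent, at consecutive addresses. Two nonempty
    disjoint children are proper subsets, so [io_proper] is about only children:
    it keeps distinct nodes distinct as sets. *)
Record inner_ok (p : nat) : Prop := {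
  io_fwd : (p < first p)%N;
  io_cnt : (first p + nk p <= cnt.+1)%N;
  io_ne : forall i, (i < nk p)%N -> exists x, x \in V (kid p i);
  io_sub : forall i, (i < nk p)%N -> V (kid p i) \subset V p;
  io_proper : nk p = 1%N -> V (kid p 0) != V p;
  io_diam : forall i x y, (i < nk p)%N -> x \in V (kid p i) ->
    y \in V (kid p i) -> d x y <= alpha ^+ (lab p).+1 * D;
  io_sep : forall i j x y, (i < nk p)%N -> (j < nk p)%N -> i <> j ->
    x \in V (kid p i) -> y \in V (kid p j) ->
    x != y /\ 10%:R^-1 * alpha ^+ lab p * D <= d x y }.

Definition entry_ok (p : nat) : Prop :=
  [/\ (0 < p)%N, (exists x, x \in V p) &
      (nk p = 0%N /\ #|V p| = 1%N) \/ ((0 < nk p)%N /\ inner_ok p)].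

Fixpoint table_tree (fuel p : nat) : ptree X :=
  PNode (V p) (lab p)
    (if fuel is m.+1 then map (table_tree m) (iota (first p) (nk p)) else [::]).

Hypothesis table_ok : forall p, (0 < p)%N -> (p <= cnt)%N -> entry_ok p.

Lemma table_tree_set m p : node_set (table_tree m p) = V p.
Proof. by case: m. Qed.

Lemma mem_kids p q : q \in iota (first p) (nk p) ->
  exists2 i, (i < nk p)%N & q = kid p i.
Proof.
rewrite mem_iota => /andP[h1 h2]; exists (q - first p)%N.
  by rewrite ltn_subLR.
by rewrite /kid subnKC.
Qed.

(** Children have larger addresses, so the fuel [cnt - p + 1] is enough to reach
    the leaves from [p]. *)
Lemma kid_range m p q : (0 < p)%N -> (p <= cnt)%N -> (cnt < p + m.+1)%N ->
  q \in iota (first p) (nk p) -> [/\ (0 < q)%N, (q <= cnt)%N & (cnt < q + m)%N].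
Proof.
move=> p0 pc fuel /mem_kids[i ik ->].
have [_ _ [[nk0 _]|[_ io]]] := table_ok p0 pc; first by rewrite nk0 in ik.
by have := io_fwd io; have := io_cnt io; rewrite /kid; split; lia.
Qed.

Lemma inner_of_kid p q : (0 < p)%N -> (p <= cnt)%N ->
  q \in iota (first p) (nk p) -> inner_ok p.
Proof.
move=> p0 pc /mem_kids[i ik _].
by have [_ _ [[nk0 _]|[_ io //]]] := table_ok p0 pc; rewrite nk0 in ik.
Qed.

Lemma foldr_and_map (T : eqType) (U : Type) (P : U -> Prop) (g : T -> U)
    (s : seq T) :
  (forall i, i \in s -> P (g i)) -> foldr and True (map P (map g s)).
Proof.
elim: s => //= i s IHs H; split; first by apply: H; rewrite mem_head.
by apply: IHs => j js; apply: H; rewrite inE js orbT.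
Qed.

Lemma pairwise_iota (r : rel nat) m k :
  (forall i j, (m <= i < m + k)%N -> (m <= j < m + k)%N -> (i < j)%N -> r i j) ->
  pairwise r (iota m k).
Proof.
move=> H; apply: (@sub_in_pairwise _ (fun i => (m <= i < m + k)%N) ltn).
- by move=> i j; apply: H.
- by apply/allP => i; rewrite mem_iota.
- by rewrite -sorted_pairwise ?iota_ltn_sorted //; apply: ltn_trans.
Qed.

Lemma diam_le (S : {set X}) c : (exists x, x \in S) ->
  (forall x y, x \in S -> y \in S -> d x y <= c) -> diam d S <= c.
Proof.
move=> [x xS] H; apply: ge_sup; first by exists (d x x), x, x.
by move=> _ [u [v [uS vS ->]]]; apply: H.
Qed.

Lemma setdist_ge (S S' : {set X}) c : (exists x, x \in S) -> (exists x, x \in S') ->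
  (forall x y, x \in S -> y \in S' -> c <= d x y) -> c <= setdist d S S'.
Proof.
move=> [x xS] [y yS] H; apply: lb_le_inf; first by exists (d x y), x, y.
by move=> _ [u [v [uS vS ->]]]; apply: H.
Qed.

Lemma table_tree_every_node m p : (0 < p)%N -> (p <= cnt)%N -> (cnt < p + m)%N ->
  every_node (fun v =>
    let cs := map (@node_set X) (children v) in
    [/\ is_leaf v -> exists x, node_set v = [set x]%SET,
        all (fun C : {set X} => C \subset node_set v) cs,
        pairwise (fun C1 C2 : {set X} => (C1 :&: C2 == finset.set0)%SET) cs,
        all (fun C : {set X} => diam d C <= alpha ^+ (label v).+1 * D) cs &
        pairwise (fun C1 C2 : {set X} =>
          10%:R^-1 * alpha ^+ label v * D <= setdist d C1 C2) cs])
    (table_tree m p).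
Proof.
elim: m p => [|m IHm] p p0 pc fuel; first by lia.
have kids_sets : map (@node_set X) (map (table_tree m) (iota (first p) (nk p)))
    = map V (iota (first p) (nk p)).
  by rewrite -map_comp; apply: eq_map => q /=; rewrite table_tree_set.
split; last first.
  apply: foldr_and_map => // q qk.
  by have [] := kid_range p0 pc fuel qk; apply: IHm.
rewrite /children /label /is_leaf; cbn zeta; rewrite /= kids_sets.
split.
- rewrite /nilp size_map size_iota => /eqP nk0.
  have [_ _ [[_ /eqP/cards1P[x ->]]|[]]] := table_ok p0 pc; first by exists x.
  by rewrite nk0.
- apply/allP => _ /mapP[q qk ->]; have io := inner_of_kid p0 pc qk.
  by have [i ik ->] := mem_kids qk; apply: (io_sub io).
- rewrite pairwise_map; apply: pairwise_iota => i j ir jr ij /=.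
  have io : inner_ok p by apply: (@inner_of_kid p i); rewrite ?mem_iota.
  apply/set0Pn => -[x]; rewrite inE => /andP[xi xj].
  have := io_sep io (i := (i - first p)%N) (j := (j - first p)%N) (x := x) (y := x).
  by rewrite /kid !subnKC ?eqxx; [|lia|lia] => -[]; lia.
- apply/allP => _ /mapP[q qk ->]; have io := inner_of_kid p0 pc qk.
  have [i ik ->] := mem_kids qk.
  apply: diam_le => [|x y]; first exact: (io_ne io).
  exact: (io_diam io).
- rewrite pairwise_map; apply: pairwise_iota => i j ir jr ij /=.
  have io : inner_ok p by apply: (@inner_of_kid p i); rewrite ?mem_iota.
  have ne q : (first p <= q < first p + nk p)%N -> exists x, x \in V q.
    move=> qr; have := io_ne io (i := (q - first p)%N).
    by rewrite /kid subnKC; [apply|]; lia.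
  apply: setdist_ge; [exact: ne|exact: ne|] => x y xi yj.
  have := io_sep io (i := (i - first p)%N) (j := (j - first p)%N) (x := x) (y := y).
  by rewrite /kid !subnKC; [|lia|lia] => -[] //; lia.
Qed.

Lemma table_tree_sets_sub m p S : (0 < p)%N -> (p <= cnt)%N -> (cnt < p + m)%N ->
  S \in node_sets (table_tree m p) -> S \subset V p /\ (exists x, x \in S).
Proof.
elim: m p => [|m IHm] p p0 pc fuel; first by lia.
rewrite /= inE => /predU1P[->|].
  by split=> //; have [_ ne _] := table_ok p0 pc.
rewrite -map_comp => /flatten_mapP[q qk /= Sq].
have [q0 qc qf] := kid_range p0 pc fuel qk.
have [Sq' ne] := IHm _ q0 qc qf Sq; split=> //.
apply: fintype.subset_trans Sq' _; have io := inner_of_kid p0 pc qk.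
by have [i ik ->] := mem_kids qk; apply: (io_sub io).
Qed.

Lemma kids_disjoint p i j x : (0 < p)%N -> (p <= cnt)%N ->
  i \in iota (first p) (nk p) -> j \in iota (first p) (nk p) ->
  x \in V i -> x \in V j -> i = j.
Proof.
move=> p0 pc ik jk; have io := inner_of_kid p0 pc ik.
have [a ak ->] := mem_kids ik; have [b bk ->] := mem_kids jk => xa xb.
have [->//|/eqP ab] := eqVneq a b.
by have [] := io_sep io ak bk ab xa xb; rewrite eqxx.
Qed.

Lemma uniq_flatten_map (S T : eqType) (g : S -> seq T) (s : seq S) :
  uniq s -> (forall i, i \in s -> uniq (g i)) ->
  (forall i j y, i \in s -> j \in s -> y \in g i -> y \in g j -> i = j) ->
  uniq (flatten (map g s)).
Proof.
elim: s => //= i s IHs /andP[nis us] ug dis; rewrite cat_uniq.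
rewrite ug ?mem_head //= IHs //; last 2 first.
- by move=> j js; apply: ug; rewrite inE js orbT.
- by move=> j k y js ks; apply: dis; rewrite inE ?js ?ks orbT.
rewrite andbT; apply/hasPn => y /flatten_mapP[j js yj]; apply/negP => yi.
have ij : i = j by apply: dis yi yj; rewrite inE ?eqxx ?js ?orbT.
by rewrite ij js in nis.
Qed.

Lemma table_tree_uniq m p : (0 < p)%N -> (p <= cnt)%N -> (cnt < p + m)%N ->
  uniq (node_sets (table_tree m p)).
Proof.
elim: m p => [|m IHm] p p0 pc fuel; first by lia.
rewrite /= -map_comp; apply/andP; split.
  apply/negP => /flatten_mapP[q qk /= Vq].
  have [q0 qc qf] := kid_range p0 pc fuel qk.
  have [pq _] := table_tree_sets_sub q0 qc qf Vq.
  have io := inner_of_kid p0 pc qk; have [i ik qE] := mem_kids qk.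
  have [nk1|nk1] := eqVneq (nk p) 1%N.
    have := io_proper io nk1; rewrite finset.eqEsubset (io_sub io) ?nk1 //=.
    by have -> : kid p 0 = q; [rewrite qE; congr kid; lia|rewrite pq].
  pose j := if i == 0%N then 1%N else 0%N.
  have jk : (j < nk p)%N by rewrite /j; case: eqP => _; lia.
  have ij : i <> j by rewrite /j; case: eqP => // ->.
  have [x xj] := io_ne io jk.
  have xi : x \in V (kid p i).
    by rewrite -qE (fintype.subsetP pq) // (fintype.subsetP (io_sub io jk)).
  by have [] := io_sep io ik jk ij xi xj; rewrite eqxx.
apply: uniq_flatten_map; first exact: iota_uniq.
  by move=> q qk /=; have [] := kid_range p0 pc fuel qk; apply: IHm.
move=> i j S ik jk /= Si Sj.
have [i0 ic icf] := kid_range p0 pc fuel ik.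
have [j0 jc jcf] := kid_range p0 pc fuel jk.
have [SVi [x xS]] := table_tree_sets_sub i0 ic icf Si.
have [SVj _] := table_tree_sets_sub j0 jc jcf Sj.
exact: kids_disjoint p0 pc ik jk (fintype.subsetP SVi _ xS) (fintype.subsetP SVj _ xS).
Qed.

Lemma table_tree_packing m p : (0 < p)%N -> (p <= cnt)%N -> (cnt < p + m)%N ->
  packing_tree d alpha (table_tree m p).
Proof.
by move=> p0 pc fuel; split; [apply: table_tree_uniq|apply: table_tree_every_node].
Qed.

Lemma mem_bigcup_seq (T : eqType) (s : seq T) (F : T -> {set X}) x :
  (x \in \bigcup_(i <- s) F i)%SET = has (fun i => x \in F i) s.
Proof.
elim: s => [|i s IHs]; first by rewrite big_nil inE.
by rewrite big_cons inE IHs.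
Qed.

Lemma table_tree_leaf m p x : (0 < p)%N -> (p <= cnt)%N -> (cnt < p + m.+1)%N ->
  (0 < nk p)%N ->
  (x \in leaf_set (table_tree m.+1 p)) =
  has (fun q => x \in leaf_set (table_tree m q)) (iota (first p) (nk p)).
Proof.
move=> p0 pc fuel nk0; rewrite -mem_bigcup_seq; rewrite -(big_map (@leaf_set X \o table_tree m) xpredT id) /= -map_comp.
by case: (nk p) nk0.
Qed.

Lemma table_tree_leaf_ne m p : (0 < p)%N -> (p <= cnt)%N -> (cnt < p + m)%N ->
  exists x, x \in leaf_set (table_tree m p).
Proof.
elim: m p => [|m IHm] p p0 pc fuel; first by lia.
have [_ [x xV] [[nk0 _]|[nk0 io]]] := table_ok p0 pc.
  by exists x; rewrite /= nk0.
have qk : first p \in iota (first p) (nk p) by rewrite mem_iota; lia.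
have [q0 qc qf] := kid_range p0 pc fuel qk.
have [y yq] := IHm _ q0 qc qf; exists y.
by rewrite table_tree_leaf //; apply/hasP; exists (first p).
Qed.

(** ** Path values *)

Hypothesis alpha_ge0 : 0 <= alpha.
Hypothesis D_ge0 : 0 <= D.
Hypothesis h_inv_ge0 : forall k, (0 < k)%N -> 0 <= h (1 / k%:R).

Definition node_gain (v : ptree X) : R :=
  alpha ^+ label v * D * h (1 / (outdeg v)%:R).

Definition path_gain x (t : ptree X) : R :=
  \sum_(v <- path_to x t | ~~ is_leaf v) node_gain v.

Lemma node_gain_ge0 v : ~~ is_leaf v -> 0 <= node_gain v.
Proof.
rewrite /is_leaf /nilp -lt0n => v0.
by rewrite /node_gain !mulr_ge0 ?exprn_ge0 ?h_inv_ge0.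
Qed.

Lemma path_gain_ge0 x t : 0 <= path_gain x t.
Proof. by apply: sumr_ge0 => v; apply: node_gain_ge0. Qed.

Variables (val : nat -> R) (c : R).
Hypothesis val_leaf : forall p, (0 < p <= cnt)%N -> nk p = 0%N -> c <= val p.
Hypothesis val_kid : forall p i, (0 < p <= cnt)%N -> (i < nk p)%N ->
  val (kid p i) <= val p + alpha ^+ lab p * D * h (1 / (nk p)%:R).

(** [val p] is what the path from the root has collected before [p]. Each step
    adds at most the gain of the node that is left, so the rest of the path
    supplies what [val p] lacks to the value at the leaf. *)
Lemma table_tree_path_gain m p x :
  (0 < p)%N -> (p <= cnt)%N -> (cnt < p + m)%N ->
  x \in leaf_set (table_tree m p) -> c <= val p + path_gain x (table_tree m p).
Proof.
elim: m p => [|m IHm] p p0 pc fuel; first by lia.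
have pr : (0 < p <= cnt)%N by rewrite p0.
have [_ _ [[nk0 _]|[nk0 io]]] := table_ok p0 pc => xl.
  apply: (le_trans (val_leaf pr nk0)); rewrite lerDl; exact: path_gain_ge0.
have := xl; rewrite table_tree_leaf // => /hasP[q qk xq].
have [q0 qc qf] := kid_range p0 pc fuel qk.
have [i ik qE] := mem_kids qk.
have := IHm _ q0 qc qf xq; have := val_kid pr ik; rewrite -qE => hv hq.
apply: le_trans hq _; apply: le_trans (lerD hv (lexx _)) _.
rewrite -addrA lerD2l.
have -> : path_gain x (table_tree m.+1 p) = node_gain (table_tree m.+1 p) +
    \sum_(q <- iota (first p) (nk p)) path_gain x (table_tree m q).
  rewrite {1}/path_gain.
  have -> : path_to x (table_tree m.+1 p) = table_tree m.+1 p ::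
      flatten (map (path_to x) (map (table_tree m) (iota (first p) (nk p)))).
    by move: xl; rewrite /= => ->.
  rewrite big_cons ifT; last first.
    by rewrite /is_leaf /= /nilp size_map size_iota -lt0n.
  by congr (_ + _); rewrite -map_comp big_flatten /= big_map.
rewrite {1}/node_gain /outdeg /= size_map size_iota lerD2l.
rewrite (big_rem q) //= lerDl; apply: sumr_ge0 => v _; exact: path_gain_ge0.
Qed.

Lemma table_tree_val m p : (0 < p)%N -> (p <= cnt)%N -> (cnt < p + m)%N ->
  val p = 0 -> c <= tree_val d alpha h (table_tree m p).
Proof.
move=> p0 pc fuel vp; apply: lb_le_inf.
  by have [x xl] := table_tree_leaf_ne p0 pc fuel; exists (path_gain x (table_tree m p)), x.
move=> _ [x xl <-]; have := table_tree_path_gain p0 pc fuel xl.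
by rewrite vp add0r.
Qed.
End NodeTable.

(** ** Trees stored in memory *)

Section StoredTable.
Variables (R : realType) (n : nat) (s : state R).
Variables (V : nat -> {set 'I_n}) (lab first nk : nat -> nat) (cnt : nat).

Hypothesis member_cell : forall p (x : 'I_n), (0 < p <= cnt)%N ->
  nmem s out_member (p * n + x)%N = (x \in V p).
Hypothesis label_cell : forall p, (0 < p <= cnt)%N -> nmem s out_label p = lab p.
Hypothesis child_cell : forall p, (0 < p <= cnt)%N ->
  nmem s out_child p = if nk p == 0%N then 0%N else first p.
Hypothesis sibling_cell : forall p i, (0 < p <= cnt)%N -> (i < nk p)%N ->
  nmem s out_sibling (first p + i)%N =
    if (i.+1 < nk p)%N then (first p + i.+1)%N else 0%N.
Hypothesis forward : forall p, (0 < p <= cnt)%N -> (0 < nk p)%N ->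
  (p < first p)%N /\ (first p + nk p <= cnt.+1)%N.

Lemma table_tree_stored m p : (0 < p)%N -> (p <= cnt)%N -> (cnt < p + m)%N ->
  stored_at s p (table_tree V lab first nk m p).
Proof.
elim: m p => [|m IHm] p p0 pc fuel; first by lia.
have pr : (0 < p <= cnt)%N by rewrite p0.
split=> //; [by move=> x; apply: member_cell|exact: label_cell|].
rewrite child_cell //; have [->//|nk0] := eqVneq (nk p) 0%N.
have [|fwd bound] := forward pr; first by rewrite lt0n.
(* the list of children from the [i]-th on *)
have tl k : forall i, (i + k = nk p)%N ->
  (fix siblings (q : nat) (ts : seq (ptree 'I_n)) : Prop :=
         if ts is t' :: ts'
         then stored_at s q t' /\ siblings (nmem s out_sibling q) ts'
         else q = 0%N)
   (if (i < nk p)%N then (first p + i)%N else 0%N)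
   (map (table_tree V lab first nk m) (iota (first p + i) k)).
  elim: k => [|k IHk] i ik; first by rewrite ifF //; lia.
  have ik' : (i < nk p)%N by lia.
  rewrite ik' /=; split; first by apply: IHm; lia.
  rewrite sibling_cell // -addnS; apply: IHk; lia.
have := tl (nk p) 0%N (add0n _); rewrite addn0 lt0n nk0; exact.
Qed.
End StoredTable.

(** * Reasoning about programs and their running time *)

Section Machine.
Variables (R : realType) (h : R -> R).
Implicit Types (s : state R) (c : cmd).

Definition runs c s (T : nat) (Q : state R -> Prop) : Prop :=
  exists t s', [/\ exec h c s t s', (t <= T)%N & Q s'].

(** The arrays outside [NL] and [RL] are the same in both states. What a program
    can write is read off its text, so that a specification has to speak only of
    the arrays that change. *)
Definition frame (NL RL : seq nat) s s' : Prop :=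
  (forall a k, a \notin NL -> nmem s' a k = nmem s a k) /\
  (forall a k, a \notin RL -> rmem s' a k = rmem s a k).

Fixpoint nwrites c : seq nat :=
  match c with
  | CNStore a _ _ => [:: a]
  | CSeq c1 c2 | CIf _ c1 c2 => nwrites c1 ++ nwrites c2
  | CWhile _ c1 => nwrites c1
  | _ => [::]
  end.

Fixpoint rwrites c : seq nat :=
  match c with
  | CRStore a _ _ => [:: a]
  | CSeq c1 c2 | CIf _ c1 c2 => rwrites c1 ++ rwrites c2
  | CWhile _ c1 => rwrites c1
  | _ => [::]
  end.

Lemma frame_trans NL RL s1 s2 s3 :
  frame NL RL s1 s2 -> frame NL RL s2 s3 -> frame NL RL s1 s3.
Proof.
move=> [n1 r1] [n2 r2]; split=> a k ak; first by rewrite n2 // n1.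
by rewrite r2 // r1.
Qed.

Lemma frame_weaken NL RL NL' RL' s s' : {subset NL <= NL'} -> {subset RL <= RL'} ->
  frame NL RL s s' -> frame NL' RL' s s'.
Proof.
move=> nl rl [fn fr]; split=> a k ak.
  by apply: fn; apply: contra ak; apply: nl.
by apply: fr; apply: contra ak; apply: rl.
Qed.

Lemma frame_sub NL RL NL' RL' s s' :
  all (fun a => a \in NL') NL && all (fun a => a \in RL') RL ->
  frame NL RL s s' -> frame NL' RL' s s'.
Proof. by case/andP=> /allP nl /allP rl; apply: frame_weaken. Qed.

Lemma exec_frame c s t s' : exec h c s t s' -> frame (nwrites c) (rwrites c) s s'.
Proof.
elim=> {c s t s'} //=.
- by move=> a i e s; split=> b k //; rewrite inE /= /upd => /negbTE ->.
- by move=> a i e s; split=> b k //; rewrite inE /= /upd => /negbTE ->.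
- move=> c1 c2 s t1 s1 t2 s2 _ f1 _ f2; apply: (@frame_trans _ _ _ s1).
    by apply: frame_weaken f1 => a; rewrite mem_cat => ->.
  by apply: frame_weaken f2 => a; rewrite mem_cat orbC => ->.
- move=> b c1 c2 s t s1 _.
  by case: ifP => _; apply: frame_weaken => a; rewrite mem_cat => -> //; rewrite orbT.
- by move=> b c s t1 s1 t2 s2 _ _ f1 _ f2; apply: frame_trans f2.
Qed.

Lemma runs_frame c s T Q :
  runs c s T Q -> runs c s T (fun s' => Q s' /\ frame (nwrites c) (rwrites c) s s').
Proof.
move=> [t [s' [ex tT q]]]; exists t, s'; split=> //; split=> //.
exact: exec_frame ex.
Qed.

Lemma runs_mono c s T T' (Q Q' : state R -> Prop) : runs c s T Q -> (T <= T')%N ->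
  (forall s', Q s' -> Q' s') -> runs c s T' Q'.
Proof.
move=> [t [s' [ex tT q]]] TT' QQ'; exists t, s'; split; [by []| |exact: QQ'].
exact: leq_trans TT'.
Qed.

Lemma runs_le c s T T' (Q : state R -> Prop) : runs c s T Q -> (T <= T')%N ->
  runs c s T' Q.
Proof. by move=> r le; apply: runs_mono r le _. Qed.

Lemma runs_post c s T (Q Q' : state R -> Prop) : runs c s T Q ->
  (forall s', Q s' -> frame (nwrites c) (rwrites c) s s' -> Q' s') -> runs c s T Q'.
Proof. by move=> /runs_frame r qq; apply: runs_mono r _ _ => // s' [q f]; apply: qq. Qed.

Lemma runs_seq c1 c2 s T1 T2 Q1 Q :
  runs c1 s T1 Q1 ->
  (forall s1, Q1 s1 -> frame (nwrites c1) (rwrites c1) s s1 -> runs c2 s1 T2 Q) ->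
  runs (CSeq c1 c2) s (T1 + T2) Q.
Proof.
move=> /runs_frame[t1 [s1 [ex1 t1T [q1 f1]]]] /(_ s1 q1 f1)[t2 [s2 [ex2 t2T q2]]].
by exists (t1 + t2)%N, s2; split=> //; [apply: ESeq ex1 ex2|rewrite leq_add].
Qed.

Lemma runs_if b c1 c2 s T Q :
  (beval h s b -> runs c1 s T Q) -> (~~ beval h s b -> runs c2 s T Q) ->
  runs (CIf b c1 c2) s (bcost b + T).+1 Q.
Proof.
move=> r1 r2.
have [t [s1 [ex tT q]]] : runs (if beval h s b then c1 else c2) s T Q.
  by case: ifP => hb; [apply: r1|apply: r2; rewrite hb].
exists (bcost b + t).+1, s1; split=> //; first exact: EIf.
by rewrite ltnS leq_add2l.
Qed.

(** ** Straight-line code is run symbolically *)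

Fixpoint straight c : bool :=
  match c with
  | CSkip | CNStore _ _ _ | CRStore _ _ _ => true
  | CSeq c1 c2 | CIf _ c1 c2 => straight c1 && straight c2
  | CWhile _ _ => false
  end.

(** Charging both branches of a conditional makes the bound independent of the
    state. *)
Fixpoint step_cost c : nat :=
  match c with
  | CNStore _ i e => (ncost i + ncost e).+1
  | CRStore _ i e => (ncost i + rcost e).+1
  | CSeq c1 c2 => (step_cost c1 + step_cost c2)%N
  | CIf b c1 c2 => (bcost b + (step_cost c1 + step_cost c2)).+1
  | _ => 1%N
  end.

Fixpoint symbolic c s : state R :=
  match c with
  | CNStore a i e => nstore s a (neval s i) (neval s e)
  | CRStore a i e => rstore s a (neval s i) (reval h s e)
  | CSeq c1 c2 => symbolic c2 (symbolic c1 s)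
  | CIf b c1 c2 => if beval h s b then symbolic c1 s else symbolic c2 s
  | _ => s
  end.

Lemma runs_straight c s (Q : state R -> Prop) : straight c -> Q (symbolic c s) ->
  runs c s (step_cost c) Q.
Proof.
elim: c s Q => //=.
- by move=> s Q _ q; exists 1%N, s; split=> //; apply: ESkip.
- move=> a i e s Q _ q; exists (ncost i + ncost e).+1, (nstore s a (neval s i) (neval s e)).
  by split=> //; apply: ENStore.
- move=> a i e s Q _ q; exists (ncost i + rcost e).+1, (rstore s a (neval s i) (reval h s e)).
  by split=> //; apply: ERStore.
- move=> c1 IH1 c2 IH2 s Q /andP[s1 s2] q.
  by apply: (runs_seq (IH1 s (fun s' => s' = symbolic c1 s) s1 erefl)) => _ -> _; apply: IH2.
- move=> b c1 IH1 c2 IH2 s Q /andP[s1 s2] q.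
  apply: runs_if => hb.
    apply: runs_mono (IH1 s Q s1 _) _ _ => //; last exact: leq_addr.
    by move: q; rewrite hb.
  apply: runs_mono (IH2 s Q s2 _) _ _ => //; last exact: leq_addl.
  by move: q; rewrite (negbTE hb).
Qed.

(** ** Loops *)

(** [phi] bounds the time still needed, so each round is charged to its
    decrease. *)
Lemma runs_while (I : state R -> Prop) (phi : state R -> nat) b c s :
  I s ->
  (forall s1, I s1 -> beval h s1 b ->
    exists T, (T + (bcost b).+1 <= phi s1)%N /\
      runs c s1 T (fun s2 => I s2 /\ (T + (bcost b).+1 + phi s2 <= phi s1)%N)) ->
  runs (CWhile b c) s (phi s + (bcost b).+1) (fun s' => I s' /\ beval h s' b = false).
Proof.
move=> Is body; have [m] := ubnP (phi s); elim: m s Is => // m IHm s Is phim.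
case hb: (beval h s b); last first.
  exists (bcost b).+1, s; split=> //; first exact: EWhileF.
  by rewrite leq_addl.
have [T [Tphi [t1 [s1 [ex1 t1T [I1 phi1]]]]]] := body s Is hb.
have [|t2 [s2 [ex2 t2T q]]] := IHm s1 I1; first by lia.
exists (bcost b + t1 + t2).+1, s2; split=> //; first exact: EWhileT hb ex1 ex2.
by lia.
Qed.

Definition nvar (a : nat) : nexp := NLoad a (NConst 0).
Definition rvar (a : nat) : rexp := RLoad a (NConst 0).
Definition nset (a : nat) (e : nexp) : cmd := CNStore a (NConst 0) e.
Definition rset (a : nat) (e : rexp) : cmd := CRStore a (NConst 0) e.

Definition for_loop (i m : nat) (c : cmd) : cmd :=
  CSeq (nset i (NConst 0))
    (CWhile (BNle (NAdd (nvar i) (NConst 1)) (nvar m))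
      (CSeq c (nset i (NAdd (nvar i) (NConst 1))))).

(** The invariant is stated after the counter has moved, and 20 operations per
    round cover the test and the increment. *)
Lemma runs_for (I : nat -> state R -> Prop) (T : nat -> nat) i m c s :
  i != m ->
  I 0%N (nstore s i 0 0) ->
  (forall j s1, (j < nmem s m 0)%N -> nmem s1 i 0 = j -> nmem s1 m 0 = nmem s m 0 ->
    frame (i :: nwrites c) (rwrites c) s s1 -> I j s1 ->
    runs c s1 (T j) (fun s2 =>
      [/\ nmem s2 i 0 = j, nmem s2 m 0 = nmem s m 0 & I j.+1 (nstore s2 i 0 j.+1)])) ->
  runs (for_loop i m c) s (\sum_(j < nmem s m 0) (T j + 20) + 20) (I (nmem s m 0)).
Proof.
move=> im I0 body; rewrite /for_loop.
set M := nmem s m 0.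
have mi : (m == i) = false by rewrite eq_sym (negbTE im).
have im' : (i == m) = false by rewrite (negbTE im).
pose J s1 := exists j, [/\ (j <= M)%N, nmem s1 i 0 = j, nmem s1 m 0 = M,
  frame (i :: nwrites c) (rwrites c) s s1 & I j s1].
pose phi (s1 : state R) : nat := (\sum_(nmem s1 i 0 <= j < M) (T j + 20))%N.
have loop : runs (CWhile (BNle (NAdd (nvar i) (NConst 1)) (nvar m))
      (CSeq c (nset i (NAdd (nvar i) (NConst 1))))) (nstore s i 0 0)
   (phi (nstore s i 0 0) + (bcost (BNle (NAdd (nvar i) (NConst 1)) (nvar m))).+1)
   (fun s' => J s' /\ beval h s' (BNle (NAdd (nvar i) (NConst 1)) (nvar m)) = false).
  apply: runs_while.
    exists 0%N; split=> //=; rewrite /upd ?eqxx ?mi //.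
    by split=> a k //; rewrite inE negb_or /= => /andP[/negbTE ai _]; rewrite /upd ai.
  move=> s1 [j [jM ij mM fr Ij]] /=; rewrite addn1 ij mM => jM'.
  exists (T j + 6)%N.
  have phiE : phi s1 = (T j + 20 + \sum_(j.+1 <= j' < M) (T j' + 20))%N.
    by rewrite /phi ij big_ltn.
  split; first by rewrite phiE; lia.
  apply: runs_mono; first last.
  - by move=> s2 q; apply: q.
  - exact: leqnn.
  apply: runs_mono (runs_seq (runs_frame (body j s1 jM' ij mM fr Ij)) _) _ _; first last.
  - by move=> s2 q; apply: q.
  - by rewrite leq_add2l; apply: (leqnn 6).
  move=> s2 [[i2 m2 I2] f2] _.
  apply: runs_straight => //=; rewrite i2 addn1; split.
    exists j.+1; split=> //=; rewrite /upd ?eqxx ?mi //.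
    apply: (@frame_trans _ _ _ s2).
      apply: frame_trans fr _; apply: frame_weaken f2 => // a.
      by rewrite inE orbC => ->.
    by split=> a k //; rewrite inE negb_or => /andP[/negbTE ai _] /=; rewrite /upd ai.
  rewrite phiE /phi /= /upd !eqxx /=; lia.
have phi0 : phi (nstore s i 0 0) = (\sum_(j < M) (T j + 20))%N.
  by rewrite /phi /= /upd !eqxx /= big_mkord.
rewrite phi0 in loop.
apply: (@runs_mono _ _ (3 + (\sum_(j < M) (T j + 20) + 8))%N _ (I M)) => //; last first.
  by rewrite addnCA leq_add2l.
apply: (runs_seq (runs_straight (c := nset i (NConst 0)) (s := s)
  (Q := fun s1 => s1 = nstore s i 0 0) isT erefl)) => _ -> _.
apply: runs_mono loop (leqnn _) _.
move=> s' [[j [jM ij mM _ Ij]]] /=; rewrite addn1 ij mM => /negbT; rewrite -leqNgt => Mj.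
by have -> : M = j by apply/eqP; rewrite eqn_leq Mj jM.
Qed.

Lemma runs_for_const (I : nat -> state R -> Prop) (T : nat) i m c s :
  i != m ->
  I 0%N (nstore s i 0 0) ->
  (forall j s1, (j < nmem s m 0)%N -> nmem s1 i 0 = j -> nmem s1 m 0 = nmem s m 0 ->
    frame (i :: nwrites c) (rwrites c) s s1 -> I j s1 ->
    runs c s1 T (fun s2 =>
      [/\ nmem s2 i 0 = j, nmem s2 m 0 = nmem s m 0 & I j.+1 (nstore s2 i 0 j.+1)])) ->
  runs (for_loop i m c) s (nmem s m 0 * (T + 20) + 20) (I (nmem s m 0)).
Proof.
move=> im I0 body; have := @runs_for I (fun=> T) i m c s im I0 body.
by rewrite sum_nat_const card_ord.
Qed.
End Machine.

(** * The program *)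

(* Natural arrays. Arrays 0 to 5 are the input size and the output. *)
Notation a_cnt := 6%N (only parsing).     (* number of nodes created *)
Notation a_cur := 7%N (only parsing).     (* the node being processed *)
Notation a_lev := 8%N (only parsing).     (* level of each node *)
Notation a_kids := 9%N (only parsing).    (* number of children of each node *)
Notation i_x := 10%N (only parsing).
Notation i_y := 11%N (only parsing).
Notation a_k := 12%N (only parsing).      (* number of picks, then of children *)
Notation a_best := 13%N (only parsing).   (* the center being picked *)
Notation a_dec := 14%N (only parsing).    (* decision: 0 none, 1 branch, 2 descend *)
Notation a_small := 15%N (only parsing).  (* index of the small ball of a point *)
Notation a_big := 16%N (only parsing).    (* index of the piece of a point *)
Notation a_flag := 17%N (only parsing).   (* whether some leaf has a low value *)
Notation a_fin := 18%N (only parsing).    (* whether the radius is below E / n *)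
Notation a_far := 19%N (only parsing).    (* a point farthest from point 0 *)
Notation a_cov := 20%N (only parsing).    (* whether the children miss a point *)

(* Real arrays. Arrays 0 and 1 are the distances and the measure. *)
Notation r_ecc := 2%N (only parsing).     (* E, the eccentricity of point 0 *)
Notation r_rad := 3%N (only parsing).     (* radius of each node *)
Notation r_val := 4%N (only parsing).     (* value of the path to each node *)
Notation r_cur := 5%N (only parsing).     (* radius in use, 0 in the final step *)
Notation r_w := 6%N (only parsing).       (* mass of the current node *)
Notation r_thr := 7%N (only parsing).     (* threshold for descending *)
Notation r_ball := 8%N (only parsing).    (* mass of the small ball of a point *)
Notation r_part := 9%N (only parsing).    (* mass of the current piece *)
Notation r_max := 10%N (only parsing).    (* largest mass of a small ball *)

Notation "c1 ;; c2" := (CSeq c1 c2) (at level 60, right associativity, only parsing).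

Definition cell (p y : nexp) : nexp := NAdd (NMul p (nvar 0)) y.
Definition rnat (k : nat) : rexp := ROfNat (NConst k).
Definition in_node (i : nat) : bexp :=
  BNle (NConst 1) (NLoad out_member (cell (nvar a_cur) (nvar i))).
Definition dist (x y : nexp) : rexp := RLoad 0 (cell x y).
Definition when (b : bexp) (c : cmd) : cmd := CIf b c CSkip.
Definition radius_small : rexp := RDiv (rvar r_cur) (rnat 20).
Definition radius_big : rexp := RMul (RDiv (rnat 3) (rnat 10)) (rvar r_cur).

Definition find_far : cmd :=
  for_loop i_y 0
    (when (BNot (BRle (dist (NConst 0) (nvar i_y)) (rvar r_ecc)))
      (rset r_ecc (dist (NConst 0) (nvar i_y)) ;; nset a_far (nvar i_y))).

Definition make_root : cmd :=
  for_loop i_y 0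
    (when (BNot (BRle (RLoad 1 (nvar i_y)) (rnat 0)))
      (CNStore out_member (cell (NConst 1) (nvar i_y)) (NConst 1))) ;;
  CNStore a_lev (NConst 1) (NConst 1) ;;
  CRStore r_rad (NConst 1) (RDiv (rvar r_ecc) (rnat 10)) ;;
  nset a_cnt (NConst 1) ;; nset a_cur (NConst 1).

(** Once the radius is at most [E / n], the radius in use is 0: balls become
    points, and the greedy choice returns the heaviest point. *)
Definition set_radius : cmd :=
  CIf (BRle (RMul (RLoad r_rad (nvar a_cur)) (ROfNat (nvar 0))) (rvar r_ecc))
    (nset a_fin (NConst 1) ;; rset r_cur (rnat 0))
    (nset a_fin (NConst 0) ;; rset r_cur (RLoad r_rad (nvar a_cur))).

(** The threshold 0 at radius 0 makes the first pick decisive. *)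
Definition weigh : cmd :=
  rset r_w (rnat 0) ;;
  for_loop i_y 0
    (CNStore a_small (nvar i_y) (NConst 0) ;; CNStore a_big (nvar i_y) (NConst 0) ;;
     CRStore r_ball (nvar i_y) (rnat 0) ;;
     when (in_node i_y) (rset r_w (RAdd (rvar r_w) (RLoad 1 (nvar i_y))))) ;;
  rset r_thr (RMul (rvar r_w) (ROfNat (NSub (NConst 1) (nvar a_fin)))).

Definition ball_masses_row : cmd :=
  for_loop i_y 0
    (when (BAnd (in_node i_y) (BRle (dist (nvar i_x) (nvar i_y)) radius_small))
      (CRStore r_ball (nvar i_x)
        (RAdd (RLoad r_ball (nvar i_x)) (RLoad 1 (nvar i_y))))).

Definition ball_masses : cmd := for_loop i_x 0 (when (in_node i_x) ball_masses_row).

Definition choose_center : cmd :=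
  rset r_max (rnat 0) ;;
  for_loop i_y 0
    (when (BAnd (in_node i_y) (BAnd (BNle (NLoad a_big (nvar i_y)) (NConst 0))
            (BNot (BRle (RLoad r_ball (nvar i_y)) (rvar r_max)))))
      (rset r_max (RLoad r_ball (nvar i_y)) ;; nset a_best (nvar i_y))).

(** Small balls keep the index of the center whose ball contains the point; the
    pieces are the large balls minus the earlier ones. *)
Definition mark_balls : cmd :=
  rset r_part (rnat 0) ;;
  for_loop i_y 0
    (when (in_node i_y)
      (when (BRle (dist (nvar a_best) (nvar i_y)) radius_small)
        (CNStore a_small (nvar i_y) (nvar a_k)) ;;
       when (BAnd (BNle (NLoad a_big (nvar i_y)) (NConst 0))
                  (BRle (dist (nvar a_best) (nvar i_y)) radius_big))
        (CNStore a_big (nvar i_y) (nvar a_k) ;;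
         rset r_part (RAdd (rvar r_part) (RLoad 1 (nvar i_y)))))).

(** Branch into the small balls if the lightest of them, the last picked, is heavy
    enough for the gain [h (1 / k)] to pay for it. Otherwise the small balls in
    the last piece are all light; then descend to the last piece, provided that its mass
    makes the loss comparable with [h (1 / k)]. *)
Definition decide : cmd :=
  CIf (BRle (ROracle (RDiv (rvar r_max) (rvar r_w)))
            (RMul (rnat 42) (ROracle (RDiv (rnat 1) (ROfNat (nvar a_k))))))
    (nset a_dec (NConst 1))
    (when (BRle (rvar r_thr)
             (RMul (RMul (rvar r_part) (ROfNat (nvar a_k)))
                   (ROfNat (NAdd (nvar a_k) (NConst 1)))))
      (nset a_dec (NConst 2))).

Definition pick_round : cmd :=
  nset a_k (NAdd (nvar a_k) (NConst 1)) ;; choose_center ;; mark_balls ;; decide.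

Definition greedy : cmd :=
  nset a_k (NConst 0) ;; nset a_dec (NConst 0) ;;
  CWhile (BNle (nvar a_dec) (NConst 0)) pick_round.

(** From here on [a_small] holds the chosen children, numbered from 1. *)
Definition select_piece : cmd :=
  when (BNle (NConst 2) (nvar a_dec))
    (for_loop i_y 0
      (CIf (BNle (nvar a_k) (NLoad a_big (nvar i_y)))
        (CNStore a_small (nvar i_y) (NConst 1))
        (CNStore a_small (nvar i_y) (NConst 0))) ;;
     nset a_k (NConst 1)).

Definition check_cover : cmd :=
  nset a_cov (NConst 0) ;;
  for_loop i_y 0
    (when (BAnd (in_node i_y) (BNle (NLoad a_small (nvar i_y)) (NConst 0)))
      (nset a_cov (NConst 1))).

Definition next_node : cmd := nset a_cur (NAdd (nvar a_cur) (NConst 1)).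

(** An only child equal to its parent is not a new node: the radius of the parent
    is divided by 10 instead. At radius 0 such a node is a single point and
    becomes a leaf. *)
Definition keep_node : cmd :=
  CIf (BNle (NConst 1) (nvar a_fin))
    (CIf (BRle (RMul (rvar r_ecc) (ROracle (RDiv (rnat 1) (rnat 2))))
               (RLoad r_val (nvar a_cur)))
       CSkip (nset a_flag (NConst 1)) ;;
     next_node)
    (CRStore r_rad (nvar a_cur) (RDiv (RLoad r_rad (nvar a_cur)) (rnat 10)) ;;
     CNStore a_lev (nvar a_cur) (NAdd (NLoad a_lev (nvar a_cur)) (NConst 1))).

Definition write_members : cmd :=
  for_loop i_y 0
    (when (BNle (NConst 1) (NLoad a_small (nvar i_y)))
      (CNStore out_member
         (cell (NAdd (nvar a_cnt) (NLoad a_small (nvar i_y))) (nvar i_y)) (NConst 1))).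

(** Truncated subtraction replaces a test: the last factor in the sibling field is
    0 for the last child and 1 otherwise. *)
Definition write_fields : cmd :=
  let q := NAdd (nvar a_cnt) (NAdd (nvar i_x) (NConst 1)) in
  for_loop i_x a_k
    (CNStore a_lev q (NAdd (NLoad a_lev (nvar a_cur)) (NConst 1)) ;;
     CRStore r_rad q (RDiv (RLoad r_rad (nvar a_cur)) (rnat 10)) ;;
     CRStore r_val q (RAdd (RLoad r_val (nvar a_cur))
       (RMul (RLoad r_rad (nvar a_cur)) (ROracle (RDiv (rnat 1) (ROfNat (nvar a_k)))))) ;;
     CNStore out_sibling q
       (NMul (NAdd q (NConst 1))
             (NSub (NConst 1) (NSub (NAdd (nvar i_x) (NConst 2)) (nvar a_k))))).

(** The label is the level when there are several children. A node with an only
    child weighs nothing in the value, as [h 1 = 0], and label 0 asks least of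
    the diameter of the child. *)
Definition link_children : cmd :=
  CNStore out_label (nvar a_cur)
    (NMul (NLoad a_lev (nvar a_cur))
          (NSub (NConst 1) (NSub (NConst 2) (nvar a_k)))) ;;
  CNStore out_child (nvar a_cur) (NAdd (nvar a_cnt) (NConst 1)) ;;
  CNStore a_kids (nvar a_cur) (nvar a_k) ;;
  nset a_cnt (NAdd (nvar a_cnt) (nvar a_k)) ;;
  next_node.

Definition write_children : cmd := write_members ;; write_fields ;; link_children.

Definition analyse_node : cmd :=
  set_radius ;; weigh ;; ball_masses ;; greedy ;; select_piece ;; check_cover.

Definition process_node : cmd :=
  analyse_node ;;
  CIf (BAnd (BNle (nvar a_k) (NConst 1)) (BNle (nvar a_cov) (NConst 0)))
    keep_node write_children.

(** The nodes are written after all others, at addresses that are still blank. *)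
Definition fallback_tree : cmd :=
  let q i := NAdd (nvar a_cnt) (NConst i) in
  CNStore out_member (cell (q 1%N) (NConst 0)) (NConst 1) ;;
  CNStore out_member (cell (q 1%N) (nvar a_far)) (NConst 1) ;;
  CNStore out_member (cell (q 2%N) (NConst 0)) (NConst 1) ;;
  CNStore out_member (cell (q 3%N) (nvar a_far)) (NConst 1) ;;
  CNStore out_child (q 1%N) (q 2%N) ;;
  CNStore out_sibling (q 2%N) (q 3%N) ;;
  nset out_root (q 1%N).

Definition finish : cmd :=
  CIf (BNle (NConst 1) (nvar a_flag)) fallback_tree (nset out_root (NConst 1)).

Definition packing_algorithm : cmd :=
  find_far ;; make_root ;;
  CWhile (BNle (nvar a_cur) (nvar a_cnt)) process_node ;;
  finish.

(** * Scanning the points of a node *)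

Section Blocks.
Variables (R : realType) (h : R -> R) (n : nat).
Variables (d : 'I_n -> 'I_n -> R) (rho : 'I_n -> R).
Implicit Types (s : state R) (W : {set 'I_n}).

Lemma eqn_ord (x y : 'I_n) : ((x : nat) == y) = (x == y).
Proof. by []. Qed.

Lemma ord_ltS (x y : 'I_n) : (y < x.+1)%N = (y == x) || (y < x)%N.
Proof. by rewrite ltnS leq_eqVlt. Qed.

Lemma sum_lt_step (P : pred 'I_n) (F : 'I_n -> R) (x : 'I_n) :
  \sum_(y | P y && (y < x.+1)%N) F y =
  \sum_(y | P y && (y < x)%N) F y + (if P x then F x else 0).
Proof.
case: ifP => Px; last first.
  rewrite addr0; apply: eq_bigl => y; rewrite ltnS leq_eqVlt.
  by case: eqVneq => // /val_inj ->; rewrite Px.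
rewrite (bigD1 x) /=; last by rewrite Px ltnS leqnn.
rewrite addrC; congr (_ + _); apply: eq_bigl => y.
rewrite ltnS leq_eqVlt -val_eqE -andbA; congr (_ && _).
by case: eqVneq => [->|] /=; rewrite ?ltnn ?andbF ?andbT.
Qed.

Lemma sum_lt_size (P : pred 'I_n) (F : 'I_n -> R) :
  \sum_(y | P y && (y < n)%N) F y = \sum_(y | P y) F y.
Proof. by apply: eq_bigl => y; rewrite ltn_ord andbT. Qed.

(** The time [T x] varies with the point because points outside the node take
    constant time: thus the masses of all small balls are computed in time
    proportional to [n] per point of the node. *)
Lemma runs_for_points (I : nat -> state R -> Prop) (T : 'I_n -> nat) i c s :
  i != 0%N -> 0%N \notin nwrites c -> i \notin nwrites c -> nmem s 0 0 = n ->
  I 0%N (nstore s i 0 0) ->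
  (forall (x : 'I_n) s1, nmem s1 i 0 = x ->
    frame (i :: nwrites c) (rwrites c) s s1 -> I x s1 ->
    runs h c s1 (T x) (fun s2 => frame (nwrites c) (rwrites c) s1 s2 ->
       I x.+1 (nstore s2 i 0 x.+1))) ->
  runs h (for_loop i 0 c) s (\sum_x (T x + 20) + 20) (I n).
Proof.
move=> i0 c0 ci sn I0 body.
pose T' j := if insub j is Some x then T x else 0%N.
have := @runs_for _ h I T' i 0 c s i0 I0; rewrite sn => loop.
have -> : (\sum_x (T x + 20) = \sum_(j < n) (T' j + 20))%N.
  by apply: eq_bigr => x _; rewrite /T' valK.
apply: loop => j s1 jn s1i s10 fr Ij.
have -> : T' j = T (Ordinal jn) by rewrite /T' insubT.
apply: runs_post (body (Ordinal jn) s1 s1i fr Ij) _ => s2 I2 f2.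
have [fn _] := f2.
by split; [rewrite fn|rewrite fn|apply: I2].
Qed.

Lemma runs_for_points_const (I : nat -> state R -> Prop) (T : nat) i c s :
  i != 0%N -> 0%N \notin nwrites c -> i \notin nwrites c -> nmem s 0 0 = n ->
  I 0%N (nstore s i 0 0) ->
  (forall (x : 'I_n) s1, nmem s1 i 0 = x ->
    frame (i :: nwrites c) (rwrites c) s s1 -> I x s1 ->
    runs h c s1 T (fun s2 => frame (nwrites c) (rwrites c) s1 s2 ->
       I x.+1 (nstore s2 i 0 x.+1))) ->
  runs h (for_loop i 0 c) s (n * (T + 20) + 20) (I n).
Proof.
move=> i0 c0 ci sn I0 body.
have := runs_for_points (T := fun=> T) i0 c0 ci sn I0 body.
by rewrite sum_nat_const card_ord.
Qed.

(** The part of the state that is only read while the children of a node are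
    being chosen. *)
Record ctx s W r : Prop := {
  ctx_n : nmem s 0 0 = n;
  ctx_d : forall x y : 'I_n, rmem s 0 (x * n + y) = d x y;
  ctx_rho : forall x : 'I_n, rmem s 1 x = rho x;
  ctx_W : forall x : 'I_n, nmem s out_member (nmem s a_cur 0 * n + x)%N = (x \in W);
  ctx_r : rmem s r_cur 0 = r }.

Lemma ctx_frame NL RL s s' W r :
  all (fun a => a \notin NL) [:: 0%N; out_member; a_cur] ->
  all (fun a => a \notin RL) [:: 0%N; 1%N; r_cur] ->
  frame NL RL s s' -> ctx s W r -> ctx s' W r.
Proof.
move=> /and4P[n0 n2 n7 _] /and4P[r0 r1 r5 _] [fn fr] [c1 c2 c3 c4 c5]; split.
- by rewrite fn.
- by move=> x y; rewrite fr.
- by move=> x; rewrite fr.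
- by move=> x; rewrite fn // fn.
- by rewrite fr.
Qed.

Lemma in_nodeE s W r i (x : 'I_n) : ctx s W r -> nmem s i 0 = x ->
  beval h s (in_node i) = (x \in W).
Proof. by move=> c ix; rewrite /= ix (ctx_n c) (ctx_W c) lt0b. Qed.

Lemma weigh_spec s W r : ctx s W r ->
  runs h weigh s (n * 60 + 60) (fun s' =>
    [/\ rmem s' r_w 0 = mass rho W,
        rmem s' r_thr 0 = mass rho W * (1 - nmem s a_fin 0)%:R &
        forall y : 'I_n, [/\ nmem s' a_small y = 0%N, nmem s' a_big y = 0%N
          & rmem s' r_ball y = 0]]).
Proof.
move=> c0.
pose I j s1 := rmem s1 r_w 0 = \sum_(y | (y \in W) && (y < j)%N) rho y /\
  forall y : 'I_n, (y < j)%N -> [/\ nmem s1 a_small y = 0%N, nmem s1 a_big y = 0%N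
          & rmem s1 r_ball y = 0].
rewrite /weigh; eapply runs_le.
  eapply runs_seq.
    apply: (runs_straight (Q := fun s1 => ctx s1 W r /\ rmem s1 r_w 0 = 0
       /\ nmem s1 a_fin 0 = nmem s a_fin 0)) => //.
    by split=> //; case: c0.
  move=> s1 [c1 [w1 fin1]] _.
  eapply runs_seq.
    apply: (runs_for_points_const (I := I)) => //.
    - exact: ctx_n c1.
    - by split=> //=; rewrite big_pred0 // => y; rewrite andbF.
    move=> x s2 xE f2 [w2 z2].
    have c2 : ctx s2 W r by apply: ctx_frame f2 c1.
    apply: runs_straight => // _; rewrite /I /=.
    rewrite /upd /= xE (ctx_n c2) (ctx_W c2) lt0b sum_lt_step -w2.
    split.
      by case: ifP => xW /=; rewrite /upd /= ?xE ?(ctx_rho c2) ?addr0.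
    move=> y yx; have zy : y != x :> nat -> (y < x)%N by lia.
    by case: ifP => xW /=; rewrite /upd /=; case: eqP => [//|/eqP/zy/z2].
  move=> s3 [w3 z3] f3.
  have [fn fr] := f3.
  apply: runs_straight => //=; rewrite /upd /= w3 sum_lt_size fn // fin1.
  by split=> // y; apply: z3.
by rewrite /=; lia.
Qed.

Lemma ball_masses_row_spec s W r (x : 'I_n) : ctx s W r -> nmem s i_x 0 = x ->
  rmem s r_ball x = 0 ->
  runs h ball_masses_row s (n * 80 + 20) (fun s' =>
    forall y : 'I_n, rmem s' r_ball y =
      if y == x then local_mass d rho W x (r / 20) else rmem s r_ball y).
Proof.
move=> c0 xE g0.
pose F z := (z \in W) && (d x z <= r / 20).
pose I j s1 := forall y : 'I_n, rmem s1 r_ball y =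
  if y == x then \sum_(z | F z && (z < j)%N) rho z else rmem s r_ball y.
eapply runs_le.
  apply: (@runs_mono _ _ _ _ _ _ (I n)).
  - apply: (runs_for_points_const (I := I)) => //.
    + exact: ctx_n c0.
    + move=> y /=; case: eqP => [->|//].
      by rewrite g0 big_pred0 // => z; rewrite ltn0 andbF.
    move=> z s2 zE f2 g2.
    have c2 : ctx s2 W r by apply: ctx_frame f2 c0.
    have xE2 : nmem s2 i_x 0 = x by rewrite (proj1 f2).
    apply: runs_straight => // _; rewrite /I /= => y.
    rewrite /upd /= zE xE2 (ctx_n c2) (ctx_W c2) lt0b (ctx_d c2) (ctx_r c2).
    rewrite sum_lt_step /F -/(F z); case: ifP => Fz /=; last by rewrite addr0 g2.
    rewrite /upd /= (ctx_rho c2) !g2 eqxx eqn_ord.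
    by case: eqP.
  - exact: leqnn.
  - move=> s' Is' y; rewrite Is'; case: eqP => // _.
    by rewrite sum_lt_size; apply: eq_bigl => z; rewrite !inE.
by rewrite /=; lia.
Qed.

Lemma ball_masses_spec s W r : ctx s W r ->
  (forall y : 'I_n, rmem s r_ball y = 0) ->
  runs h ball_masses s (n * 60 + #|W| * (n * 80 + 20) + 20) (fun s' =>
    forall y : 'I_n, rmem s' r_ball y =
      if y \in W then local_mass d rho W y (r / 20) else 0).
Proof.
move=> c0 g0.
pose I j s1 := forall y : 'I_n, rmem s1 r_ball y =
  if (y \in W) && (y < j)%N then local_mass d rho W y (r / 20) else 0.
pose T (x : 'I_n) := (20 + (if x \in W then n * 80 + 20 else 0))%N.
eapply runs_le.
  apply: (@runs_mono _ _ _ _ _ _ (I n)).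
  - apply: (runs_for_points (I := I) (T := T)) => //.
    + exact: ctx_n c0.
    + by move=> y /=; rewrite ltn0 andbF g0.
    move=> x s2 xE f2 g2.
    have c2 : ctx s2 W r by apply: ctx_frame f2 c0.
    apply: (@runs_le _ _ _ _ (bcost (in_node i_x) + (if x \in W then n * 80 + 20 else 1)%N).+1%N).
      apply: runs_if; rewrite (in_nodeE c2 xE) => xW.
        rewrite xW.
        apply: (runs_mono (ball_masses_row_spec c2 xE _)) => //.
          by rewrite g2 ltnn andbF.
        move=> s3 g3 f3 y; rewrite /= g3 g2 ord_ltS.
        by case: eqP => [->|//]; rewrite xW.
      rewrite (negbTE xW); apply: runs_straight => // _ y.
      rewrite /= g2 ord_ltS.
      by case: eqP => [->|//]; rewrite (negbTE xW).
    by rewrite /T /=; case: ifP => _; lia.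
  - exact: leqnn.
  - by move=> s' Is' y; rewrite Is' ltn_ord andbT.
rewrite /T.
have -> : (\sum_(x < n) (20 + (if x \in W then n * 80 + 20 else 0) + 20) =
   n * 40 + #|W| * (n * 80 + 20))%N.
  rewrite !big_split /= -big_mkcond /= !sum_nat_const card_ord.
  by move: (#|W| * _)%N => z; lia.
by move: (#|W| * _)%N => z; lia.
Qed.

Lemma choose_center_spec s W r : ctx s W r ->
  let U := [set y in W | nmem s a_big y == 0%N] in
  (exists y, y \in U) -> (forall y : 'I_n, y \in U -> 0 < rmem s r_ball y) ->
  runs h choose_center s (n * 80 + 60) (fun s' => exists x : 'I_n,
    [/\ x \in U, nmem s' a_best 0 = x, rmem s' r_max 0 = rmem s r_ball x &
     forall y : 'I_n, y \in U -> rmem s r_ball y <= rmem s r_ball x]).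
Proof.
move=> c0 U [y0 y0U] g0.
pose I j s1 := (rmem s1 r_max 0 = 0 /\ forall y, y \in U -> ~~ (y < j)%N) \/
  exists x : 'I_n, [/\ x \in U, nmem s1 a_best 0 = x, rmem s1 r_max 0 = rmem s r_ball x &
     forall y : 'I_n, y \in U -> (y < j)%N -> rmem s r_ball y <= rmem s r_ball x].
rewrite /choose_center; eapply runs_le.
  eapply runs_seq.
    apply: (runs_straight (Q := fun s1 => rmem s1 r_max 0 = 0)) => //.
  move=> s1 m1 f1.
  have c1 : ctx s1 W r by apply: ctx_frame f1 c0.
  apply: (@runs_mono _ _ _ _ _ _ (I n)).
  - apply: (runs_for_points_const (I := I)) => //.
    + exact: ctx_n c1.
    + by left; split.
    move=> x s2 xE f2 I2.
    have c2 : ctx s2 W r by apply: ctx_frame f2 c1.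
    have b2 : nmem s2 a_big x = nmem s a_big x by rewrite (proj1 f2) // (proj1 f1).
    have g2 : rmem s2 r_ball x = rmem s r_ball x by rewrite (proj2 f2) // (proj2 f1).
    have xUE : (x \in U) = (x \in W) && (nmem s a_big x <= 0)%N.
      by rewrite inE leqn0.
    apply: runs_straight => // _; rewrite /= xE (ctx_n c2) (ctx_W c2) lt0b b2 g2.
    rewrite andbA -xUE -ltNge; case: ifP => [/andP[xU gx]|xU] /=.
      right; exists x; split=> //; rewrite /= /upd //= => y yU yx.
      have [->//|yx'] := eqVneq y x.
      have {}yx : (y < x)%N by move: yx yx'; rewrite -val_eqE /=; lia.
      case: I2 => [[_ /(_ _ yU)]|[z [zU zE mE zmax]]]; first by rewrite yx.
      by apply: le_trans (zmax _ yU yx) _; rewrite -mE ltW.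
    case: I2 => [[m0 noU]|[z [zU zE mE zmax]]].
      left; split=> // y yU; rewrite ord_ltS negb_or noU // andbT.
      apply/negP => yx; have {}yx : y = x by apply/eqP.
      by move: xU; rewrite -yx yU /= m0 g0.
    right; exists z; split=> // y yU; rewrite ord_ltS => /orP[yx|]; last exact: zmax.
    have {}yx : y = x by apply/eqP.
    by move: xU; rewrite -yx yU /= mE leNgt => ->.
  - exact: leqnn.
  - move=> s' [[_ /(_ _ y0U)]|[x [xU xE mE xmax]]]; first by rewrite ltn_ord.
    by exists x; split=> // y yU; apply: xmax.
by rewrite /=; lia.
Qed.

Lemma mark_balls_spec s W r (x0 : 'I_n) : ctx s W r -> nmem s a_best 0 = x0 ->
  runs h mark_balls s (n * 120 + 60) (fun s' =>
    [/\ forall y : 'I_n, nmem s' a_small y =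
          (if (y \in W) && (d x0 y <= r / 20) then nmem s a_k 0 else nmem s a_small y),
        forall y : 'I_n, nmem s' a_big y =
          (if [&& y \in W, nmem s a_big y == 0%N & d x0 y <= 3 / 10 * r]
           then nmem s a_k 0 else nmem s a_big y) &
        rmem s' r_part 0 =
          \sum_(y | [&& y \in W, nmem s a_big y == 0%N & d x0 y <= 3 / 10 * r]) rho y]).
Proof.
move=> c0 bE.
pose S y := (y \in W) && (d x0 y <= r / 20).
pose B y := [&& y \in W, nmem s a_big y == 0%N & d x0 y <= 3 / 10 * r].
pose I j s1 := [/\ forall y : 'I_n, nmem s1 a_small y =
          (if S y && (y < j)%N then nmem s a_k 0 else nmem s a_small y),
        forall y : 'I_n, nmem s1 a_big y =
          (if B y && (y < j)%N then nmem s a_k 0 else nmem s a_big y) &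
        rmem s1 r_part 0 = \sum_(y | B y && (y < j)%N) rho y].
rewrite /mark_balls; eapply runs_le.
  eapply runs_seq.
    apply: (runs_straight (Q := fun s1 => rmem s1 r_part 0 = 0)) => //.
  move=> s1 m1 f1.
  have c1 : ctx s1 W r by apply: ctx_frame f1 c0.
  apply: (@runs_mono _ _ _ _ _ _ (I n)).
  - apply: (runs_for_points_const (I := I)) => //.
    + exact: ctx_n c1.
    + split=> [y|y|] /=; rewrite ?ltn0 ?andbF /upd /= ?(proj1 f1) //.
      by rewrite m1 big_pred0 // => y; rewrite ltn0 andbF.
    move=> x s2 xE f2 [sm2 bg2 pt2].
    have c2 : ctx s2 W r by apply: ctx_frame f2 c1.
    have bE2 : nmem s2 a_best 0 = x0 by rewrite (proj1 f2) // (proj1 f1).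
    have kE2 : nmem s2 a_k 0 = nmem s a_k 0 by rewrite (proj1 f2) // (proj1 f1).
    have bx2 : nmem s2 a_big x = nmem s a_big x by rewrite bg2 ltnn andbF.
    apply: runs_straight => // _.
    rewrite /I /= /upd /= xE bE2 (ctx_n c2) (ctx_W c2) lt0b (ctx_d c2) (ctx_r c2).
    rewrite sum_lt_step.
    have SxE : S x = (x \in W) && (d x0 x <= r / 20) by [].
    have BxE : B x = (x \in W) && ((nmem s a_big x <= 0)%N && (d x0 x <= 3 / 10 * r)).
      by rewrite /B leqn0.
    case xW: (x \in W) SxE BxE => /= SxE BxE; last first.
      split=> [y|y|]; rewrite ?sm2 ?bg2 ?ord_ltS /=.
      + by have [->|] := eqVneq y x; rewrite ?SxE.
      + by have [->|] := eqVneq y x; rewrite ?BxE.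
      + by rewrite BxE addr0.
    case dS: (d x0 x <= r / 20) SxE => SxE;
      rewrite /= /upd /= ?xE ?bE2 ?kE2 (ctx_n c2) (ctx_d c2) (ctx_r c2) bx2 -BxE;
      case Bx: (B x); rewrite /= /upd /= ?(ctx_rho c2) ?pt2 ?kE2 ?xE;
      split=> [y|y|]; rewrite ?eqn_ord ?sm2 ?bg2 ?ord_ltS /= ?addr0 //;
      have [->|yx] := eqVneq y x; rewrite /= ?SxE ?Bx ?ltnn ?andbF //.
  - exact: leqnn.
  - by move=> s' [sm' bg' pt']; split=> [y|y|];
      rewrite ?sm' ?bg' ?pt' ?sum_lt_size ?ltn_ord ?andbT.
by rewrite /=; lia.
Qed.
End Blocks.

(** * Greedy choice of the children *)

Section Greedy.
Variables (R : realType) (X : finType) (d : X -> X -> R) (rho : X -> R).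
Hypothesis d_metric : is_metric d.
Hypothesis rho_prob : is_prob rho.
Variables (W : {set X}) (r : R).
Hypothesis r_ge0 : 0 <= r.

Local Notation ball y := (local_mass d rho W y (r / 20)).

(** After [k] picks, with centers [c 1 .. c k]: [sm] indexes the small balls
    around the centers and [bm] the pieces, a piece being a large ball minus
    the earlier pieces. By [gi_max] a center has the heaviest small ball among
    the points free when it was picked, hence among all points of its piece and
    of later ones. *)
Record greedy_inv (sm bm : X -> nat) (k : nat) (c : nat -> X) : Prop := {
  gi_center : forall i, (0 < i <= k)%N -> c i \in W /\ bm (c i) = i;
  gi_small_le : forall y, (sm y <= k)%N;
  gi_small : forall i y, (0 < i <= k)%N ->
    sm y = i <-> y \in W /\ d (c i) y <= r / 20;
  gi_big_le : forall y, (bm y <= k)%N;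
  gi_big : forall y, (0 < bm y)%N -> y \in W /\ d (c (bm y)) y <= 3 / 10 * r;
  gi_free : forall i y, (0 < i <= k)%N -> y \in W -> bm y = 0%N ->
    3 / 10 * r < d (c i) y;
  gi_sep : forall i j, (0 < i)%N -> (i < j)%N -> (j <= k)%N ->
    3 / 10 * r < d (c i) (c j);
  gi_max : forall i y, (0 < i <= k)%N -> y \in W -> bm y = 0%N \/ (i <= bm y)%N ->
    ball y <= ball (c i) }.

Lemma greedy_inv_start (c : nat -> X) : greedy_inv (fun=> 0%N) (fun=> 0%N) 0 c.
Proof.
have no i : (0 < i <= 0)%N = false by case: i.
by split=> // [i|i y|i y|i j i0 ij|i y]; rewrite ?no //; lia.
Qed.

Let d0 x : d x x = 0.
Proof. exact/(Defs.metric_eq0 d_metric). Qed.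

(** A free point is farther than [3 / 10 * r] from the earlier centers, so its
    small ball, of radius [r / 20], meets none of theirs. *)
Lemma greedy_inv_pick sm bm k c x sm' bm' : greedy_inv sm bm k c ->
  x \in W -> bm x = 0%N ->
  (forall y, y \in W -> bm y = 0%N -> ball y <= ball x) ->
  (forall y, sm' y = if (y \in W) && (d x y <= r / 20) then k.+1 else sm y) ->
  (forall y, bm' y = if [&& y \in W, bm y == 0%N & d x y <= 3 / 10 * r]
                     then k.+1 else bm y) ->
  greedy_inv sm' bm' k.+1 (fun i => if i == k.+1 then x else c i).
Proof.
move=> gi xW bx xmax sm'E bm'E.
have r3 : 0 <= 3 / 10 * r by have := r_ge0; lra.
have old i : (0 < i <= k)%N -> i == k.+1 = false by lia.
have range i : (0 < i <= k.+1)%N -> i = k.+1 \/ (0 < i <= k)%N by lia.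
have bm'old y : (0 < bm y)%N -> bm' y = bm y.
  by move=> by0; rewrite bm'E (gtn_eqF by0) andbF.
have bm'0 y : bm' y = 0%N -> y \in W -> bm y = 0%N /\ 3 / 10 * r < d x y.
  rewrite bm'E; case: ifP => // h by0 yW; split=> //.
  by move: h; rewrite yW by0 eqxx /= leNgt => /negbFE.
split.
- move=> i /range[->|ik]; first by rewrite eqxx xW bm'E xW bx d0 eqxx r3.
  rewrite (old _ ik); have [ciW bci] := gi_center gi ik.
  by rewrite ciW bm'old bci //; lia.
- by move=> y; rewrite sm'E; case: ifP => // _; apply: leqW; apply: gi_small_le gi _.
- move=> i y /range[->|ik].
    rewrite eqxx sm'E; case: ifP => [/andP[-> ->]//|h].
    split=> [sy|[yW dy]]; last by rewrite yW dy in h.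
    by have := gi_small_le gi y; rewrite sy ltnn.
  rewrite (old _ ik) sm'E; case: ifP => [/andP[yW dxy]|_]; last exact: (gi_small gi).
  split=> [ki|[_ dcy]]; first by move: ik; rewrite -ki ltnn andbF.
  exfalso.
  have := gi_free gi ik xW bx; have := Defs.metric_triangle d_metric (c i) y x.
  by rewrite (Defs.metric_sym d_metric y x); have := r_ge0; lra.
- by move=> y; rewrite bm'E; case: ifP => // _; apply: leqW; apply: gi_big_le gi _.
- move=> y; rewrite bm'E; case: ifP => [/and3P[yW _ dxy] _|_ by0].
    by rewrite eqxx.
  rewrite old ?by0 ?(gi_big_le gi) //; exact: gi_big gi _ by0.
- move=> i y /range[->|ik] yW /bm'0/(_ yW)[by0 dxy]; first by rewrite eqxx.
  by rewrite (old _ ik); apply: gi_free gi _ _ ik yW by0.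
- move=> i j i0 ij; rewrite leq_eqVlt => /predU1P[jk|jk].
    have ik : (0 < i <= k)%N by lia.
    by rewrite (old _ ik) jk eqxx; apply: gi_free gi _ _ ik xW bx.
  rewrite (old i); last by lia.
  by rewrite (old j); [apply: gi_sep gi _ _ i0 ij _|]; lia.
- move=> i y /range[->|ik] yW.
    rewrite eqxx => byk; apply: xmax => //.
    move: byk; rewrite bm'E; case: ifP => [/and3P[_ /eqP]//|_] [//|].
    by have := gi_big_le gi y; lia.
  rewrite (old _ ik) => byi; apply: (gi_max gi ik yW).
  move: byi; rewrite bm'E; case: ifP => // /and3P[_ /eqP by0 _] _; by left.
Qed.

Definition covered (bm : X -> nat) : R := \sum_(y in W | (0 < bm y)%N) rho y.

Lemma covered_pick (bm bm' : X -> nat) k x :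
  (forall y, bm' y = if [&& y \in W, bm y == 0%N & d x y <= 3 / 10 * r]
                     then k.+1 else bm y) ->
  covered bm' = covered bm +
    \sum_(y | [&& y \in W, bm y == 0%N & d x y <= 3 / 10 * r]) rho y.
Proof.
move=> bm'E; rewrite /covered (bigID (fun y => (0 < bm y)%N)) /=; congr (_ + _).
  apply: eq_bigl => y; rewrite bm'E; case: (y \in W) => //=.
  by case: ifP => //= _; rewrite andbb.
apply: eq_bigl => y; rewrite bm'E -eqn0Ngt; case: (y \in W) => //=.
by case: eqP => [->|] //=; rewrite ?andbT ?andbF //; case: ifP.
Qed.

Lemma exists_uncovered (bm : X -> nat) : covered bm < mass rho W ->
  exists y, (y \in W) && (bm y == 0%N).
Proof.
move=> lt; apply/existsP; apply: contraT; rewrite negb_exists => /forallP no.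
suff eq : covered bm = mass rho W by rewrite eq ltxx in lt.
apply: eq_bigl => y; have := no y; rewrite negb_and -lt0n.
by case: (y \in W).
Qed.

(** A piece that was not chosen is lighter than [w / (k * (k + 1))]. These bounds
    telescope to [w * k / (k + 1)], so some point of the node is still free. *)
Lemma covered_bound (C P w : R) (k : nat) :
  C * k.+1%:R <= w * k%:R -> P * k.+1%:R * k.+2%:R <= w ->
  (C + P) * k.+2%:R <= w * k.+1%:R.
Proof.
move=> hC hP; have k1 : 0 < k.+1%:R :> R by rewrite ltr0n.
have k2 : 0 <= k.+2%:R :> R by rewrite ler0n.
rewrite -(ler_pM2r k1).
have h1 : C * k.+1%:R * k.+2%:R <= w * k%:R * k.+2%:R by rewrite ler_wpM2r.
have e1 : k.+2%:R = k%:R + 2 :> R by rewrite -(addn2 k) natrD.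
have e2 : k.+1%:R = k%:R + 1 :> R by rewrite -(addn1 k) natrD.
apply: (@le_trans _ _ (w * k%:R * k.+2%:R + w)).
  have -> : (C + P) * k.+2%:R * k.+1%:R =
    C * k.+1%:R * k.+2%:R + P * k.+1%:R * k.+2%:R by ring.
  exact: lerD.
by rewrite e1 e2 le_eqVlt; apply/orP; left; apply/eqP; ring.
Qed.

Lemma covered_lt (C w : R) (k : nat) : 0 < w -> C * k.+1%:R <= w * k%:R -> C < w.
Proof.
move=> w0 hC; have k1 : 0 < k.+1%:R :> R by rewrite ltr0n.
by rewrite -(ltr_pM2r k1); apply: le_lt_trans hC _; rewrite ltr_pM2l // ltr_nat.
Qed.

(** ** The sets of the children *)

(** [mk] numbers the children from 1, and 0 stands for the points left out. *)
Record children_ok (K : nat) (mk : X -> nat) : Prop := {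
  co_pos : (0 < K)%N;
  co_mem : forall y, (0 < mk y)%N -> y \in W;
  co_le : forall y, (mk y <= K)%N;
  co_ne : forall i, (0 < i <= K)%N -> exists y, mk y = i;
  co_diam : forall y z, (0 < mk y)%N -> mk y = mk z -> d y z <= 6 / 10 * r;
  co_small : forall y z, (1 < K)%N -> (0 < mk y)%N -> mk y = mk z -> d y z <= r / 10;
  co_sep : forall y z, (1 < K)%N -> (0 < mk y)%N -> (0 < mk z)%N -> mk y <> mk z ->
    r / 5 <= d y z }.

(** The children are disjoint, hence each level of the tree has at most [n] points. *)
Lemma children_card K mk : children_ok K mk ->
  (\sum_(i < K) #|[set y | mk y == i.+1]%SET| <= #|W|)%N.
Proof.
move=> ok.
rewrite (eq_bigr (fun i : 'I_K => \sum_(y in W | mk y == i.+1) 1)%N); last first.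
  move=> i _; rewrite sum1dep_card; apply: eq_card => y; rewrite [LHS]inE [RHS]inE.
  by case: eqP => [yi|]; rewrite ?andbF // (co_mem ok) // yi.
rewrite -sum1_card.
under eq_bigr do rewrite big_mkcondr /=.
rewrite exchange_big /=; apply: leq_sum => y _.
rewrite -big_mkcond /=; have [y0|y0] := posnP (mk y).
  by rewrite big_pred0 // => i; rewrite y0.
have yK : ((mk y).-1 < K)%N by rewrite prednK // (co_le ok).
rewrite (eq_bigl (pred1 (Ordinal yK))) ?big_pred1_eq // => i /=.
by rewrite -val_eqE /= -(prednK y0) eqSS eq_sym.
Qed.

Lemma children_count K mk : children_ok K mk -> (K <= #|W|)%N.
Proof.
move=> ok; apply: leq_trans (children_card ok).
rewrite -[X in (X <= _)%N](card_ord K) -sum1_card; apply: leq_sum => i _.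
have [|y yi] := co_ne ok (i := i.+1); first by rewrite /= ltn_ord.
by apply/card_gt0P; exists y; rewrite inE yi.
Qed.

Lemma diam_two (c y z : X) s : d c y <= s -> d c z <= s -> d y z <= 2 * s.
Proof.
move=> dy dz; have := Defs.metric_triangle d_metric y c z.
by rewrite (Defs.metric_sym d_metric y c); lra.
Qed.

Lemma branch_children sm bm k c : (0 < k)%N -> greedy_inv sm bm k c ->
  children_ok k sm.
Proof.
move=> k0 gi; have sy y : (0 < sm y)%N -> y \in W /\ d (c (sm y)) y <= r / 20.
  by move=> y0; apply/(gi_small gi) => //; rewrite y0 (gi_small_le gi).
have close y z : (0 < sm y)%N -> sm y = sm z -> d y z <= r / 10.
  move=> y0 yz; have [_ dy] := sy y y0; have [|_ dz] := sy z; first by rewrite -yz.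
  by have := diam_two dy; rewrite {1}yz => /(_ _ dz); lra.
split=> //.
- by move=> y /sy[].
- exact: gi_small_le gi.
- move=> i ik; exists (c i); apply/(gi_small gi) => //.
  by have [ciW _] := gi_center gi ik; rewrite d0; have := r_ge0; split=> //; lra.
- by move=> y z y0 yz; have := close y z y0 yz; have := r_ge0; lra.
- by move=> y z _; apply: close.
- move=> y z _; wlog yz : y z / (sm y < sm z)%N.
    move=> H y0 z0 /eqP ne; case: (ltngtP (sm y) (sm z)) ne => // lt _.
      by apply: H => //; lia.
    by rewrite (Defs.metric_sym d_metric); apply: H => //; lia.
  move=> y0 z0 _; have [_ dy] := sy y y0; have [_ dz] := sy z z0.
  have := gi_sep gi y0 yz (gi_small_le gi z).
  have := Defs.metric_triangle d_metric (c (sm y)) y (c (sm z)).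
  have := Defs.metric_triangle d_metric y z (c (sm z)).
  rewrite (Defs.metric_sym d_metric z (c (sm z))).
  by have := r_ge0; lra.
Qed.

Lemma descend_children sm bm k c : (0 < k)%N -> greedy_inv sm bm k c ->
  children_ok 1 (fun y => (k <= bm y)%N).
Proof.
move=> k0 gi.
have piece y : (k <= bm y)%N -> bm y = k.
  by move=> ky; apply/eqP; rewrite eqn_leq ky (gi_big_le gi).
have kk : (0 < k <= k)%N by rewrite k0 leqnn.
split=> //.
- by move=> y; rewrite lt0b => /piece yk; have [] := gi_big gi (y := y); rewrite ?yk.
- by move=> y; apply: leq_b1.
- move=> i i1; have -> : i = 1%N by lia.
  by exists (c k); have [_ ->] := gi_center gi kk; rewrite leqnn.
- move=> y z; rewrite lt0b => ky; rewrite ky => /esym/eqP; rewrite eqb1 => kz.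
  have [|_] := gi_big gi (y := y); rewrite piece // => dy.
  have [|_] := gi_big gi (y := z); rewrite piece // => dz.
  by have := diam_two dy dz; lra.
Qed.

Section NodeInvariant.
Variables (h : R -> R) (E V : R).
Hypothesis h_sf : submultiplicative_functional h.
Hypothesis r_gt0 : 0 < r.
Hypothesis W_inv : node_inv d rho h E W r V.

Let W_pos x : x \in W -> 0 < rho x.
Proof. by case: W_inv => _ pos _ _; apply: pos. Qed.

Let ball_gt0 x : x \in W -> 0 < ball x.
Proof.
move=> xW; apply: (mass_gt0 rho_prob (x := x)) (W_pos xW).
by rewrite inE xW mem_cball //; have := r_gt0; lra.
Qed.

Let w_gt0 : 0 < mass rho W.
Proof. by case: W_inv => -[x xW] pos _ _; apply: (mass_gt0 rho_prob xW (pos _ xW)). Qed.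

Let ball_le x : ball x <= mass rho W.
Proof. by apply: (mass_mono rho_prob); apply: finset.subsetIl. Qed.

(** The last small ball is the lightest, so the test on it bounds the loss in all
    the children. *)
Lemma branch_node_inv sm bm k c i : greedy_inv sm bm k c -> (0 < i <= k)%N ->
  h (ball (c k) / mass rho W) <= 42 * h (1 / k%:R) ->
  node_inv d rho h E [set y | sm y == i]%SET (r / 10) (V + r * h (1 / k%:R)).
Proof.
move=> gi ik good; have [ciW bci] := gi_center gi ik.
have k0 : (0 < k)%N by lia.
have kk : (0 < k <= k)%N by rewrite k0 leqnn.
have [ckW bck] := gi_center gi kk.
have setE : [set y | sm y == i]%SET = (W :&: cball d (c i) (r / 20))%SET.
  apply/finset.setP => y; rewrite !inE; apply/eqP/andP.
    by move/(gi_small gi y ik) => [].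
  by move=> [yW dy]; apply/(gi_small gi y ik).
apply: (node_inv_split d_metric rho_prob h_sf r_gt0 W_inv ciW).
- by exists (c i); rewrite setE inE ciW mem_cball //; have := r_gt0; lra.
- rewrite setE; apply: finset.setIS; apply: cball_mono.
  by have := r_gt0; lra.
- rewrite setE -/(local_mass _ _ _ _ _); apply: le_trans good.
  apply: (sf_noninc h_sf).
  + by rewrite divr_gt0 // ball_gt0.
  + rewrite ler_pM2r ?invr_gt0 //; apply: (gi_max gi ik ckW).
    by right; rewrite bck; case/andP: ik.
  + by rewrite ler_pdivrMr // mul1r.
Qed.

(** Small balls around the points of the last piece are no heavier than that of
    its center, which has failed the test for branching. *)
Lemma descend_node_inv sm bm k c : greedy_inv sm bm k c -> (0 < k)%N ->
  mass rho W <= mass rho [set y | (k <= bm y)%N]%SET * k%:R * k.+1%:R ->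
  42 * h (1 / k%:R) <= h (ball (c k) / mass rho W) ->
  node_inv d rho h E [set y | (k <= bm y)%N]%SET (r / 10) V.
Proof.
move=> gi k0 heavy gap.
have kk : (0 < k <= k)%N by rewrite k0 leqnn.
have [ckW bck] := gi_center gi kk.
have piece y : (k <= bm y)%N -> bm y = k.
  by move=> ky; apply/eqP; rewrite eqn_leq ky (gi_big_le gi).
have sub : [set y | (k <= bm y)%N]%SET \subset (W :&: cball d (c k) (3 / 10 * r))%SET.
  apply/fintype.subsetP => y; rewrite !inE => /piece yk.
  by have [|-> ] := gi_big gi (y := y); rewrite yk.
apply: (node_inv_single d_metric rho_prob h_sf r_gt0 W_inv ckW _ sub k0 heavy gap) => //.
  by exists (c k); rewrite inE bck leqnn.
move=> x; rewrite inE => kx; have xk := piece x kx.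
have [|xW _] := gi_big gi (y := x); first by rewrite xk.
by apply: (gi_max gi kk xW); right.
Qed.
End NodeInvariant.
End Greedy.

(** * The loop that picks centers *)

Section GreedyLoop.
Variables (R : realType) (h : R -> R) (n : nat).
Variables (d : 'I_n -> 'I_n -> R) (rho : 'I_n -> R).
Hypothesis d_metric : is_metric d.
Hypothesis rho_prob : is_prob rho.
Implicit Types (s : state R) (W : {set 'I_n}).

Lemma decide_spec s :
  let k := nmem s a_k 0 in
  let branch := h (rmem s r_max 0 / rmem s r_w 0) <= 42 * h (1 / k%:R) in
  let descend := rmem s r_thr 0 <= rmem s r_part 0 * k%:R * k.+1%:R in
  runs h decide s 100 (fun s' =>
    nmem s' a_dec 0 = if branch then 1%N else if descend then 2%N else nmem s a_dec 0).
Proof.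
move=> k branch descend.
eapply runs_le.
  apply: runs_straight => //.
  rewrite /= addn1 -/k -/branch -/descend.
  by case: ifP => _ //; case: ifP.
by [].
Qed.

Definition small_of s (y : 'I_n) : nat := nmem s a_small y.
Definition big_of s (y : 'I_n) : nat := nmem s a_big y.

Local Notation ball W r y := (local_mass d rho W y (r / 20)).

Section Loop.
Variables (s : state R) (W : {set 'I_n}) (r : R).
Hypotheses (s_ctx : ctx d rho s W r) (r_ge0 : 0 <= r).
Hypotheses (W_pos : forall x, x \in W -> 0 < rho x) (W_ne : exists x, x \in W).
Hypothesis s_clear : forall y : 'I_n, small_of s y = 0%N /\ big_of s y = 0%N.
Hypothesis s_ball : forall y : 'I_n, y \in W -> rmem s r_ball y = ball W r y.
Hypothesis s_w : rmem s r_w 0 = mass rho W.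
Hypothesis s_thr : rmem s r_thr 0 = mass rho W * (1 - nmem s a_fin 0)%:R.

Definition decision s' c : Prop :=
  let k := nmem s' a_k 0 in
  (0 < k)%N /\
  ((nmem s' a_dec 0 = 1%N /\ h (ball W r (c k) / mass rho W) <= 42 * h (1 / k%:R)) \/
   [/\ nmem s' a_dec 0 = 2%N,
     rmem s r_thr 0 <= mass rho [set y | (k <= big_of s' y)%N]%SET * k%:R * k.+1%:R &
     42 * h (1 / k%:R) <= h (ball W r (c k) / mass rho W)]).

(** The bound on the covered mass guarantees a free point for the next pick. The
    middle clause expresses that at radius 0 the first pick is decisive. *)
Definition greedy_loop_inv s' : Prop :=
  frame (nwrites greedy) (rwrites greedy) s s' /\
  exists c, [/\ greedy_inv d rho W r (small_of s') (big_of s') (nmem s' a_k 0) c,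
    (0 < nmem s a_fin 0)%N -> (nmem s' a_k 0 <= (0 < nmem s' a_dec 0))%N &
    (nmem s' a_dec 0 = 0%N /\
     covered rho W (big_of s') * (nmem s' a_k 0).+1%:R
       <= mass rho W * (nmem s' a_k 0)%:R) \/
    decision s' c].

Let w_gt0 : 0 < mass rho W.
Proof. by case: W_ne => x xW; apply: (mass_gt0 rho_prob xW (W_pos xW)). Qed.

Definition uncovered s' : {set 'I_n} := [set y in W | nmem s' a_big y == 0%N]%SET.

(** The center picked leaves the free points: a round takes [O(n)] time, and
    there are at most as many rounds as points in the node. *)
Lemma pick_round_spec s1 : greedy_loop_inv s1 -> nmem s1 a_dec 0 = 0%N ->
  runs h pick_round s1 (n * 200 + 240) (fun s2 =>
    greedy_loop_inv s2 /\ (#|uncovered s2| < #|uncovered s1|)%N).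
Proof.
move=> [f1 [c [gi1 fin1 [[_ cov1]|[k0 [[dec1 _]|[dec1 _ _]]]]]]] dec0;
  try by rewrite dec1 in dec0.
have c1 : ctx d rho s1 W r by apply: ctx_frame f1 s_ctx.
have [x0 /andP[x0W x0b]] := exists_uncovered (covered_lt w_gt0 cov1).
have ball1 (y : 'I_n) : y \in W -> rmem s1 r_ball y = ball W r y.
  by move=> yW; rewrite (proj2 f1) // s_ball.
have w1 : rmem s1 r_w 0 = mass rho W by rewrite (proj2 f1).
have thr1 : rmem s1 r_thr 0 = rmem s r_thr 0 by rewrite (proj2 f1).
rewrite /pick_round; eapply runs_le.
  eapply runs_seq.
    apply: (runs_straight (Q := fun s2 => nmem s2 a_k 0 = (nmem s1 a_k 0).+1)) => //=.
    by rewrite /upd /= addn1.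
  move=> s2 k2 f2; have c2 : ctx d rho s2 W r by apply: ctx_frame f2 c1.
  have big2 (y : 'I_n) : nmem s2 a_big y = big_of s1 y by rewrite (proj1 f2).
  have ball2 (y : 'I_n) : rmem s2 r_ball y = rmem s1 r_ball y by rewrite (proj2 f2).
  eapply runs_seq.
    apply: (choose_center_spec h c2).
      by exists x0; rewrite inE x0W big2 x0b.
    move=> y; rewrite inE => /andP[yW _]; rewrite ball2 ball1 //.
    apply: (mass_gt0 rho_prob (x := y)); last exact: W_pos.
    by rewrite inE yW mem_cball //; have := r_ge0; lra.
  move=> s3 [x [xU x3 max3 xmax]] f3.
  have c3 : ctx d rho s3 W r by apply: ctx_frame f3 c2.
  move: xU; rewrite inE big2 => /andP[xW /eqP xb].
  eapply runs_seq.
    by apply: (mark_balls_spec h c3 x3).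
  move=> s4 [sm4 bg4 pt4] f4.
  apply: runs_post (decide_spec s4) _ => s5 dec5 f5.
  have k4 : nmem s4 a_k 0 = (nmem s1 a_k 0).+1.
    by rewrite (proj1 f4) // (proj1 f3).
  have k5 : nmem s5 a_k 0 = (nmem s1 a_k 0).+1 by rewrite (proj1 f5).
  have big3 (y : 'I_n) : nmem s3 a_big y = big_of s1 y by rewrite (proj1 f3).
  have sm5 y : small_of s5 y =
      if (y \in W) && (d x y <= r / 20) then (nmem s1 a_k 0).+1 else small_of s1 y.
    rewrite /small_of (proj1 f5) // sm4 (proj1 f3 a_k) // k2.
    by rewrite (proj1 f3 a_small) // (proj1 f2 a_small).
  have bg5 y : big_of s5 y =
      if [&& y \in W, big_of s1 y == 0%N & d x y <= 3 / 10 * r]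
      then (nmem s1 a_k 0).+1 else big_of s1 y.
    by rewrite /big_of (proj1 f5) // bg4 (proj1 f3 a_k) // k2 big3.
  have dec4 : nmem s4 a_dec 0 = 0%N.
    by rewrite (proj1 f4) // (proj1 f3) // (proj1 f2).
  have w4 : rmem s4 r_w 0 = mass rho W.
    by rewrite (proj2 f4) // (proj2 f3) // (proj2 f2).
  have max4 : rmem s4 r_max 0 = ball W r x.
    by rewrite (proj2 f4) // max3 ball2 ball1.
  have thr4 : rmem s4 r_thr 0 = rmem s r_thr 0.
    by rewrite (proj2 f4) // (proj2 f3) // (proj2 f2).
  rewrite k4 w4 max4 thr4 pt4 dec4 in dec5.
  have part_eq : \sum_(y | [&& y \in W, nmem s3 a_big y == 0%N & d x y <= 3 / 10 * r])
      rho y = \sum_(y | [&& y \in W, big_of s1 y == 0%N & d x y <= 3 / 10 * r]) rho y.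
    by apply: eq_bigl => y; rewrite big3.
  rewrite part_eq in dec5.
  have xmax' y : y \in W -> big_of s1 y = 0%N -> ball W r y <= ball W r x.
    move=> yW yb; rewrite -!ball1 // -!ball2; apply: xmax.
    by rewrite inE yW big2; apply/eqP.
  have gi5 := greedy_inv_pick d_metric r_ge0 gi1 xW xb xmax' sm5 bg5.
  have xb5 : big_of s5 x = (nmem s1 a_k 0).+1.
    rewrite bg5 xW xb eqxx /= ifT //.
    have -> : d x x = 0 by exact/(Defs.metric_eq0 d_metric).
    by have := r_ge0; lra.
  split; last first.
    apply: proper_card; apply/properP; split.
      apply/fintype.subsetP => y; rewrite !inE => /andP[-> /=].
      rewrite -/(big_of s5 y) bg5 -/(big_of s1 y).
      by case: ifP => //; rewrite andbT.
    exists x; first by rewrite inE xW -/(big_of s1 x) xb.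
    by rewrite inE xW -/(big_of s5 x) xb5.
  split.
    apply: frame_trans f1 _.
    apply: (@frame_trans _ _ _ _ s2); first exact: frame_sub f2.
    apply: (@frame_trans _ _ _ _ s3); first exact: frame_sub f3.
    apply: (@frame_trans _ _ _ _ s4); first exact: frame_sub f4.
    exact: frame_sub f5.
  exists (fun i => if i == (nmem s1 a_k 0).+1 then x else c i); rewrite k5.
  have part_ge0 : 0 <= \sum_(y | [&& y \in W, big_of s1 y == 0%N & d x y <= 3 / 10 * r]) rho y.
    by apply: sumr_ge0 => y _; case: rho_prob.
  have k0 : nmem s1 a_k 0 = 0%N \/ nmem s a_fin 0 = 0%N.
    case: (posnP (nmem s a_fin 0)) => [|/fin1]; [by right|rewrite dec0; left; lia].
  have thr_le : rmem s r_thr 0 <= mass rho W.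
    rewrite s_thr ler_piMr ?(ltW w_gt0) //.
    by case: (nmem s a_fin 0) => [|m]; rewrite ?subn0 // subSS sub0n ler01.
  have decided : nmem s5 a_dec 0 = 0%N ->
     nmem s a_fin 0 = 0%N /\
       (\sum_(y | [&& y \in W, big_of s1 y == 0%N & d x y <= 3 / 10 * r]) rho y) *
       (nmem s1 a_k 0).+1%:R * (nmem s1 a_k 0).+2%:R <= mass rho W.
    rewrite dec5; case: ifP => // _; case: ifP => // /negbT; rewrite -ltNge => lt _; split.
      apply/eqP; rewrite -leqn0 leqNgt; apply/negP => fin.
      move: lt; rewrite s_thr.
      have /eqP -> : (1 - nmem s a_fin 0 == 0)%N by rewrite subn_eq0.
      by rewrite mulr0 ltNge => /negP; apply; rewrite !mulr_ge0.
    by apply: ltW; apply: lt_le_trans lt thr_le.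
  split=> //.
    move=> fin; case: posnP => [/decided[fin0 _]|_]; first by rewrite fin0 in fin.
    by case: k0 => [->//|fin0]; rewrite fin0 in fin.
  case: (posnP (nmem s5 a_dec 0)) => dec50.
    left; split=> //; have [_ part_le] := decided dec50.
    rewrite (@covered_pick _ _ d rho W r (big_of s1) (big_of s5) _ x bg5).
    exact: covered_bound cov1 part_le.
  right; split; first by rewrite k5.
  rewrite k5 eqxx; move: dec5 dec50; case: ifP => [good -> _|bad]; first by left.
  case: ifP => [heavy -> _|_ -> //]; right; split=> //.
    apply: le_trans heavy _; rewrite !ler_wpM2r // /mass le_eqVlt; apply/orP; left.
    apply/eqP; apply: eq_bigl => y; rewrite inE bg5; case: ifP => h1; first by rewrite leqnn.
    by rewrite ltnNge (gi_big_le gi1).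
  by move: bad; rewrite leNgt => /negbFE/ltW.
by rewrite /=; lia.
Qed.

Lemma greedy_spec :
  runs h greedy s (#|W| * (n * 200 + 260) + 40) (fun s' => exists c,
    [/\ greedy_inv d rho W r (small_of s') (big_of s') (nmem s' a_k 0) c,
        decision s' c & (0 < nmem s a_fin 0)%N -> nmem s' a_k 0 = 1%N]).
Proof.
have [x0 _] := W_ne.
pose phi s' := (#|uncovered s'| * (n * 200 + 260))%N.
rewrite /greedy; eapply runs_le.
  eapply runs_seq.
    apply: (runs_straight (Q := fun s1 => nmem s1 a_k 0 = 0%N)) => //.
  move=> s1 k1 f1.
  eapply runs_seq.
    apply: (runs_straight (Q := fun s2 => nmem s2 a_k 0 = 0%N /\ nmem s2 a_dec 0 = 0%N)) => //.
  move=> s2 [k2 dec2] f2.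
  have f02 : frame (nwrites greedy) (rwrites greedy) s s2.
    by apply: (@frame_trans _ _ _ _ s1); [apply: frame_sub f1|apply: frame_sub f2].
  have [sm2 bg2] : (forall y, small_of s2 y = 0%N) /\ (forall y, big_of s2 y = 0%N).
    split=> y; have [sm bg] := s_clear y.
      by rewrite /small_of (proj1 f2) // (proj1 f1).
    by rewrite /big_of (proj1 f2) // (proj1 f1).
  have inv2 : greedy_loop_inv s2.
    split=> //; exists (fun=> x0); rewrite k2 dec2; split=> //.
      have := greedy_inv_start d rho W r_ge0 (fun=> x0).
      have -> : small_of s2 = fun=> 0%N by apply/funext.
      by have -> : big_of s2 = fun=> 0%N by apply/funext.
    left; split=> //; rewrite mulr0 /covered big_pred0 ?mul0r // => y.
    by rewrite bg2 andbF.
  apply: (@runs_mono _ _ _ _ _ _ (fun s' => greedy_loop_inv s' /\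
     beval h s' (BNle (nvar a_dec) (NConst 0)) = false)).
  - apply: (runs_le (T := phi s2 + 5)); last first.
      apply: (@leq_trans (#|W| * (n * 200 + 260) + 5)); last exact: leqnn.
      rewrite leq_add2r leq_mul2r; apply/orP; right; apply: subset_leq_card.
      by apply/fintype.subsetP => y; rewrite inE => /andP[].
    apply: (runs_while (phi := phi)) => // s3 inv3 /=; rewrite leqn0 => /eqP dec3.
    have spec := pick_round_spec inv3 dec3.
    have [_ [s4' [_ _ [_ lt]]]] := spec.
    exists (n * 200 + 240)%N.
    have bound m : (m < #|uncovered s3|)%N ->
        (n * 200 + 240 + 5 + m * (n * 200 + 260) <= phi s3)%N.
      rewrite /phi => mlt; apply: (@leq_trans (m.+1 * (n * 200 + 260))).
        by rewrite mulSn; move: (m * _)%N => z; lia.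
      by rewrite leq_mul2r mlt orbT.
    split; first by apply: leq_trans (bound _ _); [|apply: lt]; rewrite leq_addr.
    by apply: runs_mono spec _ _ => // s4 [inv4 lt4]; split=> //; apply: bound.
  - exact: leqnn.
  move=> s' [[f' [c [gi fin dec]]]] /=; rewrite leqn0 => dec0.
  have dec' : decision s' c.
    by case: dec => // -[dec _]; rewrite dec in dec0.
  exists c; split=> // /fin; case: dec' => k0 _.
  by case: (nmem s' a_dec 0) dec0 => //= m _; lia.
by rewrite /=; move: (#|W| * _)%N => z; lia.
Qed.
End Loop.
End GreedyLoop.

(** * From the centers to the children *)

Section NodeAnalysis.
Variables (R : realType) (h : R -> R) (n : nat).
Variables (d : 'I_n -> 'I_n -> R) (rho : 'I_n -> R).
Hypothesis d_metric : is_metric d.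
Hypothesis rho_prob : is_prob rho.
Hypothesis h_sf : submultiplicative_functional h.
Implicit Types (s : state R) (W : {set 'I_n}).

Lemma select_piece_spec s : nmem s 0 0 = n ->
  runs h select_piece s (n * 60 + 60) (fun s' =>
    (forall y : 'I_n, small_of s' y = if (1 < nmem s a_dec 0)%N
       then (nmem s a_k 0 <= big_of s y)%N : nat else small_of s y) /\
    nmem s' a_k 0 = if (1 < nmem s a_dec 0)%N then 1%N else nmem s a_k 0).
Proof.
move=> sn; rewrite /select_piece /when; eapply runs_le.
  apply: runs_if => /= dec.
    rewrite dec.
    pose I j s1 := forall y : 'I_n, (y < j)%N ->
       small_of s1 y = (nmem s a_k 0 <= big_of s y)%N.
    eapply runs_seq.
      apply: (runs_for_points_const (n := n) (I := I)) => //.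
      move=> x s2 xE f2 I2.
      have k2 : nmem s2 a_k 0 = nmem s a_k 0 by rewrite (proj1 f2).
      have b2 : nmem s2 a_big x = big_of s x by rewrite /big_of (proj1 f2).
      apply: runs_straight => // _ y; rewrite /small_of /=. rewrite xE k2 b2 ord_ltS.
      by case: ifP => kb; rewrite /= /upd /= eqn_ord;
        have [->|yx] := eqVneq y x => //= yx'; rewrite ?kb //; apply: I2.
    move=> s3 I3 f3; apply: runs_straight => //=; split=> // y.
    by rewrite -I3.
  rewrite (negbTE dec); apply: (@runs_le _ _ _ _ 1); first exact: runs_straight.
  by rewrite /=; lia.
by rewrite /=; lia.
Qed.

Lemma check_cover_spec s W r : ctx d rho s W r ->
  runs h check_cover s (n * 60 + 60) (fun s' =>
    (nmem s' a_cov 0 <= 0)%N = [forall y in W, (0 < small_of s y)%N]).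
Proof.
move=> c0.
pose I j s1 := (nmem s1 a_cov 0 <= 0)%N =
  [forall y : 'I_n, (y \in W) && (y < j)%N ==> (0 < small_of s y)%N].
rewrite /check_cover; eapply runs_le.
  eapply runs_seq.
    by apply: (runs_straight (Q := fun s1 => nmem s1 a_cov 0 = 0%N)).
  move=> s1 cov1 f1; have c1 : ctx d rho s1 W r by apply: ctx_frame f1 c0.
  apply: (@runs_mono _ _ _ _ _ _ (I n)).
  - apply: (runs_for_points_const (n := n) (I := I)) => //; first exact: ctx_n c1.
      rewrite /I /= /upd /= cov1; apply/esym/forallP => y; by rewrite andbF.
    move=> x s2 xE f2 I2; have c2 : ctx d rho s2 W r by apply: ctx_frame f2 c1.
    have sm2 : nmem s2 a_small x = small_of s x by rewrite (proj1 f2) // (proj1 f1).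
    apply: runs_straight => // _.
    rewrite /I /= xE (ctx_n c2) (ctx_W c2) lt0b sm2.
    case: ifP => [/andP[xW sx]|no] /=; rewrite /upd /= ?I2.
      apply/esym/negbTE; rewrite negb_forall; apply/existsP; exists x.
      by rewrite xW ltnS leqnn /= -leqNgt.
    apply: eq_forallb => y; rewrite ord_ltS.
    have [->|//] := eqVneq y x; rewrite ltnn andbF andbT /=.
    by case: (x \in W) no => //= /negbT; rewrite -ltnNge => ->.
  - exact: leqnn.
  - move=> s' ->; apply: eq_forallb => y; by rewrite ltn_ord andbT.
by rewrite /=; lia.
Qed.

(** [final] tells whether the radius in use is 0. The geometric properties of the
    children are stated at the radius in use, whereas the invariant is carried
    down only at positive radius. *)
Record analysed (s' : state R) W (rad : R) (final : bool) : Prop := {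
  an_ok : children_ok d W (if final then 0 else rad) (nmem s' a_k 0) (small_of s');
  an_cov : (nmem s' a_cov 0 <= 0)%N = [forall y in W, (0 < small_of s' y)%N];
  an_fin : nmem s' a_fin 0 = final;
  an_final : final -> nmem s' a_k 0 = 1%N;
  an_inv : ~~ final -> forall E V i, node_inv d rho h E W rad V ->
    (0 < i <= nmem s' a_k 0)%N ->
    node_inv d rho h E [set y | small_of s' y == i]%SET (rad / 10)
      (V + rad * h (1 / (nmem s' a_k 0)%:R)) }.

Lemma analyse_node_spec s W rad :
  nmem s 0 0 = n -> (forall x y : 'I_n, rmem s 0 (x * n + y) = d x y) ->
  (forall x : 'I_n, rmem s 1 x = rho x) ->
  (forall x : 'I_n, nmem s out_member (nmem s a_cur 0 * n + x)%N = (x \in W)) ->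
  rmem s r_rad (nmem s a_cur 0) = rad -> 0 < rad \/ rad * n%:R <= rmem s r_ecc 0 ->
  (forall x, x \in W -> 0 < rho x) -> (exists x, x \in W) ->
  runs h analyse_node s (#|W| * (n * 280 + 280) + n * 300 + 300) (fun s' =>
    analysed s' W rad (rad * n%:R <= rmem s r_ecc 0)).
Proof.
move=> sn sd srho sW srad rad0 Wpos Wne; set final := rad * n%:R <= rmem s r_ecc 0.
pose rr := if final then 0 else rad.
have rr0 : 0 <= rr.
  by rewrite /rr; case: ifP rad0 => // nf [/ltW//|]; rewrite -/final nf.
rewrite /analyse_node; eapply runs_le.
  eapply runs_seq.
    apply: (runs_straight (Q := fun s1 => ctx d rho s1 W rr /\ nmem s1 a_fin 0 = final)) => //.
    rewrite /= sn srad -/final /rr.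
    by case: ifP => fE; split.
  move=> s1 [c1 fin1] _.
  eapply runs_seq; first exact: weigh_spec c1.
  move=> s2 [w2 thr2 clear2] f2; have c2 : ctx d rho s2 W rr by apply: ctx_frame f2 c1.
  have fin2 : nmem s2 a_fin 0 = final by rewrite (proj1 f2).
  eapply runs_seq.
    by apply: (ball_masses_spec h c2) => y; have [] := clear2 y.
  move=> s3 ball3 f3; have c3 : ctx d rho s3 W rr by apply: ctx_frame f3 c2.
  have fin3 : nmem s3 a_fin 0 = final by rewrite (proj1 f3).
  have thr3 : rmem s3 r_thr 0 = mass rho W * (1 - nmem s3 a_fin 0)%:R.
    by rewrite (proj2 f3) // thr2 fin3 fin1.
  eapply runs_seq.
    apply: (greedy_spec h d_metric rho_prob c3 rr0 Wpos Wne) => //.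
    - move=> y; rewrite /small_of /big_of !(proj1 f3) //.
      by have [] := clear2 y.
    - by move=> y yW; rewrite ball3 yW.
    - by rewrite (proj2 f3).
  move=> s4 [c [gi4 dec4 fk4]] f4; have c4 : ctx d rho s4 W rr by apply: ctx_frame f4 c3.
  have fin4 : nmem s4 a_fin 0 = final by rewrite (proj1 f4).
  eapply runs_seq; first exact: (select_piece_spec (ctx_n c4)).
  move=> s5 [sm5 k5] f5; have c5 : ctx d rho s5 W rr by apply: ctx_frame f5 c4.
  apply: runs_post (check_cover_spec c5) _ => s6 cov6 f6.
  have sm6 (y : 'I_n) : small_of s6 y = small_of s5 y by rewrite /small_of (proj1 f6).
  have k6 : nmem s6 a_k 0 = nmem s5 a_k 0 by rewrite (proj1 f6).
  have small_eq : @small_of R n s6 = small_of s5 by apply/funext.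
  rewrite -small_eq in cov6.
  have [k0 dec] := dec4.
  have small6 : @small_of R n s6 = if (1 < nmem s4 a_dec 0)%N
      then (fun y => (nmem s4 a_k 0 <= big_of s4 y)%N : nat) else small_of s4.
    by apply/funext => y; rewrite sm6 sm5; case: ifP.
  split=> //.
  - rewrite -/rr k6 k5 small6; case: (1 < _)%N.
      exact: (descend_children d_metric rr0 k0 gi4).
    exact: (branch_children d_metric rr0 k0 gi4).
  - by rewrite (proj1 f6) // (proj1 f5).
  - rewrite k6 k5 => fin; case: ifP => // _; apply: fk4.
    by rewrite fin3 fin.
  - move=> nofin E V i inv ik.
    have rrE : rr = rad by rewrite /rr (negbTE nofin).
    have rad_gt0 : 0 < rad by case: rad0 => //; rewrite -/final (negbTE nofin).
    rewrite rrE in gi4 dec.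
    rewrite k6 k5 in ik *.
    case: dec => [[decE good]|[decE heavy gap]]; rewrite decE /= in ik small6 *.
      rewrite small6.
      exact: (branch_node_inv d_metric rho_prob (ltW rad_gt0) h_sf rad_gt0 inv gi4 ik good).
    have -> : i = 1%N by lia.
    rewrite divr1 (sf_at1 h_sf) mulr0 addr0.
    have -> : [set y : 'I_n | small_of s6 y == 1%N]%SET
        = [set y : 'I_n | (nmem s4 a_k 0 <= big_of s4 y)%N]%SET.
      by apply/finset.setP => y; rewrite !inE small6 eqb1.
    apply: (descend_node_inv d_metric rho_prob h_sf rad_gt0 inv gi4 k0 _ gap).
    move: heavy; rewrite thr3 fin3 (negbTE nofin) subn0 mulr1; exact.
by rewrite /=; move: (#|W|) => w; lia.
Qed.
End NodeAnalysis.

(** * Writing the children *)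

Section Commit.
Variables (R : realType) (h : R -> R) (n : nat).
Implicit Types (s : state R).

Lemma cell_inj (a b : nat) (x y : 'I_n) :
  ((a * n + x == b * n + y) = (a == b) && (x == y))%N.
Proof.
apply/eqP/andP => [e|[/eqP-> /eqP->]//].
have n0 : (0 < n)%N by apply: leq_ltn_trans (ltn_ord x).
have ab : a = b.
  by have := congr1 (divn^~ n) e; rewrite !divnMDl // !divn_small // !addn0.
split; first exact/eqP.
by apply/eqP/val_inj/eqP; rewrite -(eqn_add2l (a * n)) {2}ab e.
Qed.

Lemma write_members_spec s : nmem s 0 0 = n ->
  runs h write_members s (n * 100 + 20) (fun s' =>
    forall q (x : 'I_n), nmem s' out_member (q * n + x) =
      if (0 < small_of s x)%N && (q == nmem s a_cnt 0 + small_of s x)%N then 1%N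
      else nmem s out_member (q * n + x)).
Proof.
move=> sn.
pose I j s1 := forall q (x : 'I_n), nmem s1 out_member (q * n + x) =
      if [&& (x < j)%N, 0 < small_of s x & q == nmem s a_cnt 0 + small_of s x]%N then 1%N
      else nmem s out_member (q * n + x).
eapply runs_le.
  apply: (@runs_mono _ _ _ _ _ _ (I n)).
  - apply: (runs_for_points_const (n := n) (I := I)) => //.
    move=> y s2 yE f2 I2.
    have n2 : nmem s2 0 0 = n by rewrite (proj1 f2).
    have cnt2 : nmem s2 a_cnt 0 = nmem s a_cnt 0 by rewrite (proj1 f2).
    have sm2 : nmem s2 a_small y = small_of s y by rewrite (proj1 f2).
    apply: runs_straight => // _ q x; rewrite /= yE sm2 cnt2 n2.
    case: ifP => [smy|smy] /=; rewrite /upd /= I2 ord_ltS.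
      rewrite cell_inj; have [->|xy] := eqVneq x y => /=; last by rewrite andbF.
      by rewrite ltnn andbT smy.
    by have [->|xy] := eqVneq x y => //=; rewrite smy ltnn.
  - exact: leqnn.
  - by move=> s' Is q x; rewrite Is ltn_ord.
by rewrite /=; lia.
Qed.

Lemma write_fields_spec s : let p := nmem s a_cur 0 in let c := nmem s a_cnt 0 in
  let K := nmem s a_k 0 in (p <= c)%N ->
  runs h write_fields s (K * 200 + 20) (fun s' =>
    forall q, let new := (c < q <= c + K)%N in
    [/\ nmem s' a_lev q = (if new then (nmem s a_lev p).+1 else nmem s a_lev q),
        rmem s' r_rad q = (if new then rmem s r_rad p / 10 else rmem s r_rad q),
        rmem s' r_val q = (if new then rmem s r_val p + rmem s r_rad p * h (1 / K%:R)
                           else rmem s r_val q) &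
        nmem s' out_sibling q = (if new then (if q == (c + K)%N then 0%N else q.+1)
                                 else nmem s out_sibling q)]).
Proof.
move=> p c K pc.
pose I j s1 := forall q, let new := (c < q <= c + j)%N in
    [/\ nmem s1 a_lev q = (if new then (nmem s a_lev p).+1 else nmem s a_lev q),
        rmem s1 r_rad q = (if new then rmem s r_rad p / 10 else rmem s r_rad q),
        rmem s1 r_val q = (if new then rmem s r_val p + rmem s r_rad p * h (1 / K%:R)
                           else rmem s r_val q) &
        nmem s1 out_sibling q = (if new then (if q == (c + K)%N then 0%N else q.+1)
                                 else nmem s out_sibling q)].
have I0 : I 0%N (nstore s i_x 0 0).
  move=> q; have -> /= : (c < q <= c + 0)%N = false by lia.
  by [].
eapply runs_le.
  apply: (runs_for_const (I := I) (T := 160)) => // j s1 jK jE _ fr Ij.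
  have cur1 : nmem s1 a_cur 0 = p by rewrite (proj1 fr).
  have cnt1 : nmem s1 a_cnt 0 = c by rewrite (proj1 fr).
  have k1 : nmem s1 a_k 0 = K by rewrite (proj1 fr).
  have [levp radp valp _] := Ij p.
  have np : (c < p <= c + j)%N = false by lia.
  rewrite np in levp radp valp.
  eapply runs_le.
    apply: runs_straight => //=; rewrite /upd /= jE cur1 cnt1 k1.
    have neq : ((p == c + (j + 1)) = false)%N by lia.
    rewrite ?neq levp radp valp addn1 addn1.
    split; [by []|by []|] => q.
    have -> : (c < q <= c + j.+1)%N = (q == c + j.+1)%N || (c < q <= c + j)%N by lia.
    have [lq rq vq sq] := Ij q.
    case: (eqVneq q (c + j.+1)%N) => [->|qn] /=; last first.
      by rewrite /upd /= (negbTE qn); split.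
    rewrite /upd /= eqxx; split=> //; rewrite addn1.
    have [jK1|jK1] := eqVneq (c + j.+1)%N (c + K)%N.
      by have /eqP -> : (1 - (j + 2 - K) == 0)%N; [lia|rewrite muln0].
    have /eqP -> : (1 - (j + 2 - K) == 1)%N by lia.
    by rewrite muln1.
  by [].
by rewrite /=; lia.
Qed.
End Commit.

(** * Invariants of the tree under construction *)

(** The memory of the program without the scratch arrays. *)
Record table (R : Type) : Type := Table {
  t_member : nat -> nat; t_label : nat -> nat; t_child : nat -> nat;
  t_sibling : nat -> nat; t_kids : nat -> nat; t_lev : nat -> nat;
  t_rad : nat -> R; t_val : nat -> R; t_cnt : nat; t_cur : nat; t_flag : nat }.

Section TreeInvariant.
Variables (R : realType) (h : R -> R) (n : nat).
Variables (d : 'I_n -> 'I_n -> R) (rho : 'I_n -> R) (E : R).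
Hypothesis d_metric : is_metric d.
Hypothesis rho_prob : is_prob rho.
Hypothesis h_sf : submultiplicative_functional h.

Local Notation D := (diam d [set: 'I_n]%SET).
Local Notation h2 := (h (1 / 2)).
Hypothesis E_ge0 : 0 <= E.
Hypothesis E_diam : forall x y, d x y <= 2 * E.
Hypothesis E_le : E <= D.
Hypothesis D_le : D <= 2 * E.

Implicit Types (t : table R).

Definition members t q : {set 'I_n} := [set x : 'I_n | t_member t (q * n + x) != 0%N]%SET.

Definition leaf_bound (v : R) : Prop :=
  (delta d h rho <= (130 * (E * h2) + 1680 * v)%:E)%E.

(** The radius of level [l] is [E / 10 ^ l], so nodes of radius above [E / n] have
    a level at most [max_level]. Their children have at most one level more, and
    the singletons that end the paths at most two. *)
Definition max_level : nat := trunc_log 2 n.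

(** A node not processed yet satisfies the invariant of the descent, unless it was
    created at radius 0: then the bound on [delta] at its leaf is already known. *)
Record pending t q : Prop := {
  pd_lev0 : (0 < t_lev t q)%N;
  pd_rad : t_rad t q = E / 10 ^+ t_lev t q;
  pd_val : 0 <= t_val t q;
  pd_lev : (t_lev t q <= max_level.+1)%N \/
           (#|members t q| = 1%N /\ (t_lev t q <= max_level.+2)%N);
  pd_good : node_inv d rho h E (members t q) (t_rad t q) (t_val t q) \/
            (t_rad t q * n%:R <= E /\ leaf_bound (t_val t q)) }.

(** A processed node. The flag is raised by a leaf whose value is below
    [E * h2]. *)
Record linked t q : Prop := {
  lk_entry : entry_ok d (1 / 10) (members t) (t_label t) (t_child t) (t_kids t) (t_cnt t) q;
  lk_nochild : t_kids t q = 0%N -> t_child t q = 0%N;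
  lk_sib : forall i, (i < t_kids t q)%N -> t_sibling t (t_child t q + i) =
    if (i.+1 < t_kids t q)%N then (t_child t q + i.+1)%N else 0%N;
  lk_val : forall i, (i < t_kids t q)%N -> t_val t (kid (t_child t) q i) <=
    t_val t q + (1 / 10) ^+ t_label t q * D * h (1 / (t_kids t q)%:R);
  lk_leaf : t_kids t q = 0%N ->
    leaf_bound (t_val t q) /\ (t_flag t = 0%N -> E * h2 <= t_val t q) }.

(** Addresses are handed out in order and processed in order: the nodes before
    [t_cur] are final, those from [t_cur] to [t_cnt] wait, and the memory beyond
    is blank. If the flag is up, then the bound on a low leaf has shown that
    [delta] is itself of order [E * h2]. *)
Record tree_inv t : Prop := {
  ti_cur : (0 < t_cur t <= (t_cnt t).+1)%N;
  ti_cnt : (0 < t_cnt t)%N;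
  ti_cell : forall q (x : 'I_n), t_member t (q * n + x) = (x \in members t q);
  ti_row : forall q, (0 < q <= t_cnt t)%N ->
    (exists x, x \in members t q) /\ (forall x, x \in members t q -> 0 < rho x);
  ti_fresh : forall q x, (t_cnt t < q)%N -> x \notin members t q;
  ti_open : forall q, (t_cur t <= q)%N ->
    [/\ t_label t q = 0%N, t_child t q = 0%N & t_kids t q = 0%N];
  ti_sib : forall q, (t_cnt t < q)%N -> t_sibling t q = 0%N;
  ti_pending : forall q, (t_cur t <= q <= t_cnt t)%N -> pending t q;
  ti_linked : forall q, (0 < q < t_cur t)%N -> linked t q;
  ti_flag : (0 < t_flag t)%N -> 0 < E /\ (delta d h rho <= (1810 * (E * h2))%:E)%E;
  ti_val : t_val t 1 = 0 }.

(** A node of level [l] and its descendants are processed at most once at each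
    level from [l] on, and the nodes of one level are disjoint: each point of a
    waiting node still counts once for each remaining level. *)
Definition weight t : nat :=
  \sum_(t_cur t <= q < (t_cnt t).+1) #|members t q| * (max_level + 4 - t_lev t q).

(** A processed node depends only on its own fields and on addresses up to the
    counter, which later steps leave alone. *)
Lemma linked_ext t t' q : tree_inv t -> (0 < q < t_cur t)%N ->
  (forall q', (q' <= t_cnt t)%N -> members t' q' = members t q') ->
  (forall q', (q' <= t_cnt t)%N -> t_sibling t' q' = t_sibling t q') ->
  (forall q', (q' <= t_cnt t)%N -> t_val t' q' = t_val t q') ->
  t_label t' q = t_label t q -> t_child t' q = t_child t q ->
  t_kids t' q = t_kids t q -> (t_cnt t <= t_cnt t')%N ->
  (t_flag t' = 0%N -> t_flag t = 0%N) -> linked t' q.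
Proof.
move=> ti qr rowE sibE valE labE chE kiE cntE flE.
have lk := ti_linked ti qr; have cur := ti_cur ti.
have qc : (q <= t_cnt t)%N by lia.
have [q0 ne entry] := lk_entry lk.
have kidc i : (i < t_kids t q)%N -> (t_child t q + i <= t_cnt t)%N.
  case: entry => [[-> _]//|[_ io]]; have := io_cnt io; lia.
split.
- split; [by []|by rewrite rowE|].
  rewrite kiE rowE //; case: entry => [|[k0 io]]; [by left|right; split=> //].
  have rowk i : (i < t_kids t q)%N -> members t' (kid (t_child t') q i)
      = members t (kid (t_child t) q i).
    by move=> ik; rewrite /kid chE rowE // kidc.
  case: io => i1 i2 i3 i4 i5 i6 i7; split; rewrite ?chE ?kiE ?labE ?(rowE q) //.
  + by lia.
  + by move=> i ik; rewrite rowk //; apply: i3.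
  + by move=> i ik; rewrite rowk //; apply: i4.
  + by move=> k1; rewrite rowk ?k1 //; apply: i5.
  + by move=> i x y ik; rewrite rowk //; apply: i6.
  + by move=> i j x y ik jk ij; rewrite !rowk //; apply: i7.
- by rewrite kiE chE; apply: lk_nochild.
- by move=> i; rewrite kiE chE => ik; rewrite sibE ?kidc // (lk_sib lk).
- move=> i; rewrite kiE labE => ik; rewrite /kid chE !valE ?kidc //.
  exact: (lk_val lk).
- rewrite kiE valE // => k0; have [lb fl] := lk_leaf lk k0; split=> //.
  by move=> /flE.
Qed.

Lemma pending_ext t t' q : members t' q = members t q -> t_lev t' q = t_lev t q ->
  t_rad t' q = t_rad t q -> t_val t' q = t_val t q -> pending t q -> pending t' q.
Proof. by move=> e1 e2 e3 e4 [p1 p2 p3 p4 p5]; split; rewrite ?e1 ?e2 ?e3 ?e4. Qed.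

Lemma pending_leaf_bound t q : pending t q -> t_rad t q * n%:R <= E ->
  leaf_bound (t_val t q).
Proof.
move=> pd fin; case: (pd_good pd) => [inv|[]//].
apply: (node_inv_final d_metric rho_prob h_sf _ E_ge0 _ inv).
  by rewrite (pd_rad pd) divr_ge0 // exprn_ge0.
by rewrite card_ord.
Qed.

Lemma pending_rad_ge0 t q : pending t q -> 0 <= t_rad t q.
Proof. by move=> pd; rewrite (pd_rad pd) divr_ge0 // exprn_ge0. Qed.

Lemma radius_levels t q : pending t q -> E < t_rad t q * n%:R ->
  (t_lev t q <= max_level)%N.
Proof.
move=> pd; rewrite (pd_rad pd) => big.
have E0 : 0 < E.
  rewrite lt_def E_ge0 andbT; apply/eqP => E0.
  by move: big; rewrite E0 !mul0r ltxx.
have : (10 : R) ^+ t_lev t q < n%:R.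
  move: big; rewrite mulrAC ltr_pdivlMr ?exprn_gt0 // ltr_pM2l //.
rewrite -natrX ltr_nat => lt.
have n0 : (0 < n)%N by lia.
rewrite /max_level; apply: trunc_log_max => //.
by apply: leq_trans (ltnW lt); rewrite leq_exp2r // (pd_lev0 pd).
Qed.

Lemma keep_final_inv t t' : tree_inv t -> (t_cur t <= t_cnt t)%N ->
  t_rad t (t_cur t) * n%:R <= E -> #|members t (t_cur t)| = 1%N ->
  t' = Table (t_member t) (t_label t) (t_child t) (t_sibling t) (t_kids t) (t_lev t)
    (t_rad t) (t_val t) (t_cnt t) (t_cur t).+1
    (if E * h2 <= t_val t (t_cur t) then t_flag t else 1%N) ->
  tree_inv t'.
Proof.
move=> ti pc fin single tE; set p := t_cur t in pc fin single tE *.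
have cur := ti_cur ti; have pr : (t_cur t <= p <= t_cnt t)%N by rewrite pc leqnn.
have pd := ti_pending ti pr.
have lb := pending_leaf_bound pd fin.
have [lab0 ch0 ki0] := ti_open ti (leqnn (t_cur t)).
have p0 : (0 < p <= t_cnt t)%N by rewrite pc andbT; case/andP: cur.
have h20 : 0 <= E * h2 by rewrite mulr_ge0 // half_functional_ge0.
rewrite tE; split=> //=; try by case: ti.
- by move=> q pq; apply: (ti_open ti); apply: ltnW.
- move=> q /andP[pq qc]; apply: (@pending_ext t) => //.
  by apply: (ti_pending ti); rewrite qc andbT ltnW.
- move=> q /andP[q0]; rewrite ltnS leq_eqVlt => /predU1P[->|qp].
    split=> //=.
    + split=> //; [by case/andP: p0|by have [] := ti_row ti p0|by left].
    + by move=> i; rewrite ki0.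
    + by move=> i; rewrite ki0.
    + by move=> _; split=> //; case: ifP.
  apply: (@linked_ext t) => //=; first by rewrite q0.
  by case: ifP.
- case: ifP => [_|]; first exact: ti_flag.
  move=> /negbT; rewrite -ltNge => low _; split.
    rewrite lt_def E_ge0 andbT; apply/eqP => E0.
    by move: (pd_val pd) low; rewrite E0 mul0r => /le_lt_trans lt /lt; rewrite ltxx.
  by apply: le_trans lb _; rewrite lee_fin; lra.
Qed.

Lemma keep_final_weight t t' : tree_inv t -> (t_cur t <= t_cnt t)%N ->
  members t' =1 members t -> t_lev t' =1 t_lev t -> t_cnt t' = t_cnt t ->
  t_cur t' = (t_cur t).+1 ->
  (weight t' + #|members t (t_cur t)| <= weight t)%N.
Proof.
move=> ti pc rE lE cE uE; rewrite /weight cE uE [leqRHS]big_ltn // addnC.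
have pd : pending t (t_cur t) by apply: (ti_pending ti); rewrite pc leqnn.
apply: leq_add.
  by rewrite leq_pmulr //; case: (pd_lev pd) => [|[_]]; lia.
by apply: leq_sum => q _; rewrite rE lE.
Qed.

(** Dividing the radius by 10 in place is a step to an only child that is equal to
    the node, and raises its level in the same way. *)
Lemma keep_shrink_inv t t' : tree_inv t -> (t_cur t <= t_cnt t)%N ->
  E < t_rad t (t_cur t) * n%:R ->
  (forall V, node_inv d rho h E (members t (t_cur t)) (t_rad t (t_cur t)) V ->
     node_inv d rho h E (members t (t_cur t)) (t_rad t (t_cur t) / 10) V) ->
  t_member t' = t_member t -> t_label t' = t_label t -> t_child t' = t_child t ->
  t_sibling t' = t_sibling t -> t_kids t' = t_kids t -> t_val t' = t_val t ->
  t_cnt t' = t_cnt t -> t_cur t' = t_cur t -> t_flag t' = t_flag t ->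
  (forall q, t_lev t' q = if q == t_cur t then (t_lev t q).+1 else t_lev t q) ->
  (forall q, t_rad t' q = if q == t_cur t then t_rad t q / 10 else t_rad t q) ->
  tree_inv t' /\ (weight t' + #|members t (t_cur t)| <= weight t)%N.
Proof.
move=> ti pc big shrink mE lE cE sE kE vE ntE uE fE levE radE.
have rowE q : members t' q = members t q by rewrite /members mE.
have pd : pending t (t_cur t) by apply: (ti_pending ti); rewrite pc leqnn.
have lev := radius_levels pd big.
split; last first.
  rewrite /weight ntE uE big_ltn // [leqRHS]big_ltn //.
  rewrite levE eqxx rowE addnAC leq_add //.
    have -> : (max_level + 4 - t_lev t (t_cur t) =
       (max_level + 4 - (t_lev t (t_cur t)).+1) + 1)%N by lia.
    by rewrite mulnDr muln1.
  rewrite big_nat_cond [leqRHS]big_nat_cond; apply: leq_sum => q /andP[/andP[pq _] _].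
  by rewrite rowE levE gtn_eqF.
split; rewrite ?ntE ?uE ?fE ?lE ?cE ?sE ?kE ?vE ?mE; try by case: ti.
- by move=> q x; rewrite rowE; apply: (ti_cell ti).
- by move=> q; rewrite rowE; apply: (ti_row ti).
- by move=> q x; rewrite rowE; apply: (ti_fresh ti).
- move=> q qr; have pdq := ti_pending ti qr.
  have [qE|qp] := eqVneq q (t_cur t); last first.
    by apply: pending_ext pdq; rewrite ?levE ?radE ?vE ?(negbTE qp).
  rewrite qE; split; rewrite ?levE ?radE ?eqxx ?rowE ?vE //.
  + rewrite (pd_rad pd) exprS; field.
    by rewrite ?expf_neq0 ?pnatr_eq0.
  + exact: pd_val pd.
  + by left; rewrite ltnS.
  + left; apply: shrink; case: (pd_good pd) => // -[fin _].
    by move: big; rewrite ltNge fin.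
- move=> q qr; apply: (@linked_ext t) => //; rewrite ?lE ?cE ?sE ?kE ?vE ?fE ?ntE //.
Qed.

Lemma label_one (k : nat) : (k <= 1)%N -> (1 - (2 - k) = 0)%N.
Proof. by lia. Qed.

Lemma label_many (k : nat) : (1 < k)%N -> (1 - (2 - k) = 1)%N.
Proof. by lia. Qed.

Section Extend.
Variables (t t' : table R) (K : nat) (mk : 'I_n -> nat).
Local Notation p := (t_cur t).
Local Notation c := (t_cnt t).
Let W := members t p.
Let final := t_rad t p * n%:R <= E.

Hypothesis ti : tree_inv t.
Hypothesis pc : (p <= c)%N.
Hypothesis ok : children_ok d W (if final then 0 else t_rad t p) K mk.
Hypothesis proper : ~~ ((K <= 1)%N && [forall y in W, (0 < mk y)%N]).
Hypothesis final_one : final -> K = 1%N.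
Hypothesis inv_kids : ~~ final -> forall V i,
  node_inv d rho h E W (t_rad t p) V -> (0 < i <= K)%N ->
  node_inv d rho h E [set y | mk y == i]%SET (t_rad t p / 10)
    (V + t_rad t p * h (1 / K%:R)).

Let new q := (c < q <= c + K)%N.
Hypothesis memberE : forall q (x : 'I_n), t_member t' (q * n + x) =
  if (0 < mk x)%N && (q == c + mk x)%N then 1%N else t_member t (q * n + x).
Hypothesis levE : forall q, t_lev t' q = if new q then (t_lev t p).+1 else t_lev t q.
Hypothesis radE : forall q, t_rad t' q = if new q then t_rad t p / 10 else t_rad t q.
Hypothesis valE : forall q, t_val t' q =
  if new q then t_val t p + t_rad t p * h (1 / K%:R) else t_val t q.
Hypothesis sibE : forall q, t_sibling t' q =
  if new q then (if q == (c + K)%N then 0%N else q.+1) else t_sibling t q.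
Hypothesis labelE : forall q, t_label t' q =
  if q == p then (t_lev t p * (1 - (2 - K)))%N else t_label t q.
Hypothesis childE : forall q, t_child t' q = if q == p then c.+1 else t_child t q.
Hypothesis kidsE : forall q, t_kids t' q = if q == p then K else t_kids t q.
Hypothesis cntE : t_cnt t' = (c + K)%N.
Hypothesis curE : t_cur t' = p.+1.
Hypothesis flagE : t_flag t' = t_flag t.

Let K0 : (0 < K)%N. Proof. exact: co_pos ok. Qed.
Let p_pos : (0 < p)%N. Proof. by case/andP: (ti_cur ti). Qed.
Let pd : pending t p.
Proof. by apply: (ti_pending ti); rewrite pc leqnn. Qed.

Let row_old q : ~~ new q -> members t' q = members t q.
Proof.
move=> oq; apply/finset.setP => x; rewrite !inE memberE; case: ifP => // /andP[x0 /eqP qE].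
by have := co_le ok x; move: oq x0; rewrite /new qE; clear; lia.
Qed.

Let row_new q : new q -> members t' q = [set y | mk y == (q - c)%N]%SET.
Proof.
move=> nq; apply/finset.setP => x; rewrite !inE memberE (ti_cell ti).
rewrite (negbTE (ti_fresh ti x _)); last by case/andP: nq.
case: ifP => [/andP[x0 /eqP qE]|no]; first by rewrite qE addKn eqxx.
rewrite eqxx /=; apply/esym/negbTE/negP => /eqP xE; move: no nq.
by rewrite /new xE; clear; lia.
Qed.

Let kid_new i : (i < K)%N -> new (c.+1 + i).
Proof. by rewrite /new; clear; lia. Qed.

Let new_le q : (q <= c)%N -> new q = false.
Proof. by rewrite /new; clear; lia. Qed.

Let kid_row i : (i < K)%N -> members t' (c.+1 + i) = [set y | mk y == i.+1]%SET.
Proof.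
move=> iK; rewrite row_new ?kid_new //; apply/finset.setP => y; rewrite !inE.
by have -> : (c.+1 + i - c = i.+1)%N by clear; lia.
Qed.

Let rad_ge0 : 0 <= t_rad t p. Proof. exact: pending_rad_ge0 pd. Qed.

Let radius_le x : 0 <= x -> (if final then 0 else t_rad t p) * x <= t_rad t p * x.
Proof. by move=> x0; apply: ler_wpM2r => //; case: ifP. Qed.

Let gain_ge0 : 0 <= h (1 / K%:R).
Proof.
apply: (sf_ge0 h_sf); first by rewrite divr_gt0 ?ltr0n.
by rewrite ler_pdivrMr ?ltr0n // mul1r ler1n.
Qed.

Let radius_scale : t_rad t p <= (1 / 10) ^+ t_lev t p * D.
Proof.
rewrite (pd_rad pd) expr_div_n expr1n div1r mulrC.
by apply: ler_wpM2l => //; rewrite invr_ge0 exprn_ge0.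
Qed.

Let radius_scale2 : (1 / 10) ^+ t_lev t p * D <= 2 * t_rad t p.
Proof.
rewrite (pd_rad pd) expr_div_n expr1n div1r mulrA.
rewrite mulrC ler_wpM2r //; by rewrite invr_ge0 exprn_ge0.
Qed.

Let linked_cur : linked t' p.
Proof.
split; rewrite ?childE ?kidsE ?labelE ?eqxx.
- split => //.
    rewrite row_old ?new_le //.
    by case: (ti_row ti (q := p)) => //; rewrite p_pos.
  right; split; first by rewrite kidsE eqxx.
  split; rewrite ?childE ?kidsE ?labelE ?eqxx ?cntE /kid ?childE ?eqxx.
  + by rewrite ltnS.
  + by rewrite addSn.
  + move=> i iK; have [|y yi] := co_ne ok (i := i.+1); first by [].
    by exists y; rewrite kid_row // inE yi.
  + move=> i iK; rewrite kid_row // (row_old (q := p)) ?new_le //.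
    by apply/fintype.subsetP => y; rewrite inE => /eqP yi; apply: (co_mem ok); rewrite yi.
  + move=> K1; rewrite kid_row // (row_old (q := p)) ?new_le //.
    apply/negP => /eqP cov; move: proper; rewrite K1 /=.
    case/negP; apply/forall_inP => y; rewrite /W -cov inE => /eqP ->; exact: ltn0Sn.
  + move=> i x y iK; rewrite kid_row // !inE => /eqP xi /eqP yi.
    have x0 : (0 < mk x)%N by rewrite xi.
    have xy : mk x = mk y by rewrite xi yi.
    have [K1|K1] := leqP K 1.
      rewrite label_one // muln0 expr1; apply: le_trans (co_diam ok x0 xy) _.
      have r6 : 0 <= 6 / 10 :> R by lra.
      rewrite mulrC; apply: le_trans (radius_le r6) _.
      apply: (@le_trans _ _ (1 / 10 * D * (6 / 10))); last first.
        by have := le_trans E_ge0 E_le; lra.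
      rewrite ler_wpM2r //; apply: le_trans radius_scale _.
      apply: ler_wpM2r; first exact: le_trans E_ge0 E_le.
      by rewrite -[leRHS]expr1; apply: ler_wiXn2l; [lra|lra|exact: pd_lev0 pd].
    rewrite label_many // muln1; apply: le_trans (co_small ok K1 x0 xy) _.
    have r1 : 0 <= 10^-1 :> R by rewrite invr_ge0.
    apply: le_trans (radius_le r1) _.
    have e (X : R) : 1 / 10 * X * D = X * D / 10 by field.
    by rewrite exprS e ler_wpM2r.
  + move=> i j x y iK jK ij; rewrite !kid_row // !inE => /eqP xi /eqP yj.
    have K1 : (1 < K)%N by move: iK jK ij; clear; lia.
    have x0 : (0 < mk x)%N by rewrite xi.
    have y0 : (0 < mk y)%N by rewrite yj.
    have xy : mk x <> mk y by rewrite xi yj => -[].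
    have nofin : final = false.
      by apply/negP => /final_one K1'; rewrite K1' in K1.
    split; first by apply/eqP => e; apply: xy; rewrite e.
    have := co_sep ok K1 x0 y0 xy; rewrite nofin.
    rewrite label_many // muln1 -mulrA; have := radius_scale2; lra.
- by move=> K00; move: K0; rewrite K00.
- move=> i iK; rewrite sibE kid_new //.
  have -> : (c.+1 + i == c + K)%N = ~~ (i.+1 < K)%N by move: iK; clear; lia.
  by case: ltnP => // _; rewrite addnS addSn.
- move=> i iK; rewrite /kid childE eqxx valE kid_new // (valE p).
  rewrite new_le //.
  rewrite lerD2l.
  have [K1|K1] := leqP K 1.
    have -> : K = 1%N by apply/eqP; rewrite eqn_leq K1.
    by rewrite divr1 (sf_at1 h_sf) !mulr0.
  by rewrite label_many // muln1 ler_wpM2r.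
- by move=> K00; move: K0; rewrite K00.
Qed.

Let pending_new q : new q -> pending t' q.
Proof.
move=> nq; have i_range : (0 < q - c <= K)%N by move: nq; rewrite /new; clear; lia.
split; rewrite ?levE ?radE ?valE ?nq //.
- rewrite (pd_rad pd) exprS; field.
  by rewrite ?expf_neq0 ?pnatr_eq0.
- by rewrite addr_ge0 ?(pd_val pd) // mulr_ge0.
- case fin: final; last first.
    left; rewrite ltnS; apply: radius_levels pd _.
    by rewrite ltNge -/final fin.
  have K1 := final_one fin.
  have r0 : (if final then 0 else t_rad t p) = 0 by rewrite fin.
  have single : #|members t' q| = 1%N.
    rewrite row_new //; have [y yi] := co_ne ok i_range.
    apply/eqP/cards1P; exists y; apply/finset.setP => z; rewrite !inE.
    apply/eqP/eqP => [zi|->//].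
    have y0 : (0 < mk y)%N by rewrite yi; case/andP: i_range.
    have yz : mk y = mk z by rewrite yi zi.
    have := co_diam ok y0 yz; rewrite r0 mulr0 => dyz.
    apply/esym/(Defs.metric_eq0 d_metric)/eqP.
    by rewrite eq_le dyz (Defs.metric_ge0 d_metric).
  right; split=> //; rewrite ltnS.
  case: (pd_lev pd) => // -[W1 _].
  (* a node already reduced to a point would have been kept *)
  exfalso; move: proper; rewrite K1 /= => /negP; apply.
  have [y y1] := co_ne ok (i := 1%N) (K0 : (0 < 1 <= K)%N).
  have yW : y \in W by apply: (co_mem ok); rewrite y1.
  move/eqP/cards1P: W1 => [z WE].
  apply/forall_inP => z'; rewrite /W WE inE => /eqP ->.
  by move: yW; rewrite /W WE inE => /eqP <-; rewrite y1.
- case fin: final.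
    right; split.
      apply: le_trans fin; rewrite ler_wpM2r //.
      by have := rad_ge0; lra.
    have -> : K = 1%N by apply: final_one.
    rewrite divr1 (sf_at1 h_sf) mulr0 addr0.
    exact: pending_leaf_bound pd fin.
  left; rewrite row_new //; apply: inv_kids => //; first by rewrite fin.
  by case: (pd_good pd) => // -[fin' _]; rewrite -/final fin in fin'.
Qed.

Lemma extend_inv : tree_inv t'.
Proof.
split; rewrite ?cntE ?curE ?flagE.
- by apply/andP; split=> //; rewrite ltnS; apply: leq_trans pc _; apply: leq_addr.
- by rewrite (leq_trans (ti_cnt ti)) // leq_addr.
- move=> q x; rewrite memberE; case: ifP => [/andP[x0 /eqP qE]|no].
    have nq : new q by have := co_le ok x; move: x0; rewrite /new qE; clear; lia.
    by rewrite row_new // inE qE addKn eqxx.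
  rewrite (ti_cell ti); case nq: (new q).
    rewrite (negbTE (ti_fresh ti x _)); last by case/andP: nq.
    rewrite row_new // inE; apply/esym/eqP; rewrite eqb0; apply/negP => /eqP xE; move: no nq.
    by rewrite /new xE; clear; lia.
  by rewrite row_old ?nq.
- move=> q qr; case nq: (new q).
    rewrite row_new //; split.
      have [|y yi] := co_ne ok (i := (q - c)%N); first by move: nq; rewrite /new; clear; lia.
      by exists y; rewrite inE yi.
    move=> x; rewrite inE => /eqP xi.
    have [_ pos] := ti_row ti (q := p) (introT andP (conj p_pos pc)).
    apply: pos; apply: (co_mem ok); rewrite xi; move: nq; rewrite /new; clear; lia.
  rewrite row_old ?nq //; apply: (ti_row ti).
  by move: nq qr; rewrite /new; clear; lia.
- move=> q x qr; rewrite row_old; last by move: qr; rewrite /new; clear; lia.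
  by apply: (ti_fresh ti); apply: leq_ltn_trans qr; rewrite leq_addr.
- move=> q pq; rewrite labelE childE kidsE gtn_eqF //.
  by apply: (ti_open ti); apply: ltnW.
- move=> q qr; rewrite sibE ifF; last by move: qr; rewrite /new; clear; lia.
  by apply: (ti_sib ti); apply: leq_ltn_trans qr; rewrite leq_addr.
- move=> q qr; case nq: (new q); first exact: pending_new.
  apply: (@pending_ext t); rewrite ?levE ?radE ?valE ?nq ?row_old ?nq //.
  by apply: (ti_pending ti); move: nq qr; rewrite /new; clear; lia.
- move=> q /andP[q0]; rewrite ltnS leq_eqVlt => /predU1P[->//|qp].
  apply: (@linked_ext t) => //; rewrite ?labelE ?childE ?kidsE ?cntE ?(ltn_eqF qp) ?flagE //.
  + by rewrite q0.
  + by move=> q' q'c; rewrite row_old ?new_le.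
  + by move=> q' q'c; rewrite sibE new_le.
  + by move=> q' q'c; rewrite valE new_le.
  + by rewrite leq_addr.
- exact: ti_flag.
- by rewrite valE new_le ?(ti_val ti) ?(ti_cnt ti).
Qed.

Lemma extend_weight : (weight t' + #|W| <= weight t)%N.
Proof.
rewrite /weight cntE curE (@big_cat_nat _ _ _ c.+1) /=; [|by rewrite ltnS|by rewrite ltnS leq_addr].
rewrite [leqRHS]big_ltn // -addnA addnC; apply: leq_add; last first.
  rewrite big_nat_cond [leqRHS]big_nat_cond; apply: leq_sum => q /andP[/andP[pq qc] _].
  have oq : new q = false by apply: new_le.
  by rewrite levE oq row_old ?oq.
have lev : (t_lev t p <= max_level.+2)%N by case: (pd_lev pd) => [/leqW|[_]].
pose w := (max_level + 4 - (t_lev t p).+1)%N.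
have wE : (max_level + 4 - t_lev t p = w.+1)%N by rewrite /w; move: lev; clear; lia.
rewrite -/W wE mulnS addnC leq_add2l.
have -> : (\sum_(c.+1 <= q < (c + K).+1) #|members t' q| * (max_level + 4 - t_lev t' q) =
    \sum_(i < K) #|[set y | mk y == i.+1]%SET| * w)%N.
  rewrite -{1}[c.+1]add0n big_addn subSS addKn big_mkord.
  apply: eq_bigr => i _; rewrite addnC kid_row // levE kid_new //.
rewrite -big_distrl /= leq_mul2r; apply/orP; right; exact: children_card ok.
Qed.
End Extend.
End TreeInvariant.

(** * The main loop *)

Section Program.
Variables (R : realType) (h : R -> R) (n : nat).
Variables (d : 'I_n -> 'I_n -> R) (rho : 'I_n -> R).
Hypothesis d_metric : is_metric d.
Hypothesis rho_prob : is_prob rho.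
Hypothesis h_sf : submultiplicative_functional h.
Local Notation D := (diam d [set: 'I_n]%SET).
Local Notation h2 := (h (1 / 2)).
Implicit Types (s : state R).

Definition table_of s : table R :=
  Table (nmem s out_member) (nmem s out_label) (nmem s out_child) (nmem s out_sibling)
    (nmem s a_kids) (nmem s a_lev) (rmem s r_rad) (rmem s r_val)
    (nmem s a_cnt 0) (nmem s a_cur 0) (nmem s a_flag 0).

Lemma table_of_frame NL RL s s' :
  all (fun a => a \notin NL) [:: out_member; out_label; out_child; out_sibling;
    a_kids; a_lev; a_cnt; a_cur; a_flag] ->
  all (fun a => a \notin RL) [:: r_rad; r_val] ->
  frame NL RL s s' -> table_of s' = table_of s.
Proof.
move=> /= /and5P[m l c b /and5P[k v t u /andP[g _]]] /and3P[r w _] [fn fr].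
by congr Table; rewrite ?fn //; apply/funext => q; rewrite ?fn ?fr.
Qed.

Record input_ok s (E : R) : Prop := {
  in_n : nmem s 0 0 = n;
  in_d : forall x y : 'I_n, rmem s 0 (x * n + y) = d x y;
  in_rho : forall x : 'I_n, rmem s 1 x = rho x;
  in_ecc : rmem s r_ecc 0 = E }.

Lemma input_ok_frame NL RL s s' E : 0%N \notin NL ->
  all (fun a => a \notin RL) [:: 0%N; 1%N; r_ecc] ->
  frame NL RL s s' -> input_ok s E -> input_ok s' E.
Proof.
move=> n0 /and4P[r0 r1 r2 _] [fn fr] [i1 i2 i3 i4]; split; rewrite ?fn ?fr //.
- by move=> x y; rewrite fr.
- by move=> x; rewrite fr.
Qed.

Section MainLoop.
Variable E : R.
Hypothesis E_ge0 : 0 <= E.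
Hypothesis E_diam : forall x y, d x y <= 2 * E.
Hypothesis E_le : E <= D.
Hypothesis D_le : D <= 2 * E.

Definition main_inv s : Prop :=
  input_ok s E /\ tree_inv h d rho E (table_of s).

Let current s : {set 'I_n} := members n (table_of s) (nmem s a_cur 0).
Let potential s : nat := weight n (table_of s).

(** A step takes [O(n)] time per point of the current node, and each of these
    points loses a unit of potential. *)
Lemma process_node_spec s : main_inv s -> (nmem s a_cur 0 <= nmem s a_cnt 0)%N ->
  runs h process_node s (2000 * (n * #|current s|)) (fun s' =>
    main_inv s' /\ (potential s' + #|current s| <= potential s)%N).
Proof.
move=> [inp ti] pc.
set t := table_of s in ti.
have cur := ti_cur ti.
have pr : (0 < nmem s a_cur 0 <= nmem s a_cnt 0)%N by rewrite pc andbT; case/andP: cur.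
have pd : pending h d rho E t (nmem s a_cur 0).
  by apply: (ti_pending ti); rewrite /t /= pc leqnn.
have [Wne Wpos] := ti_row ti pr.
have W0 : (0 < #|current s|)%N by apply/card_gt0P; case: Wne => x xW; exists x.
have n0 : (0 < n)%N by case: Wne => x _; apply: leq_ltn_trans (ltn_ord x).
set rad := rmem s r_rad (nmem s a_cur 0).
have rad_ge0 : 0 <= rad by exact (pending_rad_ge0 E_ge0 pd).
have rad0 : 0 < rad \/ rad * n%:R <= rmem s r_ecc 0.
  have [->|r0] := eqVneq rad 0; first by right; rewrite mul0r (in_ecc inp).
  by left; rewrite lt_def r0.
rewrite /process_node; eapply runs_le.
  eapply runs_seq.
    apply: (analyse_node_spec d_metric rho_prob h_sf (in_n inp) (in_d inp) (in_rho inp)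
      (W := current s) _ (erefl rad) rad0 Wpos Wne).
    by move=> x; apply: (ti_cell ti).
  move=> s1 an f1; rewrite (in_ecc inp) in an.
  have inp1 : input_ok s1 E by apply: input_ok_frame f1 inp.
  have t1 : table_of s1 = t by apply: table_of_frame f1.
  have cur1 : nmem s1 a_cur 0 = nmem s a_cur 0 by rewrite (proj1 f1).
  have cnt1 : nmem s1 a_cnt 0 = nmem s a_cnt 0 by rewrite (proj1 f1).
  have rad1 : rmem s1 r_rad (nmem s a_cur 0) = rad by rewrite (proj2 f1).
  have Kle := children_count (an_ok an).
  apply: (@runs_le _ _ _ _ (#|current s| * 200 + n * 100 + 300)); last exact: leqnn.
  have [K0 KW] := (co_pos (an_ok an), children_count (an_ok an)).
  have F1 a : a \notin nwrites analyse_node -> nmem s1 a = nmem s a.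
    by move=> aw; apply/funext => k; rewrite (proj1 f1).
  have G1 a : a \notin rwrites analyse_node -> rmem s1 a = rmem s a.
    by move=> aw; apply/funext => k; rewrite (proj2 f1).
  apply: (@runs_le _ _ _ _ (9 + maxn 100 (#|current s| * 200 + n * 100 + 180)).+1); last by lia.
  apply: runs_if; rewrite /= (an_cov an) => kept.
    have [K1 cov] := andP kept.
    have {}K1 : nmem s1 a_k 0 = 1%N by apply/eqP; rewrite eqn_leq K1.
    apply: (@runs_le _ _ _ _ 100); last exact: leq_maxl.
    have mk1 y : y \in current s -> small_of s1 y = 1%N.
      move=> yW; apply/eqP; rewrite eqn_leq (forall_inP cov _ yW) andbT -K1.
      exact: (co_le (an_ok an)).
    eapply runs_le.
      apply: runs_straight => //; rewrite /= (an_fin an) cur1 rad1 (in_ecc inp1) lt0b.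
      case: ifP => fin /=.
        have single : #|current s| = 1%N.
          case: (Wne) => x xW; apply/eqP/cards1P; exists x.
          apply/finset.setP => y; rewrite [RHS]inE.
          apply/idP/eqP => [yW|->//].
          have x0 : (0 < small_of s1 x)%N by rewrite mk1.
          have xy : small_of s1 x = small_of s1 y by rewrite !mk1.
          have := co_diam (an_ok an) x0 xy; rewrite fin mulr0 => dxy.
          apply/esym/(Defs.metric_eq0 d_metric)/eqP.
          by rewrite eq_le dxy (Defs.metric_ge0 d_metric).
        set s2 := nstore _ _ _ _.
        have tE : table_of s2 = Table (t_member t) (t_label t) (t_child t)
            (t_sibling t) (t_kids t) (t_lev t) (t_rad t) (t_val t) (t_cnt t)
            (t_cur t).+1 (if E * h2 <= t_val t (t_cur t) then t_flag t else 1%N).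
          rewrite /s2 /t /table_of /= -!G1 // -!F1 //.
          case: ifP => low; congr Table; rewrite /upd /= ?addn1 //.
        split; first split.
        - rewrite /s2; case: (inp1) => i1 i2 i3 i4; case: ifP => _; by split.
        - exact: (keep_final_inv d_metric rho_prob h_sf E_ge0 E_le D_le ti pc fin single tE).
        - rewrite /potential /current.
          by apply: (keep_final_weight E_ge0 E_le D_le ti pc); rewrite tE.
      set s2 := nstore _ _ _ _.
      have setE : [set y | small_of s1 y == 1%N]%SET = current s.
        apply/finset.setP => y; rewrite inE; apply/eqP/idP => [y1|/mk1//].
        by apply: (co_mem (an_ok an)); rewrite y1.
      have [] := keep_shrink_inv E_ge0 E_le D_le (t' := table_of s2) ti pc _ _
        _ _ _ _ _ _ _ _ _ _ _ => //.
      - by rewrite ltNge -/rad /t /= -/rad fin.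
      - move=> V inv; have := an_inv an (negbT fin) (V := V) (i := 1%N) inv.
        rewrite K1 /= => /(_ isT).
        by rewrite setE divr1 (sf_at1 h_sf) mulr0 addr0.
      1-5: by apply/funext => q; rewrite /s2 /table_of /= /upd /= F1.
      - by apply/funext => q; rewrite /s2 /table_of /= /upd /= G1.
      - by rewrite /s2 /table_of /= /upd /= F1.
      - by move=> q; rewrite /s2 /table_of /= /upd /= F1 // addn1; case: eqP => // ->.
      - by move=> q; rewrite /s2 /table_of /= /upd /= G1 //; case: eqP => // ->.
      move=> ti2 w2; split=> //; split=> //.
      by case: (inp1) => i1 i2 i3 i4; split.
    by [].
  apply: (@runs_le _ _ _ _ (#|current s| * 200 + n * 100 + 180)); last exact: leq_maxr.
  rewrite /write_children; eapply runs_le.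
    eapply runs_seq; first exact: (write_members_spec h (in_n inp1)).
    move=> s2 mem2 f2.
    have cur2 : nmem s2 a_cur 0 = nmem s a_cur 0 by rewrite (proj1 f2).
    have cnt2 : nmem s2 a_cnt 0 = nmem s a_cnt 0 by rewrite (proj1 f2).
    have k2 : nmem s2 a_k 0 = nmem s1 a_k 0 by rewrite (proj1 f2).
    have rad2 q : rmem s2 r_rad q = rmem s r_rad q by rewrite (proj2 f2) // (proj2 f1).
    have val2 q : rmem s2 r_val q = rmem s r_val q by rewrite (proj2 f2) // (proj2 f1).
    have lev2 q : nmem s2 a_lev q = nmem s a_lev q by rewrite (proj1 f2) // (proj1 f1).
    have sib2 q : nmem s2 out_sibling q = nmem s out_sibling q.
      by rewrite (proj1 f2) // (proj1 f1).
    apply: (@runs_le _ _ _ _ (#|current s| * 200 + 20 + 100)); last exact: leqnn.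
    eapply runs_seq.
      have := write_fields_spec h (s := s2); rewrite cur2 cnt2 k2 => /(_ pc) fields.
      apply: (runs_le fields).
      by rewrite leq_add2r leq_mul2r KW orbT.
    move=> s3 fields3 f3.
    have cur3 : nmem s3 a_cur 0 = nmem s a_cur 0 by rewrite (proj1 f3).
    have cnt3 : nmem s3 a_cnt 0 = nmem s a_cnt 0 by rewrite (proj1 f3).
    have k3 : nmem s3 a_k 0 = nmem s1 a_k 0 by rewrite (proj1 f3).
    have levp : nmem s3 a_lev (nmem s a_cur 0) = nmem s a_lev (nmem s a_cur 0).
      have [-> _ _ _] := fields3 (nmem s a_cur 0).
      by rewrite ifF ?lev2 //; move: pc; clear; lia.
    have inp3 : input_ok s3 E.
      by apply: (input_ok_frame _ _ f3) => //; apply: (input_ok_frame _ _ f2).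
    apply: (@runs_le _ _ _ _ (step_cost link_children)); last by [].
    apply: runs_straight => //.
    set s4 := symbolic _ _ _.
    have f4 : frame [:: out_label; out_child; a_kids; a_cnt; a_cur] [::] s3 s4.
      by rewrite /s4; split=> a k //; rewrite !inE !negb_or => /and5P[a1 a2 a3 a4 a5];
        rewrite /= /upd (negbTE a1) (negbTE a2) (negbTE a3) (negbTE a4) (negbTE a5).
    have old3 a q : a \in [:: out_label; out_child; a_kids] ->
        nmem s3 a q = nmem s a q.
      rewrite !inE => /or3P[] /eqP ->;
        by rewrite (proj1 f3) // (proj1 f2) // F1.
    have lab4 q : nmem s4 out_label q = if q == nmem s a_cur 0
        then (nmem s a_lev (nmem s a_cur 0) * (1 - (2 - nmem s1 a_k 0)))%N
        else nmem s out_label q.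
      by rewrite /s4 /= /upd /= cur3 k3 levp old3.
    have child4 q : nmem s4 out_child q = if q == nmem s a_cur 0
        then (nmem s a_cnt 0).+1 else nmem s out_child q.
      by rewrite /s4 /= /upd /= cur3 cnt3 addn1 old3.
    have kids4 q : nmem s4 a_kids q = if q == nmem s a_cur 0
        then nmem s1 a_k 0 else nmem s a_kids q.
      by rewrite /s4 /= /upd /= cur3 k3 old3.
    have cnt4' : nmem s4 a_cnt 0 = (nmem s a_cnt 0 + nmem s1 a_k 0)%N.
      by rewrite /s4 /= /upd /= cnt3 k3.
    have cur4' : nmem s4 a_cur 0 = (nmem s a_cur 0).+1.
      by rewrite /s4 /= /upd /= cur3 addn1.
    clearbody s4.
    have memE q (x : 'I_n) : nmem s4 out_member (q * n + x) =
        if (0 < small_of s1 x)%N && (q == nmem s a_cnt 0 + small_of s1 x)%N then 1%N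
        else nmem s out_member (q * n + x).
      by rewrite (proj1 f4) // (proj1 f3) // mem2 cnt1 F1.
    have ok : children_ok d (members n t (t_cur t))
        (if t_rad t (t_cur t) * n%:R <= E then 0 else t_rad t (t_cur t))
        (nmem s1 a_k 0) (small_of s1) := an_ok an.
    have lev4 q : t_lev (table_of s4) q =
        if (t_cnt t < q <= t_cnt t + nmem s1 a_k 0)%N
        then (t_lev t (t_cur t)).+1 else t_lev t q.
      rewrite /table_of /= (proj1 f4) //; have [-> _ _ _] := fields3 q.
      by rewrite !lev2.
    have cnt4 : t_cnt (table_of s4) = (t_cnt t + nmem s1 a_k 0)%N.
      exact: cnt4'.
    have cur4 : t_cur (table_of s4) = (t_cur t).+1.
      exact: cur4'.
    split; last exact (extend_weight (t' := table_of s4) ti pc ok memE lev4 cnt4 cur4).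
    split; first by apply: (input_ok_frame _ _ f4).
    apply: (extend_inv (t' := table_of s4) d_metric rho_prob h_sf E_ge0 E_le D_le ti pc ok kept
      (an_final an) (fun nf V i inv ir => an_inv an nf inv ir) memE lev4 _ _ _ _ _ _ cnt4 cur4).
    - move=> q; rewrite /table_of /= (proj2 f4) //; have [_ -> _ _] := fields3 q.
      by rewrite !rad2.
    - move=> q; rewrite /table_of /= (proj2 f4) //; have [_ _ -> _] := fields3 q.
      by rewrite !val2 !rad2.
    - move=> q; rewrite /table_of /= (proj1 f4) //; have [_ _ _ ->] := fields3 q.
      by rewrite !sib2.
    - exact: lab4.
    - exact: child4.
    - exact: kids4.
    - by rewrite /table_of /= (proj1 f4) // (proj1 f3) // (proj1 f2) // F1.
  by rewrite /=; lia.
by rewrite /=; move: n0 W0; move: (#|current s|) => w; clear; nia.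
Qed.

Lemma main_loop_spec s : main_inv s ->
  runs h (CWhile (BNle (nvar a_cur) (nvar a_cnt)) process_node) s
    (2010 * (n * potential s) + 6)
    (fun s' => main_inv s' /\ (nmem s' a_cnt 0 < nmem s' a_cur 0)%N).
Proof.
move=> inv; apply: (@runs_mono _ _ _ _ _ _ (fun s' => main_inv s' /\
  beval h s' (BNle (nvar a_cur) (nvar a_cnt)) = false)).
- apply: (runs_while (phi := fun s' => (2010 * (n * potential s'))%N)) => // s1 inv1 /= pc.
  have spec := process_node_spec inv1 pc.
  have [_ [s2 [_ _ [_ lt]]]] := spec.
  have W0 : (0 < #|current s1|)%N.
    have [_ ti] := inv1; have cur := ti_cur ti.
    have [|[x xW] _] := ti_row ti (q := nmem s1 a_cur 0).
      by rewrite pc andbT; case/andP: cur.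
    by apply/card_gt0P; exists x.
  have n0 : (0 < n)%N.
    by have /card_gt0P[x _] := W0; apply: leq_ltn_trans (ltn_ord x).
  exists (2000 * (n * #|current s1|))%N.
  have bound m : (m + #|current s1| <= potential s1)%N ->
    (2000 * (n * #|current s1|) + 6 + 2010 * (n * m) <= 2010 * (n * potential s1))%N.
    move: n0 W0; move: (#|current s1|) (potential s1) => w p; clear => n0 w0 mw.
    apply: (@leq_trans (2010 * (n * (m + w)))); last by rewrite !leq_mul2l mw !orbT.
    have nw : (0 < n * w)%N by rewrite muln_gt0 n0.
    by rewrite mulnDr; move: (n * w)%N (n * m)%N nw => a b; clear; lia.
  split; first by apply: leq_trans (bound _ lt); rewrite leq_addr.
  by apply: runs_mono spec (leqnn _) _ => s3 [inv3 lt3]; split=> //; apply: bound.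
- exact: leqnn.
- by move=> s' [inv' /=]; rewrite leqNgt => /negbFE.
Qed.
End MainLoop.

(** ** The initial state *)

Lemma input_cells s : s = input d rho -> forall x y : 'I_n, rmem s 0 (x * n + y) = d x y.
Proof.
move=> -> x y /=.
have n0 : (0 < n)%N by apply: leq_ltn_trans (ltn_ord x).
rewrite divnMDl // divn_small // addn0 modnMDl modn_small //.
by rewrite !valK.
Qed.

(** The eccentricity [E] of a point stands for the diameter, which it determines up
    to a factor 2. *)
Lemma find_far_spec (x0 : 'I_n) : x0 = 0%N :> nat ->
  runs h find_far (input d rho) (n * 60 + 60) (fun s =>
    (exists u : 'I_n, nmem s a_far 0 = u /\ rmem s r_ecc 0 = d x0 u) /\
    forall y, d x0 y <= rmem s r_ecc 0).
Proof.
move=> x00; set s0 := input d rho.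
pose I j s := (exists u : 'I_n, nmem s a_far 0 = u /\ rmem s r_ecc 0 = d x0 u) /\
    forall y : 'I_n, (y < j)%N -> d x0 y <= rmem s r_ecc 0.
eapply runs_le.
  apply: (@runs_mono _ _ _ _ _ _ (I n)).
  - apply: (runs_for_points_const (n := n) (I := I)) => //.
      split=> //; exists x0; split; first by rewrite x00.
      by have -> : d x0 x0 = 0 by exact/(Defs.metric_eq0 d_metric).
    move=> x s1 xE f1 [[u [uE eE]] I1].
    have d1 : rmem s1 0 (0 * n + x) = d x0 x.
      by have := input_cells (erefl s0) x0 x; rewrite x00 (proj2 f1).
    have n1 : nmem s1 0 0 = n by rewrite (proj1 f1).
    apply: runs_straight => // _; rewrite /I /= xE n1 d1.
    case: ifP => /= [|/negbFE] far.
      rewrite -ltNge in far; split.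
        by exists x; split; rewrite /upd //= n1 xE.
      move=> y; rewrite /upd /= ?n1 ?xE ?d1 ord_ltS => /orP[/eqP->//|/I1 le].
      exact: le_trans le (ltW far).
    split; first by exists u.
    by move=> y; rewrite ord_ltS => /orP[/eqP->//|/I1].
  - exact: leqnn.
  - by move=> s' [u1 I1]; split=> // y; apply: I1.
by rewrite /=; lia.
Qed.

Section Root.
Variable E : R.
Hypothesis E_ge0 : 0 <= E.
Hypothesis E_diam : forall x y, d x y <= 2 * E.

Lemma make_root_spec s0 : input_ok s0 E ->
  (forall a k, a \notin [:: 0%N; i_y; a_far] -> nmem s0 a k = 0%N) ->
  (forall a k, a \notin [:: 0%N; 1%N; r_ecc] -> rmem s0 a k = 0) ->
  runs h make_root s0 (n * 60 + 100) (fun s =>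
    main_inv E s /\ (weight n (table_of s) <= n * (max_level n + 3))%N).
Proof.
move=> inp nz rz; rewrite /make_root; eapply runs_le.
  pose I j s := forall q (x : 'I_n), nmem s out_member (q * n + x) =
    [&& (x < j)%N, q == 1%N & 0 < rho x].
  eapply runs_seq.
    apply: (runs_for_points_const (n := n) (I := I)) => //; first exact: in_n inp.
      by move=> q x; rewrite /= /upd /= nz.
    move=> y s1 yE f1 I1.
    have n1 : nmem s1 0 0 = n by rewrite (proj1 f1) // (in_n inp).
    have r1 : rmem s1 1 y = rho y by rewrite (proj2 f1) // (in_rho inp).
    apply: runs_straight => // _ q x; rewrite /= yE n1 r1 -ltNge ord_ltS.
    case: ifP => ry; rewrite /= /upd /= I1.
      rewrite cell_inj; have [->|xy] := eqVneq x y => /=; last by rewrite andbF.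
      by rewrite ltnn ry !andbT; case: (q == 1%N).
    by have [->|] := eqVneq x y => //=; rewrite ry ltnn !andbF.
  move=> s1 I1 f1.
  have inp1 : input_ok s1 E by apply: input_ok_frame f1 inp.
  apply: runs_straight => //.
  set s2 := symbolic _ _ _.
  have mem2 q (x : 'I_n) : nmem s2 out_member (q * n + x) = (q == 1%N) && (0 < rho x).
    by rewrite /s2 /= /upd /= I1 ltn_ord.
  have lev2 q : nmem s2 a_lev q = (q == 1%N).
    by rewrite /s2 /= /upd /=; case: eqP => //= _; rewrite (proj1 f1) ?nz.
  have rad2 q : rmem s2 r_rad q = if q == 1%N then E / 10 else 0.
    by rewrite /s2 /= /upd /= (in_ecc inp1); case: eqP => //= _; rewrite (proj2 f1) ?rz.
  have val2 q : rmem s2 r_val q = 0 by rewrite /s2 /= /upd /= (proj2 f1) ?rz.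
  have z2 a q : a \in [:: out_label; out_child; out_sibling; a_kids; a_flag] ->
      nmem s2 a q = 0%N.
    rewrite /s2 !inE => /or4P[/eqP->|/eqP->|/eqP->|/orP[/eqP->|/eqP->]];
      by rewrite /= /upd /= (proj1 f1) ?nz.
  have cnt2 : nmem s2 a_cnt 0 = 1%N by [].
  have cur2 : nmem s2 a_cur 0 = 1%N by [].
  have inp2 : input_ok s2 E by case: (inp1) => *; split.
  clearbody s2.
  have row2 q : members n (table_of s2) q = if q == 1%N then [set x | 0 < rho x]%SET
      else finset.set0.
    apply/finset.setP => x; rewrite inE /= mem2; case: (q == 1%N); rewrite !inE //=.
    by case: (0 < rho x).
  split; last first.
    rewrite /weight /= cnt2 cur2 big_nat1 lev2 eqxx row2 eqxx.
    rewrite leq_mul //; last by clear; lia.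
    by rewrite -[X in (_ <= X)%N](card_ord n) max_card.
  split=> //; split; rewrite /= ?cnt2 ?cur2 //.
  - by move=> q x; rewrite mem2 row2; case: (q == 1%N); rewrite !inE.
  - move=> q q1; have -> : q = 1%N by move: q1; clear; lia.
    rewrite row2 eqxx; split; last by move=> x; rewrite inE.
    have [[x xW] _ _ _] := node_inv_root d_metric rho_prob h_sf E_diam erefl E_ge0.
    by exists x.
  - by move=> q x q1; rewrite row2 gtn_eqF // inE.
  - by move=> q _; rewrite !z2.
  - by move=> q _; rewrite z2.
  - move=> q q1; have -> : q = 1%N by move: q1; clear; lia.
    split; rewrite /= ?lev2 ?rad2 ?val2 ?row2 ?eqxx ?expr1 //.
      by left.
    left; exact: (node_inv_root d_metric rho_prob h_sf E_diam erefl E_ge0).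
  - by move=> q; case: q => [|[]].
  - by rewrite z2.
by rewrite /=; lia.
Qed.
End Root.
End Program.

(** * The output *)

(** ** The two-leaf tree *)

Section Fallback.
Variables (R : realType) (h : R -> R) (n : nat) (d : 'I_n -> 'I_n -> R).
Hypothesis d_metric : is_metric d.
Hypothesis h_sf : submultiplicative_functional h.
Variables (x0 u : 'I_n) (E : R).
Hypotheses (E_gt0 : 0 < E) (E_far : d x0 u = E).
Local Notation D := (diam d [set: 'I_n]%SET).
Hypotheses (E_le : E <= D) (D_le : D <= 2 * E).

Let V (q : nat) : {set 'I_n} :=
  if q == 1%N then [set x0; u]%SET else if q == 2%N then [set x0]%SET else [set u]%SET.
Let nk (q : nat) : nat := if q == 1%N then 2%N else 0%N.

(** Two points at distance [E >= D / 2] are far enough apart to be the children of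
    a root labelled 0, whose gain [D * h (1/2)] is at least [E * h (1/2)]. *)
Definition fallback : ptree 'I_n :=
  PNode [set x0; u]%SET 0 [:: PNode [set x0]%SET 0 [::]; PNode [set u]%SET 0 [::]].

(* The table has the root at address 1 and the leaves at 2 and 3. *)
Let fallbackE : fallback = table_tree V (fun=> 0%N) (fun=> 2%N) nk 3 1.
Proof. by []. Qed.

Let far : x0 != u.
Proof.
apply/eqP => e; move: E_far; rewrite e.
have -> : d u u = 0 by exact/(Defs.metric_eq0 d_metric).
by move=> E0; move: E_gt0; rewrite -E0 ltxx.
Qed.

Let entries p : (0 < p)%N -> (p <= 3)%N ->
  entry_ok d (1 / 10) V (fun=> 0%N) (fun=> 2%N) nk 3 p.
Proof.
case: p => [//|[|[|[|//]]]] _ _.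
- split=> //; first by exists x0; rewrite !inE eqxx.
  right; split=> //; split=> //.
  + by case=> [|[|//]] _; [exists x0|exists u]; rewrite !inE.
  + by case=> [|[|//]] _; apply/fintype.subsetP => y; rewrite !inE => ->; rewrite ?orbT.
  + have d00 x : d x x = 0 by exact/(Defs.metric_eq0 d_metric).
    have pos : 0 <= (1 / 10) ^+ 1 * D by rewrite expr1; have := E_le; have := E_gt0; lra.
    by case=> [|[|//]] x y _; rewrite !inE => /eqP-> /eqP->; rewrite d00.
  + have sep : 10^-1 * (1 / 10) ^+ 0 * D <= E.
      by rewrite expr0 mulr1 mulrC ler_pdivrMr //; have := D_le; have := E_gt0; lra.
    move=> [|[|//]] [|[|//]] x y _ _ // _; rewrite !inE => /eqP-> /eqP->; split=> //.
    * by rewrite E_far.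
    * by rewrite eq_sym.
    * by rewrite (Defs.metric_sym d_metric) E_far.
- by split=> //; [exists x0; rewrite !inE|left; rewrite cards1].
- by split=> //; [exists u; rewrite !inE|left; rewrite cards1].
Qed.

Lemma fallback_packing : packing_tree d (1 / 10) fallback.
Proof. by rewrite fallbackE; apply: (table_tree_packing entries). Qed.

Lemma fallback_val : E * h (1 / 2) <= tree_val d (1 / 10) h fallback.
Proof.
have h2 := half_functional_ge0 h_sf.
pose val (q : nat) : R := if q == 1%N then 0 else E * h (1 / 2).
have a0 : 0 <= 1 / 10 :> R by lra.
have D0 : 0 <= D by apply: le_trans E_le; apply: ltW.
have hk k := functional_inv_ge0 (k := k) h_sf.
rewrite fallbackE; apply: (table_tree_val entries a0 D0 hk (val := val)) => //.
- by move=> p pr; rewrite /nk /val; case: eqP.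
- move=> p i pr; rewrite /nk /val /kid; case: eqP => // _ _.
  by rewrite add2n /= add0r expr0; apply: ler_wpM2r => //; rewrite mul1r.
Qed.
End Fallback.

(** ** Reading the result *)

Section Output.
Variables (R : realType) (h : R -> R) (n : nat).
Variables (d : 'I_n -> 'I_n -> R) (rho : 'I_n -> R) (E : R).
Hypothesis d_metric : is_metric d.
Hypothesis rho_prob : is_prob rho.
Hypothesis h_sf : submultiplicative_functional h.
Local Notation D := (diam d [set: 'I_n]%SET).
Local Notation h2 := (h (1 / 2)).
Hypothesis E_ge0 : 0 <= E.
Hypotheses (E_le : E <= D) (D_le : D <= 2 * E).
Variables (x0 u : 'I_n).
Hypotheses (x0_0 : x0 = 0%N :> nat) (E_far : d x0 u = E).

Definition good_output (s : state R) : Prop := exists T : ptree 'I_n,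
  [/\ outputs s T, packing_tree d (1 / 10) T &
      (delta d h rho <= (1810 * tree_val d (1 / 10) h T)%:E)%E].

(** If every leaf has value at least [E * h2], the term [130 * (E * h2)] in the
    bound at a leaf is absorbed by the value, and [1810 = 130 + 1680]. *)
Lemma main_tree_good s : main_inv h d rho E s ->
  (nmem s a_cnt 0 < nmem s a_cur 0)%N -> nmem s a_flag 0 = 0%N ->
  good_output (nstore s out_root 0 1).
Proof.
move=> [inp ti] done flag; set t := table_of s in ti.
have lk q : (0 < q)%N -> (q <= t_cnt t)%N -> linked h d rho E t q.
  by move=> q0 qc; apply: (ti_linked ti); rewrite q0; apply: leq_ltn_trans qc done.
have entries q q0 qc := lk_entry (lk q q0 qc).
have c0 := ti_cnt ti.
have range q : (0 < q <= t_cnt t)%N -> linked h d rho E t q.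
  by case/andP; apply: lk.
set T := table_tree (members n t) (t_label t) (t_child t) (t_kids t) (t_cnt t) 1.
have fuel : (t_cnt t < 1 + t_cnt t)%N by rewrite add1n.
have a0 : 0 <= 1 / 10 :> R by lra.
have D0 := le_trans E_ge0 E_le.
have hk k := functional_inv_ge0 (k := k) h_sf.
exists T; split.
- rewrite /outputs /=; apply: (table_tree_stored (cnt := t_cnt t)) => //.
  + by move=> p x pr; exact (ti_cell ti p x).
  + move=> p pr; rewrite -[nmem _ _ _]/(t_child t p).
    by case: eqP => // k0; apply: (lk_nochild (range p pr)).
  + by move=> p i pr ik; exact (lk_sib (range p pr) ik).
  + move=> p pr kp; have [_ _ [[k0 _]|[_ io]]] := lk_entry (range p pr).
      by rewrite k0 in kp.
    by split; [exact: io_fwd io|exact: io_cnt io].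
- exact: (table_tree_packing entries).
- have lower c : (forall p, (0 < p <= t_cnt t)%N -> t_kids t p = 0%N -> c <= t_val t p) ->
      c <= tree_val d (1 / 10) h T.
    move=> leafc; apply: (table_tree_val entries a0 D0 hk (val := t_val t)) => //.
    + by move=> p i pr; apply: (lk_val (range p pr)).
    + exact: ti_val ti.
  have leaf p : (0 < p <= t_cnt t)%N -> t_kids t p = 0%N ->
      (delta d h rho <= (1810 * t_val t p)%:E)%E.
    move=> pr kp; have [lb fl] := lk_leaf (range p pr) kp.
    by apply: le_trans lb _; rewrite lee_fin; have := fl flag; lra.
  case: (delta d h rho) leaf => [r| |] leaf; last exact: leNye.
    rewrite lee_fin mulrC -ler_pdivrMr; last by lra.
    apply: lower => p pr kp; have := leaf p pr kp.
    by rewrite lee_fin => le; lra.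
  have : tree_val d (1 / 10) h T + 1 <= tree_val d (1 / 10) h T.
    by apply: lower => p pr kp; have := leaf p pr kp.
  by rewrite gerDl ler10.
Qed.

(** A leaf of value below [E * h2] bounds [delta] by [1810 * (E * h2)], and the
    two-leaf tree has value at least [E * h2]. *)
Lemma fallback_good s s' : main_inv h d rho E s -> nmem s a_far 0 = u ->
  (nmem s a_cnt 0 < nmem s a_cur 0)%N -> (0 < nmem s a_flag 0)%N ->
  s' = symbolic h fallback_tree s -> good_output s'.
Proof.
move=> [inp ti] farE done flag s'E; set t := table_of s in ti.
have [E_gt0 bound] := ti_flag ti flag.
have n1 := in_n inp.
set c := nmem s a_cnt 0 in done.
have fresh q (x : 'I_n) : (c < q)%N -> nmem s out_member (q * n + x) = 0%N.
  by move=> cq; have := ti_cell ti q x; rewrite (negbTE (ti_fresh ti x _)).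
exists (fallback x0 u); split.
- have x0E : 0%N = x0 by rewrite x0_0.
  have mem q (x : 'I_n) : (c < q)%N -> nmem s' out_member (q * n + x) =
     ((q == c + 1) && ((x == x0) || (x == u))) ||
     ((q == c + 2) && (x == x0)) || ((q == c + 3) && (x == u))%N.
    have cx0 k : (q * n + x == k * n + 0)%N = (q == k) && (x == x0).
      by rewrite -x0_0 cell_inj.
    move=> cq; rewrite s'E /= /upd /= n1 farE -/c !cx0 !cell_inj fresh //.
    by case: (q == (c + 1)%N); case: (q == (c + 2)%N); case: (q == (c + 3)%N);
      case: (x == x0); case: (x == u).
  have cur_le q : (c < q)%N -> (t_cur t <= q)%N.
    by case/andP: (ti_cur ti) => _ cur cq; apply: leq_trans cur cq.
  have lab q : (c < q)%N -> nmem s' out_label q = 0%N.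
    by move=> /cur_le/(ti_open ti)[lab _ _]; rewrite s'E.
  have child q : (c < q)%N -> nmem s' out_child q = if q == (c + 1)%N then (c + 2)%N else 0%N.
    move=> /cur_le/(ti_open ti)[_ ch _]; rewrite s'E /= /upd /= -/c.
    by case: eqP => // _; exact: ch.
  have sib q : (c < q)%N -> nmem s' out_sibling q = if q == (c + 2)%N then (c + 3)%N else 0%N.
    move=> cq; have sb := ti_sib ti cq; rewrite s'E /= /upd /= -/c.
    by case: eqP => // _; exact: sb.
  have root : nmem s' out_root 0 = (c + 1)%N by rewrite s'E.
  clear s'E.
  have lt i : (0 < i)%N -> (c < c + i)%N by rewrite -{1}[c]addn0 ltn_add2l.
  have neq i j : (c + i == c + j)%N = (i == j) by rewrite eqn_add2l.
  have sib2 : nmem s' out_sibling (c + 2) = (c + 3)%N by rewrite sib ?lt ?eqxx.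
  have sib3 : nmem s' out_sibling (c + 3) = 0%N by rewrite sib ?lt ?neq.
  have child1 : nmem s' out_child (c + 1) = (c + 2)%N by rewrite child ?lt ?eqxx.
  rewrite /outputs root /fallback /= child1 sib2 sib3; split; rewrite ?lab ?lt //.
  + by rewrite addn1.
  + by move=> x; rewrite mem ?lt // !neq /= !inE orbF orbF.
  split.
    split; rewrite ?child ?lab ?lt ?neq //.
    + by rewrite addn2.
    + by move=> x; rewrite mem ?lt // !neq /= !inE orbF.
  split=> //; split; rewrite ?child ?lab ?lt ?neq //.
  + by rewrite addn3.
  + by move=> x; rewrite mem ?lt // !neq /= !inE.
- exact: (fallback_packing d_metric E_gt0 E_far E_le D_le).
- apply: le_trans bound _; rewrite lee_fin.
  by have := fallback_val d_metric h_sf E_gt0 E_far E_le D_le; lra.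
Qed.
End Output.

(** As [n >= 2], the [3] extra levels are at most [3 * ln n / ln 2]. *)
Lemma levels_time (R : realType) (C n time : nat) : (1 < n)%N ->
  (time <= C * (n * n * (max_level n + 3)))%N ->
  time%:R <= C%:R * 4 / ln 2 * (n%:R ^+ 2 * ln n%:R) :> R.
Proof.
move=> n1 time_le.
have n0 : (0 < n)%N by apply: ltnW.
have ln2 : 0 < ln 2 :> R by rewrite ln_gt0 // ltr1n.
have lvl : (max_level n)%:R * ln 2 <= ln n%:R :> R.
  rewrite mulrC mulr_natr -lnXn ?ltr0n // ler_ln ?posrE ?exprn_gt0 ?ltr0n //.
  by rewrite -natrX ler_nat trunc_logP.
have ln2n : ln 2 <= ln n%:R :> R by rewrite ler_ln ?posrE ?ltr0n // ler_nat.
apply: (@le_trans _ _ (C%:R * (n%:R * n%:R * ((max_level n)%:R + 3)))).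
  by rewrite -!natrM -natrD -natrM -natrM ler_nat.
have -> : C%:R * 4 / ln 2 * (n%:R ^+ 2 * ln n%:R) =
    C%:R * (n%:R * n%:R * (4 * ln n%:R / ln 2)) :> R by ring.
apply: ler_wpM2l; first exact: ler0n.
apply: ler_wpM2l; first by rewrite -natrM ler0n.
by rewrite ler_pdivlMr //; lra.
Qed.

Theorem theorem1p9 (R : realType) :
  exists (c : R) (algorithm : cmd) (K : R), 0 < c /\
  forall h : R -> R,
    log_concave_chaining_functional h -> normalized_at1 h ->
  forall (n : nat) (d : 'I_n -> 'I_n -> R) (rho : 'I_n -> R),
    is_metric d -> is_prob rho ->
  exists (time : nat) (final : state R) (T : ptree 'I_n),
    [/\ exec h algorithm (input d rho) time final,
        (1 < n)%N -> time%:R <= K * (n%:R ^+ 2 * ln n%:R),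
        outputs final T,
        packing_tree d (1 / 10) T &
        (delta d h rho <= (c * tree_val d (1 / 10) h T)%:E)%E].
Proof.
exists 1810, packing_algorithm, (3000%:R * 4 / ln 2); split; first by lra.
move=> h /log_concave_submultiplicative h_sf _ n d rho d_metric rho_prob.
have n0 : (0 < n)%N.
  case: n d rho d_metric rho_prob => // d rho _ [_]; rewrite big_ord0 => /esym/eqP.
  by rewrite oner_eq0.
pose x0 : 'I_n := Ordinal n0.
have run : runs h packing_algorithm (input d rho)
    (3000 * (n * n * (max_level n + 3))) (@good_output R h n d rho).
  rewrite /packing_algorithm; eapply runs_le.
    eapply runs_seq; first exact: (find_far_spec h rho d_metric (erefl : x0 = 0%N :> nat)).
    move=> s1 [[u [farE eccE]] ecc_max] f1.
    set E := rmem s1 r_ecc 0 in eccE ecc_max.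
    have E_ge0 : 0 <= E by rewrite eccE (Defs.metric_ge0 d_metric).
    have E_diam x y : d x y <= 2 * E.
      have := Defs.metric_triangle d_metric x x0 y.
      rewrite (Defs.metric_sym d_metric x x0).
      by have := ecc_max x; have := ecc_max y; lra.
    have D_le : diam d [set: 'I_n]%SET <= 2 * E.
      by apply: diam_le => //; exists x0; rewrite inE.
    have E_le : E <= diam d [set: 'I_n]%SET.
      apply: ub_le_sup; last by exists x0, u; rewrite !inE.
      by exists (2 * E) => _ [x [y [_ _ ->]]].
    have inp1 : input_ok d rho s1 E.
      split=> //.
      - by rewrite (proj1 f1).
      - by move=> x y; rewrite (proj2 f1) // (input_cells (erefl (input d rho))).
      - by move=> x; rewrite (proj2 f1) //= valK.
    apply: (@runs_le _ _ _ _
      (n * 60 + 100 + (2010 * (n * (n * (max_level n + 3))) + 6 + 200))); last exact: leqnn.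
    eapply runs_seq.
      apply: (make_root_spec d_metric rho_prob h_sf E_ge0 E_diam inp1).
        move=> a k; rewrite !inE !negb_or => /and3P[a0 ay af].
        rewrite (proj1 f1) /=; first by rewrite (negbTE a0).
        by rewrite !inE !negb_or ay af.
      move=> a k; rewrite !inE !negb_or => /and3P[a0 a1 ae].
      rewrite (proj2 f1) /=; last by rewrite !inE (negbTE ae).
      by case: a a0 a1 ae => [|[|a]].
    move=> s2 [inv2 w2] f2.
    have far2 : nmem s2 a_far 0 = u by rewrite (proj1 f2).
    eapply runs_seq.
      apply: runs_le.
        exact: (main_loop_spec d_metric rho_prob h_sf E_ge0 E_le D_le inv2).
      by rewrite leq_add2r !leq_mul2l w2 !orbT.
    move=> s3 [inv3 done3] f3.
    have far3 : nmem s3 a_far 0 = u by rewrite (proj1 f3).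
    have x0E : x0 = 0%N :> nat by [].
    apply: (@runs_le _ _ _ _ (step_cost finish)); last by [].
    apply: runs_straight => //.
    have -> : symbolic h finish s3 = if (0 < nmem s3 a_flag 0)%N
      then symbolic h fallback_tree s3 else nstore s3 out_root 0 1 by [].
    case: ifP => flag.
      exact (fallback_good d_metric h_sf E_le D_le x0E (esym eccE) inv3 far3 done3 flag erefl).
    apply: (main_tree_good h_sf E_ge0 E_le inv3 done3).
    by apply/eqP; rewrite -leqn0 leqNgt flag.
  rewrite -[(n * n * _)%N]mulnA; have nN : (n <= n * (n * (max_level n + 3)))%N.
    by rewrite leq_pmulr // muln_gt0 n0 addn3.
  have := n0; move: (n * (n * _))%N nN => N; clear; lia.
have [time [final [ex time_le [T [out pack val]]]]] := run.
exists time, final, T; split=> // n1.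
exact: levels_time.
Qed.
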